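(* Let $X$ be a Banach space, $F:\mathbb{R}^{n+1}_+\to X$ and $G:\mathbb{R}^{n+1}_+\to X'$ strongly measurable, and $q\in(0,\infty)$. Then $$\iint_{\mathbb{R}^{n+1}_+}|\langle F(y,t),G(y,t)\rangle|\,\frac{dy\,dt}{t}\lesssim\int_{\mathbb{R}^n}C_q(F)(x)\,A(G)(x)\,dx,$$ with implicit constant independent of $F,G$.
   Context: $\Gamma(x):=\{(y,t)\in\mathbb{R}^{n+1}_+:|y-x|<t\}$, $\Gamma^h(x):=\{(y,t)\in\Gamma(x):t<h\}$. Gauss norm (for a Banach space $Z$, here $Z=X$ or $X'$): $H=L^2(\mathbb{R}^{n+1}_+,\,dy\,dt/t^{n+1})$, $(\gamma_j)$ independent complex standard Gaussians; for $T\in\mathcal{L}(H,Z)$, $\|T\|_{\gamma(H,Z)}:=\|\sum_j\gamma_jTe_j\|_{L^2(\Omega;Z)}$ when this converges for an orthonormal basis $(e_j)$. For strongly measurable weakly-$L^2$ $\Phi:\mathbb{R}^{n+1}_+\to Z$, $I_\Phi h:=$ Pettis-$\int\Phi h\,dy\,dt/t^{n+1}$, $\|\Phi\|_{\gamma(Z)}:=\|I_\Phi\|_{\gamma(H,Z)}$, and $\infty$ otherwise. $A(F)(x):=\|F1_{\Gamma(x)}\|_{\gamma(X)}$, $A(F|h)(x):=\|F1_{\Gamma^h(x)}\|_{\gamma(X)}$ (similarly $A(G)$ with $\gamma(X')$), and $C_q(F)(x):=\sup_{B\ni x}\big(\frac1{|B|}\int_BA(F|r(B))(y)^q\,dy\big)^{1/q}$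 over open balls $B\ni x$ of radius $r(B)$. *)

(* Defs.v *)
From HB Require Import structures.
From mathcomp Require Import all_boot all_order all_algebra.
From mathcomp Require Import complex.
From mathcomp Require Import all_classical all_reals all_analysis.
Set Implicit Arguments. Unset Strict Implicit. Unset Printing Implicit Defensive.
Import Order.TTheory GRing.Theory Num.Theory.
Import numFieldNormedType.Exports.
Local Open Scope classical_set_scope.
Local Open Scope ring_scope.

Section Defs.
Variable R : realType.
Local Notation C := R[i].

Definition cre (z : C) : R := complex.Re z.
Definition cim (z : C) : R := complex.Im z.
Definition cmk (a b : R) : C := complex.Complex a b.
Definition cconj (z : C) : C := cmk (cre z) (- cim z).
Definition cabs (z : C) : R := Num.sqrt (cre z ^+ 2 + cim z ^+ 2).
Definition rc (a : R) : C := cmk a 0.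

Definition cmeasurable d (T : measurableType d) (D : set T) (f : T -> C) :=
  measurable_fun D (cre \o f) /\ measurable_fun D (cim \o f).

Definition cint d (T : measurableType d) (mu : {measure set T -> \bar R})
  (D : set T) (f : T -> C) : C :=
  cmk (Rintegral mu D (cre \o f)) (Rintegral mu D (cim \o f)).

Definition edist n (a b : n.-tuple R) : R :=
  Num.sqrt (\sum_(i < n) (tnth a i - tnth b i) ^+ 2).

(* [lam] is Lebesgue measure on R^n (on the Borel sets): it gives every
   half-open box its volume.  Such a measure exists and is unique. *)
Definition is_lebesgue_n n (lam : {measure set (n.-tuple R) -> \bar R}) :=
  forall a b : n.-tuple R, (forall i, tnth a i <= tnth b i) ->
    lam [set x | forall i, tnth a i < tnth x i <= tnth b i] =
    (\prod_(i < n) (tnth b i - tnth a i))%:E.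

Definition eball n (c : n.-tuple R) (r : R) : set (n.-tuple R) :=
  [set x | edist x c < r].

(** ** Upper half space R^{n+1}_+ : a point w = (t, y) is stored as the
    tuple t :: y (so t = thead w, y = behead w). *)
Definition ht (n : nat) (w : n.+1.-tuple R) : R := thead w.
Definition hy (n : nat) (w : n.+1.-tuple R) : n.-tuple R := [tuple of behead w].
Definition uhs n : set (n.+1.-tuple R) := [set w | 0 < ht w].
Arguments uhs n : clear implicits.

(* the measure dy dt / t^{n+1} on uhs, written through Lebesgue measure lam1
   on R^{n+1} *)
Definition wt n (w : n.+1.-tuple R) : R := (ht w ^+ n.+1)^-1.

Section Hilbert.
Variable n : nat.
Variable lam1 : {measure set (n.+1.-tuple R) -> \bar R}.

Definition Hnorm2 (h : n.+1.-tuple R -> C) : \bar R :=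
  (\int[lam1]_(w in uhs n) ((cabs (h w)) ^+ 2 * wt w)%:E)%E.

Definition inH (h : n.+1.-tuple R -> C) : Prop :=
  cmeasurable (uhs n) h /\ (Hnorm2 h < +oo)%E.

Definition Hint (f : n.+1.-tuple R -> C) : C :=
  cint lam1 (uhs n) (fun w => f w * rc (wt w)).

Definition Hip (f g : n.+1.-tuple R -> C) : C :=
  Hint (fun w => f w * cconj (g w)).

Definition is_ONB (e : nat -> n.+1.-tuple R -> C) : Prop :=
  [/\ forall j, inH (e j),
      forall i j, Hip (e i) (e j) = (if i == j then 1 else 0) &
      forall h, inH h -> (forall j, Hip h (e j) = 0) -> Hnorm2 h = 0%E].
End Hilbert.

(* g is a sequence of independent real standard Gaussians on (Omega, P);
   gamma_j := (g_{2j} + i g_{2j+1}) / sqrt 2 are then independent complex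
   standard Gaussians. *)
Definition iid_std_gauss dO (Omega : measurableType dO)
  (P : probability Omega R) (g : nat -> Omega -> R) : Prop :=
  [/\ forall j, measurable_fun setT (g j),
      forall j (B : set R), measurable B ->
        P (g j @^-1` B) = normal_prob 0 1 B &
      forall (J : seq nat) (B : nat -> set R), uniq J ->
        (forall j, measurable (B j)) ->
        P (\bigcap_(j in [set j | j \in J]) (g j @^-1` B j)) =
        (\prod_(j <- J) P (g j @^-1` B j))%E].

Definition cgauss (Omega : Type) (g : nat -> Omega -> R) (j : nat)
  (om : Omega) : C :=
  cmk (g j.*2 om / Num.sqrt 2) (g j.*2.+1 om / Num.sqrt 2).

(** ** Generic Banach space Z (a subspace S of an lmodType with norm nZ) *)
Section GammaNorm.
Variable Z : lmodType C.
Variable S : set Z.      (* the Banach space itself inside Z *)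
Variable nZ : Z -> R.

Definition is_dual (phi : Z -> C) : Prop :=
  (forall (a : C) u v, S u -> S v -> phi (a *: u + v) = a * phi u + phi v) /\
  exists c : R, forall z, S z -> cabs (phi z) <= c * nZ z.

Definition strongly_measurable d (T : measurableType d) (D : set T)
  (Phi : T -> Z) : Prop :=
  (forall w, D w -> S (Phi w)) /\
  exists s : nat -> T -> Z,
    [/\ forall k w, S (s k w),
        forall k, finite_set (range (s k)),
        forall k z, measurable (D `&` (s k @^-1` [set z])) &
        forall w, D w -> (fun k => nZ (s k w - Phi w)) @ \oo --> (0 : R)].

Variable n : nat.
Variable lam1 : {measure set (n.+1.-tuple R) -> \bar R}.
Local Notation T := (n.+1.-tuple R).

Definition weakly_L2 (Phi : T -> Z) : Prop :=
  forall phi, is_dual phi -> inH lam1 (phi \o Phi).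

(* Iop is the operator I_Phi : H -> Z, h |-> Pettis-int Phi h *)
Definition is_IPhi (Phi : T -> Z) (Iop : (T -> C) -> Z) : Prop :=
  forall h, inH lam1 h ->
    S (Iop h) /\
    forall phi, is_dual phi ->
      phi (Iop h) = Hint lam1 (fun w => phi (Phi w) * h w).

Definition gsum (Omega : Type) (g : nat -> Omega -> R)
  (e : nat -> T -> C) (Iop : (T -> C) -> Z) (N : nat) (om : Omega) : Z :=
  \sum_(j < N) (cgauss g j om *: Iop (e j)).

(* v is ||Phi||_{gamma(Z)}: Phi is strongly measurable and weakly L^2, I_Phi
   exists, and for an orthonormal basis (e_j) of H and independent complex
   standard Gaussians (gamma_j), sum_j gamma_j I_Phi e_j converges in
   L^2(Omega; Z) (Cauchy criterion; Z is complete), and v is the L^2 norm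
   of its sum. *)
Definition gamma_value (Phi : T -> Z) (v : R) : Prop :=
  strongly_measurable (uhs n) Phi /\ weakly_L2 Phi /\
  exists Iop e, is_IPhi Phi Iop /\ is_ONB lam1 e /\
  exists dO (Omega : measurableType dO) (P : probability Omega R) g,
    iid_std_gauss P g /\
    let E2 (f : Omega -> Z) := (\int[P]_om ((nZ (f om)) ^+ 2)%:E)%E in
    (forall eps : R, 0 < eps -> exists N0, forall N M, (N0 <= N)%N ->
       (N0 <= M)%N ->
       (E2 (fun om => (gsum g e Iop N om - gsum g e Iop M om)%R) <= eps%:E)%E) /\
    (fun N => Num.sqrt (fine (E2 (gsum g e Iop N)))) @ \oo --> v.

(* ||Phi||_{gamma(Z)}, := +oo when undefined.  The value does not depend on
   the basis nor on the Gaussian sequence, so the infimum is that value. *)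
Definition gamma_norm (Phi : T -> Z) : \bar R :=
  ereal_inf [set v%:E | v in [set v | gamma_value Phi v]].
End GammaNorm.

Definition Xnorm (X : normedModType C) (x : X) : R := cre `|x|.

Definition is_Xdual (X : normedModType C) (f : X -> C) : Prop :=
  (forall (a : C) x y, f (a *: x + y) = a * f x + f y) /\
  exists c : R, forall x, cabs (f x) <= c * Xnorm x.

Definition Xdual_norm (X : normedModType C) (f : X -> C) : R :=
  sup [set cabs (f x) | x in [set x | Xnorm x <= 1]].

Definition cone n (x : n.-tuple R) : set (n.+1.-tuple R) :=
  [set w | uhs n w /\ edist (hy w) x < ht w].
Definition cone_h n (x : n.-tuple R) (h : R) : set (n.+1.-tuple R) :=
  [set w | cone x w /\ ht w < h].

Definition restr (Z : zmodType) n (A : set (n.+1.-tuple R))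
  (F : n.+1.-tuple R -> Z) : n.+1.-tuple R -> Z :=
  fun w => if `[< A w >] then F w else 0.

Section Area.
Variable X : normedModType C.
Variable n : nat.
Variable lam1 : {measure set (n.+1.-tuple R) -> \bar R}.

Definition AX (F : n.+1.-tuple R -> X) (x : n.-tuple R) : \bar R :=
  gamma_norm setT (@Xnorm X) lam1 (restr (cone x) F).
Definition AXh (F : n.+1.-tuple R -> X) (h : R) (x : n.-tuple R) : \bar R :=
  gamma_norm setT (@Xnorm X) lam1 (restr (cone_h x h) F).
Definition AXd (G : n.+1.-tuple R -> X -> C) (x : n.-tuple R) : \bar R :=
  gamma_norm (@is_Xdual X) (@Xdual_norm X) lam1 (restr (cone x) G).

Variable lam : {measure set (n.-tuple R) -> \bar R}.
Definition Cq (q : R) (F : n.+1.-tuple R -> X) (x : n.-tuple R) : \bar R :=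
  ereal_sup [set ((fine (lam (eball cr.1 cr.2)))^-1%:E *
                  \int[lam]_(y in eball cr.1 cr.2) (AXh F cr.2 y `^ q)) `^ q^-1
            | cr in [set cr : n.-tuple R * R | (0 < cr.2 /\ edist x cr.1 < cr.2)%R]]%E.
End Area.
End Defs.
Arguments uhs {R} n.

(* Main.v *)
(* Trace duality bounds the pairing on a truncated cone: for Gaussian sums,
   integral_{Gamma^h(x)} |<F,G>| dy dt/t^{n+1} <= c A(F|h)(x) A(G)(x).  To prove
   it, F is approximated by countably many values on pieces where the phase of
   <F,G> is removed, the resulting sum is expanded in the two orthonormal bases
   (Parseval), and the coefficient matrices, which are contractions by Bessel,
   are absorbed by the rotation invariance of Gaussian vectors; no Hahn-Banach
   theorem is needed.  Then comes the stopping time of Coifman, Meyer and Stein: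
   by Chebyshev the set E_r where A(F|r) <= M C_q(F) fills at least half of the
   ball B(y,t) for some r between 2t and 4t, so Tonelli on {(w,x) : w in Gamma(x),
   x in E_r for some r > ht w} turns the pointwise bound into the theorem.

   The area functionals are not known to be measurable, so A(F|h) is replaced by
   its lower semicontinuous envelope, a countable supremum over rational balls.
   The cone inequality survives by Fatou's lemma, because cones with nearby
   vertices nearly agree; only the 0 * oo cases need a separate argument through
   scalar functionals.  Integrals of nonmeasurable functions are lower
   integrals, and they only ever occur on the right-hand side. *)

(* Each value of a Gauss norm comes with its own basis and its own probability space, so the two
   norms share no Gaussian variables at first. Everything is therefore reduced to finite sums: since
   only the law of a Gaussian vector matters, both sums can be written over one sequence, where the
   expectation of the pairing keeps the diagonal terms and becomes a trace. The inequality
   [2 |<A,B>| <= s |A|^2 + |B|^2 / s] is carried through all limits with [s] free, because its terms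
   converge separately; [s] is optimised once at the end.

   Scalars are real throughout: a complex basis [e_j] becomes the real basis [e_j], [i e_j], and a
   complex Gaussian a pair of real ones, so real rotations are enough.

   The two factors on the right are treated asymmetrically. [A(G)] occurs only at the vertex [x] and
   stays as it is, whereas [A(F|h)] is averaged over balls and compared with a threshold on a set
   that must be measurable; hence it is the one replaced by its envelope. The envelope being
   smaller, so is the [C_q] built from it. *)
Require Import Defs.
From HB Require Import structures.
From mathcomp Require Import all_boot all_order all_algebra.
From mathcomp Require Import complex.
From mathcomp Require Import all_classical all_reals all_analysis.
From mathcomp Require Import measurable_realfun.
From mathcomp Require Import ring lra.
Import Order.TTheory GRing.Theory Num.Theory.
Import numFieldNormedType.Exports.
Local Open Scope classical_set_scope.
Local Open Scope ring_scope.

Set Implicit Arguments. Unset Strict Implicit. Unset Printing Implicit Defensive.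

(** * Gaussian vectors *)

(* Neither side is assumed measurable: the integral of a nonnegative function
   is a supremum over the simple functions below it. *)
Lemma ge0_le_lower_integral d (T : measurableType d) (R : realType)
    (mu : {measure set T -> \bar R}) (D : set T) (f g : T -> \bar R) :
  (forall x, D x -> 0 <= f x)%E -> (forall x, D x -> f x <= g x)%E ->
  (\int[mu]_(x in D) f x <= \int[mu]_(x in D) g x)%E.
Proof.
move=> f0 fg; rewrite !ge0_integralE //; last first.
  by move=> x Dx; exact: le_trans (f0 x Dx) (fg x Dx).
apply: ge_ereal_sup => _ [h /= hf <-]; apply: ereal_sup_ubound; exists h => //= x; apply: le_trans (hf x) _.
by rewrite /patch; case: ifPn => // /[!inE]; exact: fg.
Qed.

Lemma lower_integral_subset d (T : measurableType d) (R : realType)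
    (mu : {measure set T -> \bar R}) (A B : set T) (f : T -> \bar R) :
  A `<=` B -> (forall x, B x -> 0 <= f x)%E ->
  (\int[mu]_(x in A) f x <= \int[mu]_(x in B) f x)%E.
Proof.
move=> AB f0; rewrite -(setIidr AB) integral_mkcondr.
apply: ge0_le_lower_integral => x Bx; rewrite /patch; case: ifP => // _; exact: f0.
Qed.

Section ImageMeasure.
Context d d' (T1 : measurableType d) (T2 : measurableType d') (R : realType).
Variables (m : {measure set T1 -> \bar R}) (f : T1 -> T2).
Hypothesis mf : measurable_fun setT f.

(** The pushforward bundled with its measure structure, so that uniqueness theorems for measures
    apply to it. *)
Definition image_measure : {measure set T2 -> \bar R} :=
  measure_function_pushforward__canonical__measure_function_Measure m mf.

Lemma image_measureE A : image_measure A = m (f @^-1` A).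
Proof. by []. Qed.

Lemma ge0_integral_image_measure (h : T2 -> \bar R) :
  measurable_fun setT h -> (forall y, 0 <= h y)%E ->
  (\int[image_measure]_y h y = \int[m]_x h (f x))%E.
Proof. by move=> mh h0; rewrite ge0_integral_pushforward. Qed.

End ImageMeasure.

(** * Rotation invariance of the Gaussian measure on the plane *)

Section LebesgueTranslation.
Context {R : realType}.
Local Notation leb := (@lebesgue_measure R).

(** Translation preserves the length of half-open intervals, and these lengths determine Lebesgue
    measure. *)
Lemma ge0_integral_translation (a : R) (f : R -> \bar R) :
  measurable_fun setT f -> (forall x, 0 <= f x)%E ->
  (\int[leb]_x f ((x : R) + a)%R = \int[leb]_x f x)%E.
Proof.
move=> mf f0.
have mphi : measurable_fun setT (fun x : measurableTypeR R => x + a : measurableTypeR R).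
  exact: measurable_funD.
have E B : measurable B -> leb B = image_measure leb mphi B.
  apply: lebesgue_measure_unique => X [[x y]] /= _ <-.
  rewrite /pushforward.
  have -> : (fun z : measurableTypeR R => z + a : measurableTypeR R) @^-1` `]x, y] =
      `]x - a, y - a]%classic.
    apply/seteqP; split=> z /=; rewrite !in_itv /= ?ltrBlDr ?lerBrDr //.
  rewrite !lebesgue_measure_itv /= !lte_fin ltrD2r -!EFinD.
  by case: ifP => // _; congr (_%:E); ring.
rewrite -(ge0_integral_image_measure leb mphi mf f0).
by apply/esym/eq_measure_integral => B mB _; exact: E.
Qed.

End LebesgueTranslation.

Section Rotation.
Context {R : realType}.
Local Notation leb := (@lebesgue_measure R).
Local Notation gau := (@normal_prob R 0 1).
Local Notation pdf := (@normal_pdf R 0 1).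

(** Change of variables gives an integral against the Radon-Nikodym derivative, which equals [pdf]
    almost everywhere because both have the same integral over every measurable set. *)
Lemma ge0_integral_gauss (f : R -> \bar R) :
  measurable_fun setT f -> (forall x, 0 <= f x)%E ->
  (\int[gau]_x f x = \int[leb]_x (f x * (pdf x)%:E))%E.
Proof.
move=> mf f0; have dom := @normal_prob_dominates R 0 1.
have Id := Radon_Nikodym_SigmaFinite.f_integrable dom.
have mpdf : measurable_fun setT (EFin \o pdf).
  by apply/measurable_EFinP; exact: measurable_normal_pdf.
rewrite -(Radon_Nikodym_SigmaFinite.change_of_variables dom f0 measurableT mf).
apply: ae_eq_integral => //.
- by apply: emeasurable_funM => //; exact: measurable_int Id.
- exact: emeasurable_funM.
apply: ae_eqe_mul2l; apply: integral_ae_eq => // E _ mE.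
by rewrite -(Radon_Nikodym_SigmaFinite.f_integral dom mE).
Qed.

Definition rot (c s : R) (p : R * R) : R * R :=
  (c * p.1 - s * p.2, s * p.1 + c * p.2).

Lemma measurable_rot c s : measurable_fun setT (rot c s).
Proof.
by apply: measurable_fun_pair; [apply: measurable_funB|apply: measurable_funD];
  apply: measurable_funM.
Qed.

Let integral2 (f : R * R -> \bar R) := (\int[leb]_x \int[leb]_y f (x, y))%E.

(** For a fixed second coordinate the shear is a translation of the first one; Tonelli puts the
    first coordinate inside. *)
Let shear1 (a : R) (f : R * R -> \bar R) :
  measurable_fun setT f -> (forall p, 0 <= f p)%E ->
  integral2 (fun p => f (p.1 + a * p.2, p.2)) = integral2 f.
Proof.
move=> mf f0; rewrite /integral2.
have mg : measurable_fun setT (fun p : R * R => f (p.1 + a * p.2, p.2)).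
  apply: (measurableT_comp mf); apply: measurable_fun_pair => //.
  by apply: measurable_funD => //; apply: measurable_funM.
have := @fubini_tonelli _ _ _ _ R leb leb _ mg (fun p => f0 _).
rewrite /= => ->.
have := @fubini_tonelli _ _ _ _ R leb leb _ mf (fun p => f0 _).
rewrite /= => ->.
apply: eq_integral => y _.
rewrite -[RHS](ge0_integral_translation (a * y)) //=.
exact: (measurableT_comp mf).
Qed.

Let shear2 (a : R) (f : R * R -> \bar R) :
  measurable_fun setT f -> (forall p, 0 <= f p)%E ->
  integral2 (fun p => f (p.1, p.2 + a * p.1)) = integral2 f.
Proof.
move=> mf f0; rewrite /integral2.
apply: eq_integral => y _ /=.
rewrite -[RHS](ge0_integral_translation (a * y)) //=.
exact: (measurableT_comp mf).
Qed.

(** A rotation with [s != 0] is a product of three shears, with parameters [(c - 1) / s], [s] and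
    [(c - 1) / s]. *)
Let integral2_rot (c s : R) (f : R * R -> \bar R) :
  c ^+ 2 + s ^+ 2 = 1 -> s != 0 ->
  measurable_fun setT f -> (forall p, 0 <= f p)%E ->
  integral2 (f \o rot c s) = integral2 f.
Proof.
move=> cs s0 mf f0; pose a := (c - 1) / s.
pose f1 (p : R * R) := f (p.1 + a * p.2, p.2).
pose f2 (p : R * R) := f1 (p.1, p.2 + s * p.1).
have m1 : measurable_fun setT f1.
  apply: (measurableT_comp mf); apply: measurable_fun_pair => //.
  by apply: measurable_funD => //; apply: measurable_funM.
have m2 : measurable_fun setT f2.
  apply: (measurableT_comp m1); apply: measurable_fun_pair => //.
  by apply: measurable_funD => //; apply: measurable_funM.
rewrite -(shear1 a mf f0) -[RHS](shear2 s m1 (fun p => f0 _)).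
rewrite -[RHS](shear1 a m2 (fun p => f0 _)).
congr integral2; apply/funext => -[x y]; rewrite /f2 /f1 /rot /=. congr (f (_, _)) => /=.
  rewrite /a; move: cs => /eqP; rewrite addrC eq_sym -subr_eq => /eqP cs.
  transitivity (c * x - s ^+ 2 / s * y); first by field.
  by rewrite -cs; field.
by rewrite /a; field.
Qed.

(** The product of the two densities depends on the point only through its squared norm, so the
    invariance of the plane Lebesgue integral carries over. *)
Let gauss2E (A : set (R * R)) : measurable A ->
  (gau \x gau)%E A =
  integral2 (fun p => (\1_A p * (normal_peak 1 ^+ 2 * expR (- (p.1 ^+ 2 + p.2 ^+ 2) / 2)))%:E).
Proof.
move=> mA; rewrite /product_measure1 /=.
rewrite ge0_integral_gauss //; last exact: measurable_fun_xsection.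
apply: eq_integral => x _ /=; rewrite /normal_prob.
rewrite -ge0_integralZr //=; last 4 first.
- exact: measurable_xsection.
- by apply/measurable_EFinP/measurable_funTS; exact: measurable_normal_pdf.
- by move=> y _; rewrite lee_fin normal_pdf_ge0.
- by rewrite lee_fin normal_pdf_ge0.
rewrite integral_mkcond; apply: eq_integral => y _.
rewrite patchE mem_xsection indicE.
case: ifP => xyA; rewrite ?mul0r // mul1r -EFinM; congr (_%:E).
rewrite !normal_pdfE ?oner_neq0 // /normal_fun !subr0 expr1n.
rewrite mulrACA -expr2; congr (_ * _).
by rewrite -expRD; congr expR; rewrite -mulrDl -opprD addrC.
Qed.

Let gauss2_rot1 (c s : R) (A : set (R * R)) :
  c ^+ 2 + s ^+ 2 = 1 -> s != 0 -> measurable A ->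
  (gau \x gau)%E (rot c s @^-1` A) = (gau \x gau)%E A.
Proof.
move=> cs s0 mA.
have mrA : measurable (rot c s @^-1` A).
  by rewrite -[X in measurable X]setTI; exact: measurable_rot.
pose g (p : R * R) := (\1_A p *
  (normal_peak 1 ^+ 2 * expR (- (p.1 ^+ 2 + p.2 ^+ 2) / 2)))%:E.
have mg : measurable_fun setT g.
  apply/measurable_EFinP; apply: measurable_funM => //.
  apply: measurable_funM => //; apply: measurableT_comp => //.
  apply: measurable_funM => //; apply: measurableT_comp => //.
  by apply: measurable_funD; apply: measurable_funX.
have g0 p : (0 <= g p)%E.
  by rewrite lee_fin !mulr_ge0 ?expR_ge0 ?exprn_ge0 ?normal_peak_ge0.
rewrite (gauss2E mrA) (gauss2E mA) -(integral2_rot cs s0 mg g0).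
congr integral2; apply/funext => -[x y]; rewrite /g /=.
have -> : (c * x - s * y) ^+ 2 + (s * x + c * y) ^+ 2 = x ^+ 2 + y ^+ 2.
  transitivity ((c ^+ 2 + s ^+ 2) * (x ^+ 2 + y ^+ 2)); last by rewrite cs mul1r.
  by ring.
by rewrite !indicE.
Qed.

Lemma gauss2_rot (c s : R) (A : set (R * R)) :
  c ^+ 2 + s ^+ 2 = 1 -> measurable A ->
  (gau \x gau)%E (rot c s @^-1` A) = (gau \x gau)%E A.
Proof.
move=> cs mA.
have [s0|] := eqVneq s 0; last by move=> s0; exact: gauss2_rot1.
(* a rotation by 0 or pi is the square of one by 0 or pi/2, or of the latter
   composed with its inverse *)
have r01 : (0 : R) ^+ 2 + 1 ^+ 2 = 1 by rewrite expr0n expr1n add0r.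
have r0N1 : (0 : R) ^+ 2 + (- c) ^+ 2 = 1.
  by move: cs; rewrite s0 expr0n addr0 sqrrN add0r.
have c0 : - c != 0.
  apply: contra_eq_neq cs => /eqP; rewrite oppr_eq0 => /eqP ->.
  by rewrite s0 expr0n addr0 eq_sym oner_neq0.
have mA' : measurable (rot 0 (- c) @^-1` A).
  by rewrite -[X in measurable X]setTI; exact: measurable_rot.
transitivity ((gau \x gau)%E (rot 0 1 @^-1` (rot 0 (- c) @^-1` A))); last first.
  by rewrite (gauss2_rot1 r01 (oner_neq0 _) mA') (gauss2_rot1 r0N1 c0 mA).
congr ((gau \x gau)%E _); apply/seteqP.
have E x y : rot 0 (- c) (rot 0 1 (x, y)) = rot c s (x, y).
  by rewrite /rot /= s0; congr (_, _); ring.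
by split => -[x y] /=; rewrite E.
Qed.

End Rotation.

(* [normal_prob] is a measure on [measurableTypeR R], whose measure display
   differs from that of [R]; [stdgauss] is the same measure on [R].  It is
   locked so that canonical structures do not unfold it back. *)
HB.lock Definition stdgauss {R : realType} : set R -> \bar R := @normal_prob R 0 1.

Section StdGauss.
Context {R : realType}.
Local Notation stdgauss := (@stdgauss R).

Lemma stdgaussE (A : set R) : stdgauss A = normal_prob 0 1 A.
Proof. by rewrite stdgauss.unlock. Qed.

Let stdgauss0 : stdgauss set0 = 0%E.
Proof. by rewrite stdgaussE; exact: (measure0 (@normal_prob R 0 1)). Qed.
Let stdgauss_ge0 A : (0 <= stdgauss A)%E.
Proof. by rewrite stdgaussE; exact: (measure_ge0 (@normal_prob R 0 1)). Qed.
Let stdgauss_sigma : semi_sigma_additive stdgauss.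
Proof.
rewrite stdgauss.unlock.
exact: (@measure_semi_sigma_additive _ _ _ (@normal_prob R 0 1)).
Qed.
HB.instance Definition _ :=
  isMeasure.Build _ _ _ stdgauss stdgauss0 stdgauss_ge0 stdgauss_sigma.
Let stdgaussT : stdgauss setT = 1%E.
Proof. by rewrite stdgaussE; exact: (@probability_setT _ _ _ (@normal_prob R 0 1)). Qed.
HB.instance Definition _ :=
  Measure_isProbability.Build _ _ _ stdgauss stdgaussT.

(** The invariance is transported along the identity map out of [measurableTypeR R] in each
    coordinate: the image of the product measure agrees with the product of [stdgauss] on
    rectangles, hence everywhere. *)
Lemma stdgauss2_rot (c s : R) (A : set (R * R)) :
  c ^+ 2 + s ^+ 2 = 1 -> measurable A ->
  (stdgauss \x stdgauss)%E (rot c s @^-1` A) = (stdgauss \x stdgauss)%E A.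
Proof.
move=> cs mA.
have mid1 : measurable_fun [set: measurableTypeR R] (fun x : measurableTypeR R => x : R).
  by move=> _ B mB; rewrite setTI.
have mid : measurable_fun [set: measurableTypeR R * measurableTypeR R]
    (fun p : measurableTypeR R * measurableTypeR R => p : R * R).
  rewrite (_ : (fun _ => _) = fun p => (p.1 : R, p.2 : R)); last first.
    by apply/funext => -[].
  apply: measurable_fun_pair.
    exact: (measurableT_comp mid1 measurable_fst).
  exact: (measurableT_comp mid1 measurable_snd).
pose gau2 := image_measure (@normal_prob R 0 1 \x @normal_prob R 0 1)%E mid.
have E C : measurable C -> (stdgauss \x stdgauss)%E C = gau2 C.
  apply: product_measure_unique => B1 B2 m1 m2.
  rewrite /= !stdgaussE; exact: (@product_measure1E _ _ _ _ _ (@normal_prob R 0 1) (@normal_prob R 0 1)).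
have mrA : measurable (rot c s @^-1` A).
  by rewrite -[X in measurable X]setTI; exact: measurable_rot.
rewrite (E _ mrA) (E _ mA).
exact: gauss2_rot.
Qed.

End StdGauss.

(** * Finite Gaussian sequences and their rotations *)

Section GaussSeq.
Context {R : realType} {dO} {Omega : measurableType dO} (P : probability Omega R).
Local Notation gau := (@stdgauss R).

(** Finite form of [iid_std_gauss]: only the first [K] variables are constrained. Linear changes of
    variables act on finitely many coordinates and preserve this form. *)
Definition gauss_seq (K : nat) (g : nat -> Omega -> R) : Prop :=
  (forall j, (j < K)%N -> measurable_fun setT (g j)) /\
  forall B : nat -> set R, (forall j, measurable (B j)) ->
    P [set om | forall j, (j < K)%N -> B j (g j om)] =
    (\prod_(j < K) gau (B j))%E.

Lemma iid_std_gauss_seq g K : iid_std_gauss P g -> gauss_seq K g.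
Proof.
move=> [mg gB gJ]; split=> [//|B mB].
have := gJ (iota 0 K) B (iota_uniq _ _) mB.
rewrite (_ : \bigcap_(j in _) _ = [set om | forall j, (j < K)%N -> B j (g j om)]).
  move=> ->; rewrite -{1}(subn0 K) -[iota 0 _]/(index_iota 0 K) big_mkord.
  by apply: eq_bigr => i _; rewrite stdgaussE; exact: gB.
apply/seteqP; split=> om /= H j.
  by move=> jK; apply: H; rewrite /= mem_iota.
by rewrite /= mem_iota add0n => /H.
Qed.

Lemma gauss_seq_le K L g : (L <= K)%N -> gauss_seq K g -> gauss_seq L g.
Proof.
move=> LK [mg gB]; split=> [j jL|B mB]; first exact/mg/(leq_trans jL).
have := gB (fun j => if (j < L)%N then B j else setT).
rewrite (_ : [set om | _] = [set om | forall j, (j < L)%N -> B j (g j om)]); last first.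
  apply/seteqP; split => om /= H j jL.
    by have := H j (leq_trans jL LK); rewrite jL.
  by case: ifP => // /H.
move=> ->; last by move=> j; case: ifP.
rewrite -(big_mkord xpredT (fun j => gau (if (j < L)%N then B j else setT))).
rewrite -(big_mkord xpredT (fun j => gau (B j))).
rewrite (big_cat_nat (n := L)) //= [X in (_ * X)%E]big1_seq ?mule1.
  by apply: eq_big_nat => j /andP[_ ->].
move=> j; rewrite mem_index_iota => /andP[_ /andP[Lj _]].
by rewrite ltnNge Lj /= probability_setT.
Qed.

(** The type [T] is arbitrary so that one definition rotates both the random vector and the rows of
    a coefficient matrix. *)
Definition rotate (i k : nat) (c s : R) (T : Type) (f : nat -> T -> R) : nat -> T -> R :=
  fun j x => if j == i then (rot c s (f i x, f k x)).1
             else if j == k then (rot c s (f i x, f k x)).2 else f j x.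

Lemma measurable_forall_lt K (g : nat -> Omega -> R) (B : nat -> set R) :
  (forall j, (j < K)%N -> measurable_fun setT (g j)) ->
  (forall j, measurable (B j)) ->
  measurable [set om | forall j, (j < K)%N -> B j (g j om)].
Proof.
move=> mg mB.
rewrite (_ : [set _ | _] = \bigcap_(j in [set j | (j < K)%N]) (g j @^-1` B j)) //.
apply: bigcap_measurableType => j jK; rewrite -[X in measurable X]setTI.
exact: mg.
Qed.

(** Restricted to any event about the remaining coordinates, the law of the pair [(g i, g k)] is a
    multiple of the plane Gaussian measure, which is rotation invariant. *)
Lemma gauss_seq_rotate i k c s K g : (i < K)%N -> (k < K)%N -> i != k ->
  c ^+ 2 + s ^+ 2 = 1 -> gauss_seq K g -> gauss_seq K (rotate i k c s g).
Proof.
move=> iK kK ik cs [mg gB]; split.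
  move=> j jK; rewrite /rotate; case: (j == i).
    by apply: measurable_funB; apply: measurable_funM => //; exact: mg.
  case: (j == k); last exact: mg.
  by apply: measurable_funD; apply: measurable_funM => //; exact: mg.
move=> B mB.
pose upd (B1 B2 : set R) j := if j == i then B1 else if j == k then B2 else B j.
have mupd B1 B2 : measurable B1 -> measurable B2 ->
    forall j, measurable (upd B1 B2 j).
  by move=> m1 m2 j; rewrite /upd; case: ifP => // _; case: ifP.
pose i' := Ordinal iK; pose k' := Ordinal kK.
pose p : \bar R := (\prod_(j < K | (j != i') && (j != k')) gau (B j))%E.
have prodE B1 B2 : (\prod_(j < K) gau (upd B1 B2 j) = gau B1 * gau B2 * p)%E.
  rewrite (bigD1 i') //= (bigD1 k') /=; last by rewrite -val_eqE /= eq_sym.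
  have -> : upd B1 B2 i = B1 by rewrite /upd eqxx.
  have -> : upd B1 B2 k = B2 by rewrite /upd eq_sym (negbTE ik) eqxx.
  rewrite muleA; congr (_ * _)%E; apply: eq_bigr => j; rewrite -!val_eqE /= /upd => /andP[ji jk].
  by rewrite (negbTE ji) (negbTE jk).
(* The event that the coordinates other than [i] and [k] lie in their sets; its probability is the
   product [p]. *)
pose A := [set om | forall j, (j < K)%N -> upd setT setT j (g j om)].
have mA : measurable A by apply: measurable_forall_lt => //; exact: mupd.
have p_fin : p \is a fin_num.
  have -> : p = P A.
    have mT : measurable (setT : set R) by [].
    by rewrite /A (gB _ (mupd _ _ mT mT)) prodE !probability_setT !mul1e.
  exact: fin_num_measure.
have p0 : (0 <= p)%E by apply: prode_ge0.
have mgik : measurable_fun setT (fun om => (g i om, g k om)).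
  by apply: measurable_fun_pair; exact: mg.
pose nu := image_measure (mrestr P mA) mgik.
have nuE B1 B2 : measurable B1 -> measurable B2 ->
    nu (B1 `*` B2) = (p * (gau B1 * gau B2))%E.
  move=> m1 m2; rewrite muleC -prodE -(gB _ (mupd _ _ m1 m2)).
  rewrite /nu image_measureE /mrestr; congr (P _).
  apply/seteqP; split => om /=.
    move=> [[b1 b2] H] j /H; rewrite /upd; case: eqP => [->//|_].
    by case: eqP => [->//|_].
  move=> H; split.
    split; first by have := H i iK; rewrite /upd eqxx.
    by have := H k kK; rewrite /upd eq_sym (negbTE ik) eqxx.
  by move=> j /H; rewrite /upd; case: eqP => // _; case: eqP.
have nuC C : measurable C -> nu C = (p * (gau \x gau)%E C)%E.
  (* Uniqueness of the product measure is applied to [nu] divided by [p], so [p = 0] is treated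
     apart. *)
  move=> mC; have [p0'|pn0] := eqVneq p 0%E.
    rewrite p0' mul0e; apply/eqP; rewrite eq_le; apply/andP; split; last exact: measure_ge0.
    have <- : nu (setT `*` setT) = 0%E by rewrite nuE // p0' mul0e.
    by rewrite setXTT; apply: le_measure; rewrite ?inE.
  have fp0 : 0 < fine p by rewrite fine_gt0 // lt0e pn0 p0 ltey_eq p_fin.
  have ip0 : 0 <= (fine p)^-1 by rewrite invr_ge0 ltW.
  have pp : ((fine p)^-1%:E * p = 1)%E.
    by rewrite -[X in (_ * X)%E](fineK p_fin) -EFinM mulVf // gt_eqF.
  pose nu' : {measure set (R * R) -> \bar R} := mscale (NngNum ip0) nu.
  have -> : (gau \x gau)%E C = nu' C.
    apply: product_measure_unique => // B1 B2 m1 m2; rewrite /nu' /= /mscale /= nuE //.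
    by rewrite [LHS]muleA pp mul1e.
  by rewrite /nu' /= /mscale /= [RHS]muleA [X in (X * _)%E]muleC pp mul1e.
transitivity (nu (rot c s @^-1` (B i `*` B k))).
  rewrite /nu image_measureE /mrestr; congr (P _).
  apply/seteqP; split => om /=.
    move=> H; split.
      split => /=; first by have := H i iK; rewrite /rotate eqxx.
      by have := H k kK; rewrite /rotate eq_sym (negbTE ik) eqxx.
    by move=> j /H; rewrite /rotate /upd; case: eqP => // _; case: eqP.
  move=> [[b1 b2] H] j /H; rewrite /rotate /upd; case: eqP => [->//|_].
  by case: eqP => [->//|_].
have mrBB : measurable (rot c s @^-1` (B i `*` B k)).
  rewrite -[X in measurable X]setTI; apply: measurable_rot => //.
  exact: measurableX.
rewrite nuC // stdgauss2_rot //; last exact: measurableX.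
rewrite product_measure1E // muleC -prodE; apply: eq_bigr => j _.
by congr (gau _); rewrite /upd; case: eqP => [->//|_]; case: eqP => [->//|].
Qed.

End GaussSeq.

Section GaussLaw.
Context {R : realType}.

Definition box (K : nat) (B : nat -> set R) : set (K.-tuple R) :=
  [set t | forall j : 'I_K, B j (tnth t j)].

Lemma measurable_box K B : (forall j, measurable (B j)) -> measurable (box (K:=K) B).
Proof.
move=> mB; rewrite (_ : box B = \bigcap_(j in [set: 'I_K]) ((@tnth K R)^~ j @^-1` B j)).
  apply: fin_bigcap_measurable => // j _; rewrite -[X in measurable X]setTI.
  exact: measurable_tnth.
by apply/seteqP; split => t /= H j; [move=> _; exact: H|exact: (H j I)].
Qed.

Lemma measure_unique_box K (m1 m2 : {measure set (K.-tuple R) -> \bar R})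
    (b : nat -> nat -> set R) :
  (forall n j, measurable (b n j)) -> \bigcup_n box (K:=K) (b n) = setT ->
  (forall n, m1 (box (b n)) < +oo)%E ->
  (forall B, (forall j, measurable (B j)) -> m1 (box (K:=K) B) = m2 (box B)) ->
  forall A, measurable A -> m1 A = m2 A.
Proof.
move=> mb bT b_fin m12 A mA.
pose G := [set box (K:=K) B | B in [set B | forall j, measurable (B j)]].
apply: (@g_sigma_algebra_measure_unique _ _ _ G _ (fun n => box (b n))) => //.
- by move=> _ [B mB <-]; exact: measurable_box.
- by move=> n; exists (b n).
- move=> _ _ [B1 mB1 <-] [B2 mB2 <-]; exists (fun j => B1 j `&` B2 j).
    by move=> j; exact: measurableI.
  apply/seteqP; split => t /=.
    by move=> H; split => j; have [] := H j.
  by move=> [H1 H2] j; split.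
- by move=> _ [B mB <-]; exact: m12.
suff : measurable `<=` <<s G >> by apply.
apply: smallest_sub; first exact: smallest_sigma_algebra.
(* The sigma-algebra on tuples is generated by preimages of single coordinates; such a preimage is a
   box whose other sides are the whole line. *)
rewrite -bigcup_seq => _ [i _ [B mB <-]]; apply: sub_sigma_algebra.
exists (fun j : nat => if j == i then B else setT).
  by move=> j; case: ifP.
rewrite setTI; apply/seteqP; split => t /=.
  by move=> /(_ i); rewrite eqxx.
by move=> Bt j; case: eqP => // /val_inj ->.
Qed.

(** The probabilities of boxes determine the law of the vector. The two probability spaces may
    differ, which lets Gaussian sums over different spaces be compared. *)
Lemma gauss_seq_law dO (Omega : measurableType dO) (P : probability Omega R)
    dO' (Omega' : measurableType dO') (P' : probability Omega' R) K g g'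
    (phi : K.-tuple R -> \bar R) :
  gauss_seq P K g -> gauss_seq P' K g' ->
  measurable_fun setT phi -> (forall t, 0 <= phi t)%E ->
  (\int[P]_om phi [tuple g j om | j < K] =
   \int[P']_om phi [tuple g' j om | j < K])%E.
Proof.
move=> [mg gB] [mg' gB'] mphi phi0.
have mt dX (X : measurableType dX) (h : nat -> X -> R) :
    (forall j, (j < K)%N -> measurable_fun setT (h j)) ->
    measurable_fun setT (fun om => [tuple h j om | j < K]).
  move=> mh; apply/measurable_fun_tnthP => i.
  rewrite (_ : _ \o _ = h i); first exact: mh.
  by apply/funext => om /=; rewrite tnth_mktuple.
pose V := image_measure P (mt _ _ _ mg).
pose V' := image_measure P' (mt _ _ _ mg').
rewrite -(ge0_integral_image_measure P (mt _ _ _ mg) mphi phi0).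
rewrite -(ge0_integral_image_measure P' (mt _ _ _ mg') mphi phi0).
have boxE dX (X : measurableType dX) (h : nat -> X -> R) B :
    (fun om => [tuple h j om | j < K]) @^-1` box B =
    [set om | forall j, (j < K)%N -> B j (h j om)].
  apply/seteqP; split => om /= H j.
    by move=> jK; have := H (Ordinal jK); rewrite tnth_mktuple.
  by rewrite tnth_mktuple; apply: H.
apply: eq_measure_integral => A mA _.
apply: (@measure_unique_box K _ _ (fun _ _ => setT)) => //.
- by apply/seteqP; split => // t _; exists 0%N.
- move=> n; rewrite /V image_measureE boxE.
  rewrite (le_lt_trans (probability_le1 P _)) ?ltry //.
  by apply: (@measurable_forall_lt _ _ _ K g (fun=> setT)).
- move=> B mB; transitivity (\prod_(j < K) stdgauss (B j))%E.
    by apply: etrans (gB _ mB); rewrite image_measureE boxE.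
  by apply: etrans (esym (gB' _ mB)) _; rewrite image_measureE boxE.
Qed.

End GaussLaw.

(** * Orthonormal linear images of a Gaussian vector *)

Section Orthonormal.
Context {R : realType} {dO} {Omega : measurableType dO} (P : probability Omega R).

(** For a matrix [C] with rows indexed by [j], [dot N g C om l] is the [l]-th linear combination of
    the Gaussians, and [dot N C C] is the Gram matrix of the columns. *)
Definition dot (N : nat) T U (f : nat -> T -> R) (h : nat -> U -> R) x y : R :=
  \sum_(j < N) f j x * h j y.

Lemma rotate_dot i k c s N T U (f : nat -> T -> R) (h : nat -> U -> R) x y :
  (i < N)%N -> (k < N)%N -> i != k -> c ^+ 2 + s ^+ 2 = 1 ->
  dot N (rotate i k c s f) (rotate i k c s h) x y = dot N f h x y.
Proof.
move=> iN kN ik cs; rewrite /dot.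
pose i' := Ordinal iN; pose k' := Ordinal kN.
have ki : k' != i' by rewrite -val_eqE /= eq_sym.
rewrite (bigD1 i') //= (bigD1 k') //= [RHS](bigD1 i') //= [in RHS](bigD1 k') //=.
rewrite !addrA; congr (_ + _); last first.
  apply: eq_bigr => j; rewrite -!val_eqE /= /rotate => /andP[ji jk].
  by rewrite (negbTE ji) (negbTE jk).
rewrite /rotate !eqxx [k == i]eq_sym (negbTE ik) /rot /=.
transitivity ((c ^+ 2 + s ^+ 2) * (f i x * h i y + f k x * h k y)); first by ring.
by rewrite cs mul1r.
Qed.

Lemma gauss_seq_eq L (g g' : nat -> Omega -> R) :
  (forall j om, (j < L)%N -> g j om = g' j om) -> gauss_seq P L g -> gauss_seq P L g'.
Proof.
move=> gg' [mg gB]; split=> [j jL|B mB].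
  have -> : g' j = g j by apply/funext => om; rewrite gg'.
  exact: mg.
rewrite -gB //; congr (P _); apply/seteqP; split => om /= H j jL.
  by rewrite gg' //; exact: H.
by rewrite -gg' //; exact: H.
Qed.

Let unit_cols k N (C : nat -> nat -> R) :=
  forall l j, (l < k)%N -> (j < N)%N -> C j l = (j == l)%:R.

(** Givens rotations in the planes [(k, j)], applied to [g] and [C] together, clear column [k] below
    the diagonal without changing any [dot]; [m] bounds the rows treated so far. Each rotation turns
    the pivot into a square root, which fixes its sign as soon as some row lies below [k]. *)
Lemma eliminate_column k N m (g : nat -> Omega -> R) (C : nat -> nat -> R) :
  (k < N)%N -> gauss_seq P N g -> unit_cols k N C ->
  exists g' C', [/\ gauss_seq P N g', unit_cols k N C',
    (forall l l', dot N C' C' l l' = dot N C C l l') /\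
    (forall om l, dot N g' C' om l = dot N g C om l),
    forall j, (k < j < m)%N -> (j < N)%N -> C' j k = 0 &
    (k.+1 < m)%N -> (k.+1 < N)%N -> 0 <= C' k k].
Proof.
move=> kN gg uC; elim: m => [|m [g' [C' [gg' uC' [CC gC] C0 Cp]]]].
  by exists g, C; split => // j /andP[].
have [mk|km] := leqP m k.
  exists g', C'; split => //.
    by move=> j /andP[kj jm]; have := leq_trans (leq_trans kj jm) mk; rewrite ltnn.
  by rewrite ltnS ltnNge mk.
have [Nm|mN] := leqP N m.
  exists g', C'; split => //.
    move=> j /andP[kj jm] jN; apply: C0 => //; rewrite kj /=.
    exact: leq_trans jN Nm.
  by move=> _ kN'; apply: Cp => //; exact: leq_trans kN' Nm.
(* The rotation below takes the pair [(a, b)] to [(r, 0)]. *)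
pose a := C' k k; pose b := C' m k; pose r := Num.sqrt (a ^+ 2 + b ^+ 2).
have ab0 : 0 <= a ^+ 2 + b ^+ 2 by rewrite addr_ge0 ?sqr_ge0.
have [r0|r0] := eqVneq r 0.
  have ab : (a == 0) && (b == 0).
    have : a ^+ 2 + b ^+ 2 == 0 by rewrite -(sqr_sqrtr ab0) -/r r0 expr0n.
    by rewrite paddr_eq0 ?sqr_ge0 // !sqrf_eq0.
  move/andP : ab => [/eqP a0 /eqP b0].
  exists g', C'; split => //; last by rewrite -/a a0.
  move=> j /andP[kj]; rewrite ltnS leq_eqVlt => /orP[/eqP ->//|jm] jN.
  by apply: C0 => //; rewrite kj.
have km' : k != m by rewrite neq_ltn km.
have cs : (a / r) ^+ 2 + (- b / r) ^+ 2 = 1.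
  rewrite !expr_div_n sqrrN -mulrDl -(sqr_sqrtr ab0) -/r divff //.
  by rewrite sqrf_eq0.
exists (rotate k m (a / r) (- b / r) g'), (rotate k m (a / r) (- b / r) C').
split.
- exact: gauss_seq_rotate.
- move=> l j lk jN; rewrite /rotate /rot /=.
  rewrite !uC' // !(gtn_eqF lk) (gtn_eqF (ltn_trans lk km)) !mulr0 subrr addr0.
  case: eqP => [->|_]; first by rewrite (gtn_eqF lk).
  by case: eqP => [->|_]; rewrite ?uC' // (gtn_eqF (ltn_trans lk km)).
- by split=> [l l'|om l]; rewrite rotate_dot.
- move=> j /andP[kj]; rewrite ltnS /rotate /rot /= (gtn_eqF kj).
  rewrite leq_eqVlt; case: eqP => [-> _ _|_ /= jm jN].
    by rewrite -/a -/b; field.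
  by apply: C0 => //; rewrite kj.
- move=> _ _; rewrite /rotate eqxx /rot /= -/a -/b.
  have -> : a / r * a - - b / r * b = (a ^+ 2 + b ^+ 2) / r by ring.
  by rewrite divr_ge0 // sqrtr_ge0.
Qed.

Lemma sum_delta n (l : nat) (F : nat -> R) : (l < n)%N ->
  \sum_(j < n) (j == l :> nat)%:R * F j = F l.
Proof.
move=> ln; rewrite (bigD1 (Ordinal ln)) //= eqxx mul1r big1 ?addr0 // => j.
by rewrite -val_eqE /= => /negbTE ->; rewrite mul0r.
Qed.

(** Eliminating the columns in turn reduces [C] to the first [L] unit vectors, where the
    combinations are the variables [g l] themselves. The strict inequality [L < N] leaves a row
    below every pivot, so that each pivot can be rotated to [1] instead of [-1]. *)
Lemma gauss_seq_orthonormal N L (g : nat -> Omega -> R) (C : nat -> nat -> R) :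
  (L < N)%N -> gauss_seq P N g ->
  (forall l l', (l < L)%N -> (l' < L)%N -> dot N C C l l' = (l == l')%:R) ->
  gauss_seq P L (fun l om => dot N g C om l).
Proof.
move=> LN gg CC; have : unit_cols 0 N C by [].
have : (0 + L = L)%N by []; move: 0%N => k; move: {1}L => d.
elim: d k g C gg CC => [|d IH] k g C gg CC; rewrite ?addn0 => kdL uC.
  apply: (gauss_seq_eq (g := g)); last exact: gauss_seq_le (ltnW LN) gg.
  move=> l om lL; rewrite /dot; rewrite -kdL in lL.
  have lN : (l < N)%N by rewrite (ltn_trans _ LN) // -kdL.
  rewrite -(sum_delta (fun j => g j om) lN).
  by apply: eq_bigr => j _; rewrite uC ?ltn_ord -?kdL // mulrC.
have kL : (k < L)%N by rewrite -kdL addnS ltnS leq_addr.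
have kN : (k < N)%N := ltn_trans kL LN.
have [g' [C' [gg' uC' [CC' gC'] C0 Cp]]] := eliminate_column N kN gg uC.
apply: (gauss_seq_eq (g := fun l om => dot N g' C' om l)) => //.
apply: (IH k.+1) => //.
- by move=> l l' lL l'L; rewrite CC' CC.
- by rewrite addSnnS.
(* Above the diagonal the entry is the product with an earlier column, already a unit vector; below
   it the elimination applies. *)
have Cjk j : (j < N)%N -> j != k -> C' j k = 0.
  move=> jN; rewrite neq_ltn => /orP[jk|kj]; last by apply: C0; rewrite ?kj.
  have CC0 : dot N C' C' j k = 0.
    by rewrite CC' CC ?(ltn_trans jk kL) // (ltn_eqF jk).
  rewrite -[RHS]CC0 -[LHS](sum_delta (fun i => C' i k) jN) /dot.
  by apply: eq_bigr => i _; rewrite (uC' j).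
have Ckk : C' k k = 1.
  have : C' k k ^+ 2 = 1.
    have CC1 : dot N C' C' k k = 1 by rewrite CC' CC // eqxx.
    rewrite -[RHS]CC1 /dot (bigD1 (Ordinal kN)) //= -expr2 big1 ?addr0 // => j.
    by rewrite -val_eqE /= => jk; rewrite Cjk // mul0r.
  move/eqP; rewrite sqrf_eq1 => /orP[/eqP //|/eqP E].
  have := Cp (leq_ltn_trans kL LN) (leq_ltn_trans kL LN).
  by rewrite E oppr_ge0 ler10.
move=> l j; rewrite ltnS leq_eqVlt => /orP[/eqP -> jN|lk jN]; last exact: uC'.
by case: eqP => [->//|/eqP jk]; exact: Cjk.
Qed.

End Orthonormal.

(** * Square roots of positive semidefinite matrices *)

Section Cholesky.
Context {R : realType}.

(** Induction on the size through the Schur complement of the last diagonal entry [p]. When [p = 0],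
    positivity forces the last column to vanish, and then division by zero yields the right value
    [0]. *)
Lemma cholesky L (Q : nat -> nat -> R) :
  (forall l l', Q l l' = Q l' l) ->
  (forall d : nat -> R, 0 <= \sum_(l < L) \sum_(l' < L) d l * d l' * Q l l') ->
  exists b : nat -> nat -> R, forall l l', (l < L)%N -> (l' < L)%N ->
    dot L b b l l' = Q l l'.
Proof.
elim: L Q => [|L IH] Q Qs Qp; first by exists (fun _ _ => 0).
pose p := Q L L.
have formE (d : nat -> R) : \sum_(l < L.+1) \sum_(l' < L.+1) d l * d l' * Q l l' =
    \sum_(l < L) \sum_(l' < L) d l * d l' * Q l l' +
    d L * (\sum_(l < L) d l * Q l L) *+ 2 + d L ^+ 2 * p.
  rewrite big_ord_recr /= big_ord_recr /=.
  under eq_bigr do rewrite big_ord_recr /=.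
  rewrite big_split /= mulr2n -!addrA; congr (_ + _).
  rewrite addrA addrA; congr (_ + _).
  by rewrite mulr_sumr; congr (_ + _); apply: eq_bigr => l _; rewrite ?(Qs L l); ring.
have p0 : 0 <= p.
  pose d l : R := (l == L)%:R; have := Qp d; rewrite (formE d) /d eqxx.
  rewrite !big1; first by rewrite mul1r mul0rn !add0r expr1n mul1r.
    by move=> l _; rewrite ltn_eqF // mul0r.
  by move=> l _; rewrite big1 // => l' _; rewrite ltn_eqF // !mul0r.
have QL0 l : (l < L)%N -> p = 0 -> Q l L = 0.
  move=> lL pE; apply/eqP/negPn/negP => Ql.
  (* With this weight on the last coordinate and [1] on coordinate [l], the form takes the value
     [-1]. *)
  pose t := - (1 + Q l l) / (Q l L *+ 2).
  pose d j := if j == L then t else (j == l)%:R.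
  have := Qp d; rewrite (formE d) /d eqxx pE.
  have E (F : nat -> R) : \sum_(j < L) (if j == L :> nat then t else (j == l :> nat)%:R) * F j = F l.
    rewrite -[RHS](sum_delta F lL); apply: eq_bigr => j _.
    by rewrite ltn_eqF.
  rewrite (E (fun j => Q j L)) mulr0 addr0.
  under eq_bigr => i _.
    under eq_bigr do rewrite -mulrA.
    rewrite -mulr_sumr (E (fun j => Q i j)).
    over.
  rewrite (E (fun i => Q i l)); have -> : Q l l + t * Q l L *+ 2 = - 1.
    by rewrite /t -mulr_natr; field.
  by rewrite oppr_ge0 ler10.
pose Q' l l' := Q l l' - Q l L * Q l' L / p.
have [||b bE] := IH Q'.
- by move=> l l'; rewrite /Q' Qs [Q l L * _]mulrC.
- move=> d; pose S := \sum_(l < L) d l * Q l L.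
  have -> : \sum_(l < L) \sum_(l' < L) d l * d l' * Q' l l' =
      \sum_(l < L) \sum_(l' < L) d l * d l' * Q l l' - S ^+ 2 / p.
    have -> : S ^+ 2 / p = \sum_(l < L) d l * Q l L * (S / p).
      by rewrite -mulr_suml expr2 mulrA.
    rewrite -sumrB; apply: eq_bigr => l _.
    have -> : S / p = \sum_(l' < L) d l' * Q l' L / p by rewrite -mulr_suml.
    rewrite mulr_sumr -sumrB; apply: eq_bigr => l' _.
    by rewrite /Q'; ring.
  (* For [p != 0], [- S / p] minimises the form in its last variable, and the minimum is the form of
     the Schur complement. *)
  pose d' l := if (l < L)%N then d l else - S / p.
  have := Qp d'; rewrite (formE d') /d' ltnn.
  have -> : \sum_(l < L) (if (l < L)%N then d l else - S / p) * Q l L = S.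
    by apply: eq_bigr => l _; rewrite ltn_ord.
  under eq_bigr do under eq_bigr do rewrite !ltn_ord.
  have [pE|pn0] := eqVneq p 0; first by rewrite pE invr0 !(mulr0, mul0r, mul0rn) !addr0 subr0.
  by congr (_ <= _); rewrite -mulr_natr; field.
have sp : Num.sqrt p ^+ 2 = p by rewrite sqr_sqrtr.
exists (fun i l => if (i < L)%N then if (l < L)%N then b i l else 0
                   else Q l L / Num.sqrt p) => l l' lL l'L.
rewrite /dot big_ord_recr /= ltnn.
under eq_bigr do rewrite ltn_ord.
have E : Q l L / Num.sqrt p * (Q l' L / Num.sqrt p) = Q l L * Q l' L / p.
  by rewrite mulrACA -invfM -expr2 sp.
rewrite E; move: lL; rewrite ltnS leq_eqVlt => /orP[/eqP lE|lL].
  rewrite lE ltnn; under eq_bigr do rewrite mul0r.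
  rewrite big1 // add0r -/p mulrAC; have [pE|pn0] := eqVneq p 0; last by rewrite divff // mul1r Qs.
  rewrite pE invr0 mulr0 mul0r; move: l'L; rewrite ltnS leq_eqVlt => /orP[/eqP ->|l'L].
    by rewrite -/p pE.
  by rewrite Qs QL0.
rewrite lL; move: l'L; rewrite ltnS leq_eqVlt => /orP[/eqP lE|l'L].
  rewrite lE ltnn; under eq_bigr do rewrite mulr0.
  rewrite big1 // add0r -/p; have [pE|pn0] := eqVneq p 0; last by rewrite mulfK.
  by rewrite pE invr0 mulr0 QL0.
by rewrite l'L -/(dot L b b l l') bE // /Q' subrK.
Qed.

End Cholesky.

(** * Contractions of Gaussian vectors *)

Section Contraction.
Context {R : realType} {dO} {Omega : measurableType dO} (P : probability Omega R).
Variable g : nat -> Omega -> R.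
Hypothesis hg : forall K, gauss_seq P K g.

Definition vec L (u : nat -> R) : L.-tuple R := [tuple u l | l < L].

Lemma measurable_vec L (u : nat -> Omega -> R) :
  (forall l, (l < L)%N -> measurable_fun setT (u l)) ->
  measurable_fun setT (fun om => vec L (u^~ om)).
Proof.
move=> mu; apply/measurable_fun_tnthP => i.
rewrite (_ : _ \o _ = u i); first exact: mu.
by apply/funext => om /=; rewrite tnth_mktuple.
Qed.

(* [a] is completed to an isometry by a square root [b] of [I - a^T a]; the
   Gaussian vectors [g a + g' b] and [g a - g' b] are then standard and [g a]
   is their mean. *)
Lemma gauss_contraction N L (a : nat -> nat -> R) (phi : L.-tuple R -> R) :
  (forall d : nat -> R,
    \sum_(i < N) (\sum_(l < L) a i l * d l) ^+ 2 <= \sum_(l < L) d l ^+ 2) ->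
  measurable_fun setT phi -> (forall t, 0 <= phi t) ->
  (forall u v : nat -> R, phi (vec L u) <=
    (phi (vec L (fun l => u l + v l)) + phi (vec L (fun l => u l - v l))) / 2) ->
  (\int[P]_om (phi (vec L (fun l => \sum_(i < N) a i l * g i om)))%:E <=
   \int[P]_om (phi (vec L (g^~ om)))%:E)%E.
Proof.
move=> ac mphi phi0 phic.
pose Q (l l' : nat) := (l == l')%:R - dot N a a l l'.
have [||b bE] := @cholesky R L Q.
- move=> l l'; rewrite /Q eq_sym; congr (_ - _).
  by apply: eq_bigr => i _; rewrite mulrC.
- move=> d.
  rewrite (_ : \sum_(l < L) _ = \sum_(l < L) d l ^+ 2 -
      \sum_(i < N) (\sum_(l < L) a i l * d l) ^+ 2) ?subr_ge0 //.
  under [X in _ = _ - X]eq_bigr do rewrite expr2 mulr_suml.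
  rewrite [X in _ = _ - X]exchange_big -sumrB; apply: eq_bigr => l _.
  under [X in _ = _ - X]eq_bigr do rewrite mulr_sumr.
  rewrite [X in _ = _ - X]exchange_big /= /Q.
  under eq_bigr do rewrite mulrBr.
  rewrite sumrB; congr (_ - _).
    rewrite expr2 -(sum_delta (fun l' => d l * d l') (ltn_ord l)).
    by apply: eq_bigr => l' _; rewrite mulrC eq_sym.
  apply: eq_bigr => l' _; rewrite /dot mulr_sumr; apply: eq_bigr => i _.
  by ring.
(* The rows of [a], then those of [s * b], then a zero row, so that there are strictly more rows
   than columns as [gauss_seq_orthonormal] asks. *)
pose C (s : R) j l := if (j < N)%N then a j l
                      else if (j < N + L)%N then s * b (j - N)%N l else 0.
have dotC T (f : nat -> T -> R) s x l : dot (N + L).+1 f (C s) x l =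
    \sum_(i < N) f i x * a i l + s * \sum_(i < L) f (N + i)%N x * b i l.
  rewrite /dot big_ord_recr /= {2}/C ltnNge leq_addr /= ltnn mulr0 addr0.
  rewrite big_split_ord /=; congr (_ + _).
    by apply: eq_bigr => i _; rewrite /C ltn_ord.
  rewrite mulr_sumr; apply: eq_bigr => i _.
  by rewrite /C ltnNge leq_addr /= ltn_add2l ltn_ord addKn mulrCA.
have orth s : s ^+ 2 = 1 -> forall l l', (l < L)%N -> (l' < L)%N ->
    dot (N + L).+1 (C s) (C s) l l' = (l == l')%:R.
  move=> s1 l l' lL l'L; rewrite dotC.
  have -> : \sum_(i < N) C s i l * a i l' = dot N a a l l'.
    by apply: eq_bigr => i _; rewrite /C ltn_ord.
  have -> : \sum_(i < L) C s (N + i)%N l * b i l' = s * dot L b b l l'.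
    rewrite mulr_sumr; apply: eq_bigr => i _.
    by rewrite /C ltnNge leq_addr /= ltn_add2l ltn_ord addKn mulrA.
  by rewrite mulrA -expr2 s1 mul1r bE // /Q addrC subrK.
have gC s : s ^+ 2 = 1 -> gauss_seq P L (fun l om => dot (N + L).+1 g (C s) om l).
  move=> s1; apply: gauss_seq_orthonormal => //; last exact: orth.
  by rewrite ltnS leq_addl.
pose E s := (\int[P]_om (phi (vec L (fun l => dot (N + L).+1 g (C s) om l)))%:E)%E.
have mE : measurable_fun setT (EFin \o phi) by exact/measurable_EFinP.
have EE s : s ^+ 2 = 1 -> E s = (\int[P]_om (phi (vec L (g^~ om)))%:E)%E.
  move=> s1; apply: (gauss_seq_law (gC _ s1) (hg L) mE) => t.
  by rewrite lee_fin.
have N11 : (- 1 : R) ^+ 2 = 1 by rewrite sqrrN expr1n.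
have mphiC s : s ^+ 2 = 1 ->
    measurable_fun setT (fun om => phi (vec L (fun l => dot (N + L).+1 g (C s) om l))).
  move=> s1; apply: (measurableT_comp mphi); apply: measurable_vec => l lL.
  by have [+ _] := gC _ s1; exact.
have -> : (\int[P]_om (phi (vec L (g^~ om)))%:E)%E = ((2^-1)%:E * (E 1%R + E (- 1)%R))%E.
  rewrite !EE ?expr1n //; set X := (\int[P]_om _)%E.
  have X0 : (0 <= X)%E by apply: integral_ge0 => om _; rewrite lee_fin.
  rewrite -[in RHS](mul1e X) -ge0_muleDl ?lee_fin // muleA -EFinD -EFinM.
  by rewrite -[1 + 1]/(2%:R) mulVf // mul1e.
pose f s om := (phi (vec L (fun l => dot (N + L).+1 g (C s) om l)))%:E.
have mf s : s ^+ 2 = 1 -> measurable_fun setT (f s).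
  by move=> s1; apply/measurable_EFinP; exact: mphiC.
have f0 s om : (0 <= f s om)%E by rewrite lee_fin.
have p1 : (1 : R) ^+ 2 = 1 by rewrite expr1n.
have -> : (E 1%R + E (- 1)%R = \int[P]_om (f 1%R om + f (- 1)%R om))%E.
  by rewrite ge0_integralD //; exact: mf.
have mff : measurable_fun setT (fun om => f 1%R om + f (- 1)%R om)%E.
  by apply: emeasurable_funD; exact: mf.
have -> : ((2^-1)%:E * \int[P]_om (f 1%R om + f (- 1)%R om) =
    \int[P]_om ((2^-1)%:E * (f 1%R om + f (- 1)%R om)))%E.
  by rewrite ge0_integralZl ?lee_fin ?invr_ge0 // => om _; rewrite adde_ge0.
apply: ge0_le_lower_integral => om _; first by rewrite lee_fin.
rewrite /f -EFinD -EFinM lee_fin mulrC.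
pose v l := \sum_(i < L) g (N + i)%N om * b i l.
have := phic (fun l => \sum_(i < N) a i l * g i om) v.
congr (_ <= (phi (vec L _) + phi (vec L _)) / 2); apply/funext => l.
  by rewrite dotC mul1r; congr (_ + _); apply: eq_bigr => i _; rewrite mulrC.
by rewrite dotC mulN1r; congr (_ - _); apply: eq_bigr => i _; rewrite mulrC.
Qed.

End Contraction.

(** * Second moments of Gaussian variables *)

Section Moments.
Context {R : realType}.
Local Notation leb := (@lebesgue_measure R).
Local Notation gau := (@normal_prob R 0 1).

Definition sigma2 : R := fine (\int[@stdgauss R]_x (x ^+ 2)%:E)%E.

Let integral_stdgauss (f : R -> \bar R) :
  measurable_fun setT f -> (forall x, 0 <= f x)%E ->
  (\int[@stdgauss R]_x f x = \int[leb]_x (f x * (normal_pdf 0 1 x)%:E))%E.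
Proof.
move=> mf f0; rewrite -ge0_integral_gauss //.
have mid : measurable_fun [set: measurableTypeR R] (fun x : measurableTypeR R => x : R).
  by move=> _ B mB; rewrite setTI.
rewrite -(ge0_integral_image_measure gau mid mf f0).
by apply: eq_measure_integral => A mA _; rewrite /= stdgaussE.
Qed.

Let mX2 : measurable_fun setT (fun x : R => (x ^+ 2)%:E).
Proof. by apply/measurable_EFinP; exact: measurable_funX. Qed.

(** Comparison with the normal density of variance [2]: at [y = x^2 / 4], the bound
    [y * expR (- y) <= 1] gives [x^2 * expR (- x^2 / 2) <= 4 * expR (- x^2 / 4)]. *)
Lemma integral_sqr_stdgauss_lty : (\int[@stdgauss R]_x (x ^+ 2)%:E < +oo)%E.
Proof.
rewrite integral_stdgauss //; last by move=> x; rewrite lee_fin sqr_ge0.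
pose s : R := Num.sqrt 2.
have s20 : s ^+ 2 = 2 by rewrite sqr_sqrtr.
have s0 : s != 0 by rewrite sqrtr_eq0 -ltNge.
pose k : R := 4 * normal_peak 1 / normal_peak s.
have k0 : 0 <= k by rewrite divr_ge0 ?mulr_ge0 ?normal_peak_ge0.
apply: (@le_lt_trans _ _ (\int[leb]_x (k%:E * (normal_pdf 0 s x)%:E))%E).
  apply: ge0_le_lower_integral => x _.
    by rewrite -EFinM lee_fin mulr_ge0 ?sqr_ge0 ?normal_pdf_ge0.
  rewrite -!EFinM lee_fin !normal_pdfE ?oner_neq0 //.
  rewrite /normal_fun subr0 expr1n s20 /k.
  set p1 := normal_peak 1; set p2 := normal_peak s.
  have p20 : p2 != 0 by rewrite gt_eqF // normal_peak_gt0.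
  pose y := x ^+ 2 / 4.
  have -> : - x ^+ 2 / (1 *+ 2) = - y - y by rewrite /y; field.
  have -> : - x ^+ 2 / (2 *+ 2) = - y by rewrite /y; field.
  have -> : 4 * p1 / p2 * (p2 * expR (- y)) = 4 * p1 * expR (- y) * 1 by field.
  have -> : x ^+ 2 * (p1 * expR (- y - y)) =
      4 * p1 * expR (- y) * (y * expR (- y)) by rewrite expRD /y; field.
  rewrite ler_wpM2l ?mulr_ge0 ?normal_peak_ge0 ?expR_ge0 //.
  rewrite expRN ler_pdivrMr ?expR_gt0 // mul1r.
  by apply: le_trans (expR_ge1Dx y); rewrite lerDr.
rewrite ge0_integralZl //=; last 2 first.
- by apply/measurable_EFinP; exact: measurable_normal_pdf.
- by move=> x _; rewrite lee_fin normal_pdf_ge0.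
by rewrite integral_normal_pdf mule1 ltry.
Qed.

Lemma sigma2E : (\int[@stdgauss R]_x (x ^+ 2)%:E)%E = sigma2%:E.
Proof.
rewrite /sigma2 fineK // ge0_fin_numE ?integral_sqr_stdgauss_lty //.
by apply: integral_ge0 => x _; rewrite lee_fin sqr_ge0.
Qed.

(** If the moment vanished, [x^2] would be zero almost everywhere and the measure would be carried
    by the null set of the origin. *)
Lemma sigma2_gt0 : 0 < sigma2.
Proof.
rewrite lt0r; apply/andP; split; last first.
  by rewrite -lee_fin -sigma2E; apply: integral_ge0 => x _; rewrite lee_fin sqr_ge0.
apply/negP => /eqP s0.
have : (\int[@stdgauss R]_x `| (x ^+ 2)%:E | = 0)%E.
  transitivity (sigma2%:E); last by rewrite s0.
  rewrite -sigma2E; apply: eq_integral => x _.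
  by rewrite gee0_abs // lee_fin sqr_ge0.
move/(ae_eq_integral_abs _ measurableT mX2) => [N [mN N0 subN]].
have : (@stdgauss R setT <= @stdgauss R N + @stdgauss R [set 0%R])%E.
  apply: le_trans (measureU2 _ mN (measurable_set1 0)).
  apply: le_measure; rewrite ?inE //; first exact: measurableU.
  move=> x _; have [->|x0] := eqVneq x 0; [by right|left].
  apply: subN => /= /(_ I) [] /eqP.
  by rewrite sqrf_eq0 (negbTE x0).
rewrite probability_setT N0 add0e stdgaussE /normal_prob integral_set1.
by rewrite lee_fin ler10.
Qed.

Variables (dO : measure_display) (Omega : measurableType dO).
Variables (P : probability Omega R) (g : nat -> Omega -> R).
Hypothesis hg : forall K, gauss_seq P K g.

(** The coefficients form a single orthonormal column, and [1 < N] is the strict inequality of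
    [gauss_seq_orthonormal]. *)
Let gauss_seq_lin N (c : nat -> R) : (1 < N)%N -> \sum_(i < N) c i ^+ 2 = 1 ->
  gauss_seq P 1 (fun _ om => \sum_(i < N) c i * g i om).
Proof.
move=> N1 c1.
have /(@gauss_seq_orthonormal _ _ _ _ _ 1%N _ (fun i _ => c i)) H := hg N.
apply: gauss_seq_eq (H N1 _) => [l om _|l l'].
  by apply: eq_bigr => i _; rewrite mulrC.
rewrite !ltnS !leqn0 => /eqP -> /eqP ->; rewrite eqxx -[RHS]c1.
by apply: eq_bigr => i _; rewrite expr2.
Qed.

Let gauss_seq_coord j : gauss_seq P 1 (fun _ => g j).
Proof.
have jN : (j < j.+2)%N by [].
apply: gauss_seq_eq (@gauss_seq_lin j.+2 (fun i => (i == j)%:R) _ _) => //.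
  by move=> _ om _; rewrite (sum_delta (g^~ om)).
rewrite -[RHS](sum_delta (fun=> 1) jN); apply: eq_bigr => i _.
by rewrite mulr1; case: (_ == _); rewrite ?expr1n ?expr0n.
Qed.

Let gauss_seq_id : gauss_seq (@stdgauss R) 1 (fun _ => id).
Proof.
split=> // B mB; rewrite big_ord_recl big_ord0 mule1; congr (stdgauss _).
by apply/seteqP; split => x /= H; [exact: H|move=> [|]].
Qed.

Let integral_sqr_gauss (h : Omega -> R) : gauss_seq P 1 (fun _ => h) ->
  (\int[P]_om (h om ^+ 2)%:E = sigma2%:E)%E.
Proof.
move=> hh; rewrite -sigma2E.
pose phi (t : 1.-tuple R) := (tnth t ord0 ^+ 2)%:E.
have mphi : measurable_fun setT phi.
  apply/measurable_EFinP; apply: (measurable_funX 2).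
  exact: measurable_tnth.
have phi0 t : (0 <= phi t)%E by rewrite lee_fin sqr_ge0.
have := gauss_seq_law hh gauss_seq_id mphi phi0.
by under eq_integral do rewrite /phi tnth_mktuple;
   under [in X in _ = X]eq_integral do rewrite /phi tnth_mktuple.
Qed.

Lemma gauss_sqr j : (\int[P]_om (g j om ^+ 2)%:E = sigma2%:E)%E.
Proof. exact: integral_sqr_gauss. Qed.

Lemma measurable_gauss j : measurable_fun setT (g j).
Proof. by have [+ _] := hg j.+1; apply. Qed.

Lemma integrable_gauss_mul i j :
  P.-integrable setT (fun om => (g i om * g j om)%:E).
Proof.
have mg := measurable_gauss.
apply: (@le_integrable _ _ _ _ _ measurableT _
    (fun om => (g i om ^+ 2)%:E + (g j om ^+ 2)%:E)%E).
- by apply/measurable_EFinP; exact: measurable_funM.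
- move=> om _; rewrite -EFinD !abse_EFin lee_fin [leRHS]ger0_norm; last first.
    by rewrite addr_ge0 ?sqr_ge0.
  rewrite normrM -[g i om ^+ 2]real_normK ?num_real // -[g j om ^+ 2]real_normK ?num_real //.
  by have := sqr_ge0 (`|g i om| - `|g j om|); have := normr_ge0 (g i om); have := normr_ge0 (g j om); nra.
- have I k : P.-integrable setT (fun om => (g k om ^+ 2)%:E).
    apply/integrableP; split.
      by apply/measurable_EFinP; exact: measurable_funX.
    under eq_integral do rewrite gee0_abs ?lee_fin ?sqr_ge0 //.
    by rewrite gauss_sqr ltry.
  exact: integrableD.
Qed.

(** [(g i + g j) / sqrt 2] is again a standard Gaussian; expanding its second moment forces the
    mixed term to vanish. *)
Lemma gauss_uncorrelated i j : i != j ->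
  (\int[P]_om (g i om * g j om)%:E = 0)%E.
Proof.
move=> ij; have r2 : (Num.sqrt (2^-1 : R)) ^+ 2 = 2^-1 by rewrite sqr_sqrtr.
pose r : R := Num.sqrt 2^-1.
pose N := (i + j).+2.
have iN : (i < N)%N by rewrite ltnS leqW // leq_addr.
have jN : (j < N)%N by rewrite ltnS leqW // leq_addl.
have hh : gauss_seq P 1 (fun _ om => r * (g i om + g j om)).
  apply: gauss_seq_eq (@gauss_seq_lin N (fun k => r * ((k == i)%:R + (k == j)%:R)) _ _) => //.
    move=> _ om _; rewrite -(sum_delta (g^~ om) iN) -(sum_delta (g^~ om) jN).
    rewrite -big_split mulr_sumr; apply: eq_bigr => k _ /=; ring.
  transitivity (\sum_(k < N) 2^-1 * ((k == i :> nat)%:R * 1 + (k == j :> nat)%:R * 1) : R).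
    apply: eq_bigr => k _; rewrite exprMn r2; congr (_ * _).
    case: eqP => [->|_]; [rewrite (negbTE ij)|case: eqP => _];
      by rewrite !(mul0r, mul1r, add0r, addr0, expr1n, expr0n).
  rewrite -mulr_sumr big_split /= (sum_delta (fun=> 1) iN) (sum_delta (fun=> 1) jN).
  by rewrite -[1 + 1]/(2%:R) mulVf.
have := integral_sqr_gauss hh.
have I := integrable_gauss_mul.
have -> : (\int[P]_om ((r * (g i om + g j om)) ^+ 2)%:E =
    \int[P]_om (2^-1%:E * ((g i om * g i om)%:E + (g j om * g j om)%:E) +
      (g i om * g j om)%:E))%E.
  apply: eq_integral => om _.
  transitivity ((2^-1 * (g i om * g i om + g j om * g j om) + g i om * g j om)%:E) => //.
  by congr (_%:E); rewrite exprMn r2; field.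
have Isum : P.-integrable setT (fun om => ((g i om * g i om)%:E + (g j om * g j om)%:E)%E).
  exact: (integrableD measurableT (I i i) (I j j)).
rewrite integralD //; last by apply: integrableZl.
rewrite integralZl // integralD //.
under eq_integral do rewrite -expr2.
under [X in (_ * (_ + X))%E]eq_integral do rewrite -expr2.
rewrite !gauss_sqr.
have : (\int[P]_om (g i om * g j om)%:E)%E \is a fin_num.
  exact: (integrable_fin_num measurableT (I i j)).
case: (\int[P]_om (g i om * g j om)%:E)%E => // z _ [] E; congr (_%:E).
by move: E; lra.
Qed.

(** Only diagonal terms survive the expectation. This is how a trace arises from the pairing of two
    Gaussian sums. *)
Lemma gauss_quadratic N (r : nat -> nat -> R) :
  P.-integrable setT (fun om => (\sum_(i < N) \sum_(j < N) g i om * g j om * r i j)%:E) /\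
  (\int[P]_om (\sum_(i < N) \sum_(j < N) g i om * g j om * r i j)%:E =
   (sigma2 * \sum_(i < N) r i i)%:E)%E.
Proof.
have Irij i j : P.-integrable setT (fun om => (g i om * g j om * r i j)%:E).
  under eq_fun do rewrite EFinM.
  by apply: integrableZr => //; exact: integrable_gauss_mul.
have Ij i : P.-integrable setT (fun om => (\sum_(j < N) g i om * g j om * r i j)%:E).
  under eq_fun do rewrite -sumEFin.
  by apply: integrable_sum => // j _; exact: Irij.
split.
  under eq_fun do rewrite -sumEFin.
  by apply: integrable_sum => // i _; exact: Ij.
under eq_integral do rewrite -sumEFin.
rewrite integral_sum //.
rewrite mulr_sumr -sumEFin; apply: eq_bigr => i _.
under eq_integral do rewrite -sumEFin.
rewrite integral_sum //.
have -> : (sigma2 * r i i)%:E = (\sum_(j < N) ((j == i :> nat)%:R * (sigma2 * r i j))%:E)%E.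
  by rewrite sumEFin (sum_delta (fun j => sigma2 * r i j) (ltn_ord i)).
apply: eq_bigr => j _; under eq_integral do rewrite EFinM.
rewrite integralZr //; last exact: integrable_gauss_mul.
have [->|ij] := eqVneq (j : nat) i.
  under eq_integral do rewrite -expr2.
  by rewrite gauss_sqr mul1r.
by rewrite gauss_uncorrelated ?mul0r ?mul0e // eq_sym.
Qed.

End Moments.

(** * Gaussian sums in a normed space *)

Section ComplexFacts.
Context {R : realType}.
Local Notation C := R[i].
Implicit Types (a b : R) (z w : C).

Definition ci : C := cmk 0 1.

Lemma complex_eq z w : cre z = cre w -> cim z = cim w -> z = w.
Proof. by case: z w => [a b] [c d] /= -> ->. Qed.

Lemma creD z w : cre (z + w) = cre z + cre w. Proof. by case: z w => [? ?] []. Qed.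
Lemma cimD z w : cim (z + w) = cim z + cim w. Proof. by case: z w => [? ?] []. Qed.
Lemma creN z : cre (- z) = - cre z. Proof. by case: z. Qed.
Lemma cimN z : cim (- z) = - cim z. Proof. by case: z. Qed.
Lemma creM z w : cre (z * w) = cre z * cre w - cim z * cim w.
Proof. by case: z w => [? ?] []. Qed.
Lemma cimM z w : cim (z * w) = cre z * cim w + cim z * cre w.
Proof. by case: z w => [? ?] []. Qed.
Lemma cre_rcM a z : cre (rc a * z) = a * cre z.
Proof. by rewrite creM mul0r subr0. Qed.
Lemma cim_rcM a z : cim (rc a * z) = a * cim z.
Proof. by rewrite cimM mul0r addr0. Qed.
Lemma rcD a b : rc (a + b) = rc a + rc b.
Proof. by apply: complex_eq; rewrite /= ?addr0. Qed.
Lemma rcN a : rc (- a) = - rc a.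
Proof. by apply: complex_eq; rewrite /= ?oppr0. Qed.
Lemma rcM a b : rc (a * b) = rc a * rc b.
Proof. by apply: complex_eq; rewrite ?creM ?cimM /= ?mulr0 ?mul0r ?addr0 ?subr0. Qed.
Lemma rc0 : rc (0 : R) = 0. Proof. by []. Qed.
Lemma rc1 : rc (1 : R) = 1. Proof. by []. Qed.
Lemma rc_sum (I : Type) (r : seq I) (Q : pred I) (F : I -> R) :
  rc (\sum_(i <- r | Q i) F i) = \sum_(i <- r | Q i) rc (F i).
Proof. by elim/big_rec2 : _ => // i x y _ <-; rewrite rcD. Qed.
Lemma cre_sum (I : Type) (r : seq I) (Q : pred I) (F : I -> C) :
  cre (\sum_(i <- r | Q i) F i) = \sum_(i <- r | Q i) cre (F i).
Proof. by elim/big_rec2 : _ => // i x y _ <-; rewrite creD. Qed.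

Lemma normc_cabs z : `|z| = rc (cabs z). Proof. by rewrite normc_def. Qed.
Lemma cabsM z w : cabs (z * w) = cabs z * cabs w.
Proof. by have := normrM z w; rewrite !normc_cabs -rcM => -[]. Qed.
Lemma cabs_rc a : cabs (rc a) = `|a|.
Proof. by rewrite /cabs /= expr0n addr0 sqrtr_sqr. Qed.
Lemma cabs_ge0 z : 0 <= cabs z. Proof. exact: sqrtr_ge0. Qed.
Lemma cabsN z : cabs (- z) = cabs z.
Proof. by rewrite /cabs creN cimN !sqrrN. Qed.
Lemma sqr_cabs z : cabs z ^+ 2 = cre z ^+ 2 + cim z ^+ 2.
Proof. by rewrite sqr_sqrtr // addr_ge0 ?sqr_ge0. Qed.
Lemma cabs0 : cabs (0 : C) = 0.
Proof. by rewrite -rc0 cabs_rc normr0. Qed.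
Lemma cabs1 : cabs (1 : C) = 1.
Proof. by rewrite -rc1 cabs_rc normr1. Qed.
Lemma cabs_cconj z : cabs (cconj z) = cabs z.
Proof. by rewrite /cabs /= sqrrN. Qed.
Lemma cabsD z w : cabs (z + w) <= cabs z + cabs w.
Proof. by have := ler_normD z w; rewrite !normc_cabs -rcD lecE /= => /andP[]. Qed.
Lemma cre_le_cabs z : `|cre z| <= cabs z.
Proof. by rewrite -sqrtr_sqr ler_wsqrtr // lerDl sqr_ge0. Qed.
Lemma cim_le_cabs z : `|cim z| <= cabs z.
Proof. by rewrite -sqrtr_sqr ler_wsqrtr // lerDr sqr_ge0. Qed.
Lemma cabs_eq0 z : cabs z = 0 -> z = 0.
Proof.
move=> z0; have := sqr_cabs z; rewrite z0 expr0n /= => /esym/eqP.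
rewrite paddr_eq0 ?sqr_ge0 // !sqrf_eq0 => /andP[/eqP re0 /eqP im0].
exact: complex_eq.
Qed.
Lemma mul_cconj z : z * cconj z = rc (cabs z ^+ 2).
Proof.
by rewrite sqr_cabs; apply: complex_eq; rewrite ?creM ?cimM /=; ring.
Qed.

Lemma cfun_addE (T : Type) (f h : T -> C) x : (f + h) x = f x + h x.
Proof. by []. Qed.
Lemma cfun_scaleE (T : Type) z (f : T -> C) x : (z *: f) x = z * f x.
Proof. by []. Qed.

End ComplexFacts.

Section MeasurableTuple.
Context {R : realType}.

Lemma measurable_lt_sets d (T : measurableType d) (D : set T) (f : T -> R) :
  (forall a, measurable (D `&` [set x | f x < a])) -> measurable_fun D f.
Proof.
move=> H mD; apply: (measurability _ (RGenInftyO.measurableE R)) => //.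
by move=> _ [_ [a ->] <-]; rewrite preimage_itvNyo.
Qed.

(** A sublevel set of [p] is the union, over rational points, of sublevel sets of the Lipschitz
    majorants centred there, which are visibly measurable. It serves for norms on spaces without a
    sigma-algebra, seen as functions of finitely many real coefficients. *)
Lemma measurable_lipschitz_tuple L (c : 'I_L -> R) (p : L.-tuple R -> R) :
  (forall l, 0 <= c l) ->
  (forall t t', p t <= p t' + \sum_(l < L) c l * `|tnth t l - tnth t' l|) ->
  measurable_fun setT p.
Proof.
move=> c0 pc; apply: measurable_lt_sets => a; rewrite setTI.
pose q (v : L.-tuple rat) : L.-tuple R := [tuple ratr (tnth v l) | l < L].
pose B (v : L.-tuple rat) := [set t : L.-tuple R |
  p (q v) + \sum_(l < L) c l * `|tnth t l - tnth (q v) l| < a].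
rewrite (_ : [set _ | _] = \bigcup_v B v).
  apply: countable_bigcupT_measurable => // v.
  rewrite /B -[X in measurable X]setTI.
  have mf : measurable_fun setT (fun t : L.-tuple R =>
      p (q v) + \sum_(l < L) c l * `|tnth t l - tnth (q v) l|).
    apply: measurable_funD => //; apply: measurable_sum => l.
    apply: measurable_funM => //; apply: measurableT_comp => //.
    by apply: measurable_funB => //; exact: measurable_tnth.
  have := mf measurableT `]-oo, a[%classic (measurable_itv _).
  by rewrite preimage_itvNyo.
apply/seteqP; split => [t /= pta|t [v _] /=]; last exact: le_lt_trans.
(* One third of the gap bounds the distance term, one third the growth of [p] up to the rational
   point; the last third keeps the inequality strict. *)
pose e := (a - p t) / 3.
have e0 : 0 < e by rewrite divr_gt0 // subr_gt0.
pose S := \sum_(l < L) c l.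
have S0 : 0 <= S by apply: sumr_ge0.
pose de := e / (S + 1).
have de0 : 0 < de by rewrite divr_gt0 // ltr_wpDl.
have /choice[v vP] : forall l : 'I_L, exists r : rat, `|tnth t l - ratr r| < de.
  move=> l; have : tnth t l - de < tnth t l + de.
    by rewrite ltrD2l; rewrite gtrN.
  move=> /rat_in_itvoo[r]; rewrite in_itv /= => /andP[r1 r2].
  by exists r; rewrite ltr_distl; apply/andP; split; lra.
exists [tuple v l | l < L] => //=; rewrite /B /=.
set T := \sum_(l < L) _.
have Te : T <= e.
  apply: (@le_trans _ _ (S * de)).
    rewrite mulr_suml; apply: ler_sum => l _; apply: ler_wpM2l => //.
    by rewrite !tnth_mktuple ltW.
  rewrite /de mulrA ler_pdivrMr ?ltr_wpDl // mulrC.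
  by rewrite ler_pM2l // lerDl.
have := pc (q [tuple v l | l < L]) t.
have -> : \sum_(l < L) c l * `|tnth (q [tuple v l0 | l0 < L]) l - tnth t l| = T.
  by apply: eq_bigr => l _; rewrite distrC.
have e3 : 3 * e = a - p t by rewrite /e; field.
lra.
Qed.

End MeasurableTuple.

Section GaussSums.
Context {R : realType}.
Local Notation C := R[i].
Variables (Z : lmodType C) (S : set Z) (nZ : Z -> R).

(** One interface for [X], with [S = setT], and for [X'], which lives inside the space of all
    functions [X -> C] as the subset [is_Xdual]. *)
Definition seminormed : Prop :=
  [/\ S 0, forall x y, S x -> S y -> S (x + y), forall a x, S x -> S (a *: x),
      forall x y, S x -> S y -> nZ (x + y) <= nZ x + nZ y &
      forall a x, S x -> nZ (a *: x) = cabs a * nZ x].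

Hypothesis sn : seminormed.

Lemma seminormed0 : S 0. Proof. by case: sn. Qed.
Lemma seminormedD x y : S x -> S y -> S (x + y). Proof. by case: sn => _ + _ _ _; apply. Qed.
Lemma seminormedZ a x : S x -> S (a *: x). Proof. by case: sn => _ _ + _ _; apply. Qed.
Lemma nZD x y : S x -> S y -> nZ (x + y) <= nZ x + nZ y. Proof. by case: sn => _ _ _ + _; apply. Qed.
Lemma nZZ a x : S x -> nZ (a *: x) = cabs a * nZ x. Proof. by case: sn => _ _ _ _; apply. Qed.
Lemma nZ_ge0 x : S x -> 0 <= nZ x.
Proof.
move=> Sx; have := nZD Sx (seminormedZ (- 1) Sx).
rewrite scaleN1r subrr -(scale0r x) -scaleN1r !nZZ // cabsN cabs1 cabs0 !mul0r mul1r.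
by rewrite -mulr2n pmulrn_lge0.
Qed.

Definition comb L (x : nat -> Z) (u : nat -> R) : Z := \sum_(l < L) rc (u l) *: x l.

Lemma seminormed_comb L x u : (forall l, S (x l)) -> S (comb L x u).
Proof.
move=> Sx; rewrite /comb; elim/big_ind : _ => [|a b Sa Sb|l _].
- exact: seminormed0.
- exact: seminormedD.
- exact: seminormedZ.
Qed.

Lemma comb_ext L x u v : (forall l, (l < L)%N -> u l = v l) -> comb L x u = comb L x v.
Proof. by move=> uv; apply: eq_bigr => l _; rewrite uv. Qed.

Lemma combD L x u v : comb L x (fun l => u l + v l) = comb L x u + comb L x v.
Proof. by rewrite /comb -big_split; apply: eq_bigr => l _; rewrite rcD scalerDl. Qed.

Lemma combZ L x a u : comb L x (fun l => a * u l) = rc a *: comb L x u.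
Proof. by rewrite /comb scaler_sumr; apply: eq_bigr => l _; rewrite rcM scalerA. Qed.

Lemma comb_comb L N (x : nat -> Z) (a : nat -> nat -> R) u :
  comb N (fun i => comb L x (a i)) u = comb L x (fun l => \sum_(i < N) a i l * u i).
Proof.
rewrite /comb; under eq_bigr do rewrite scaler_sumr.
rewrite exchange_big; apply: eq_bigr => l _.
rewrite rc_sum scaler_suml; apply: eq_bigr => i _.
by rewrite scalerA -rcM mulrC.
Qed.

Lemma nZ_comb L x u : (forall l, S (x l)) ->
  nZ (comb L x u) <= \sum_(l < L) nZ (x l) * `|u l|.
Proof.
move=> Sx; rewrite /comb; elim: L => [|L IH].
  by rewrite !big_ord0 -(scale0r 0) nZZ ?cabs0 ?mul0r //; exact: seminormed0.
rewrite !big_ord_recr /= (le_trans (nZD _ _)) ?lerD //.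
- exact: seminormed_comb.
- exact: seminormedZ.
- by rewrite nZZ // cabs_rc mulrC.
Qed.

(** The integrand of [gq] as a function of the coefficient tuple, the form to which statements on
    laws of Gaussian vectors apply. *)
Definition tcomb L (x : nat -> Z) (t : L.-tuple R) : R :=
  nZ (\sum_(l < L) rc (tnth t l) *: x l) ^+ 2.

Lemma tcomb_vec L x u : tcomb x (vec L u) = nZ (comb L x u) ^+ 2.
Proof.
by congr (nZ _ ^+ 2); apply: eq_bigr => l _; rewrite tnth_mktuple.
Qed.

Lemma measurable_tcomb L x : (forall l, S (x l)) ->
  measurable_fun setT (@tcomb L x).
Proof.
move=> Sx; apply: measurable_funX.
have Sc t : S (\sum_(l < L) rc (tnth t l) *: x l).
  elim/big_ind : _ => [|a b Sa Sb|l _].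
  - exact: seminormed0.
  - exact: seminormedD.
  - exact: seminormedZ.
apply: (@measurable_lipschitz_tuple _ _ (fun l => nZ (x l))) => [l|t t'].
  exact: nZ_ge0.
(* The difference of the coefficients as a sequence on [nat], extended by [0] from [L] on. *)
pose d : nat -> R := fun l => if insub l is Some i then tnth t i - tnth t' i else 0.
have dE (l : 'I_L) : d l = tnth t l - tnth t' l by rewrite /d insubT // => lL; congr (tnth t _ - tnth t' _); apply: val_inj.
rewrite (_ : \sum_(l < L) rc (tnth t l) *: x l =
    \sum_(l < L) rc (tnth t' l) *: x l + comb L x d).
  rewrite (le_trans (nZD _ _)) ?lerD2l //; first exact: seminormed_comb.
  by rewrite (le_trans (nZ_comb _ _ _)) //; under eq_bigr do rewrite dE.
rewrite -big_split; apply: eq_bigr => l _ /=.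
by rewrite -scalerDl -rcD dE addrC subrK.
Qed.

Section OneSpace.
Context {dO} {Omega : measurableType dO} (P : probability Omega R).
Variable g : nat -> Omega -> R.
Hypothesis hg : forall K, gauss_seq P K g.

Definition gq (x : nat -> Z) (L : nat) : \bar R :=
  (\int[P]_om (nZ (comb L x (g^~ om)) ^+ 2)%:E)%E.

Lemma measurable_gq x L : (forall l, S (x l)) ->
  measurable_fun setT (fun om => (nZ (comb L x (g^~ om)) ^+ 2)%:E).
Proof.
move=> Sx; apply/measurable_EFinP; under eq_fun do rewrite -tcomb_vec.
apply: (measurableT_comp (measurable_tcomb Sx)); apply: measurable_vec => l _.
exact: (measurable_gauss hg).
Qed.

(** The squared norm is midpoint convex, so the contraction principle for Gaussian vectors applies
    to it. *)
Lemma gq_contraction N L (a : nat -> nat -> R) x : (forall l, S (x l)) ->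
  (forall d : nat -> R,
    \sum_(i < N) (\sum_(l < L) a i l * d l) ^+ 2 <= \sum_(l < L) d l ^+ 2) ->
  (gq (fun i => comb L x (a i)) N <= gq x L)%E.
Proof.
move=> Sx ac; rewrite /gq.
under eq_integral do rewrite comb_comb -tcomb_vec.
under [leRHS]eq_integral do rewrite -tcomb_vec.
apply: gauss_contraction => //.
- exact: measurable_tcomb.
- by move=> t; exact: sqr_ge0.
- move=> u v; rewrite !tcomb_vec.
  have -> : comb L x u = rc 2^-1 *: (comb L x (fun l => u l + v l) +
                                     comb L x (fun l => u l + (- 1) * v l)).
    rewrite !combD combZ rcN rc1 scaleN1r addrACA subrr addr0.
    rewrite scalerDr -scalerDl -rcD (_ : 2^-1 + 2^-1 = 1 :> R) ?rc1 ?scale1r //.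
    by field.
  have -> : comb L x (fun l => u l - v l) = comb L x (fun l => u l + (- 1) * v l).
    by apply: comb_ext => l _; rewrite mulN1r.
  set A := comb L x (fun l => u l + v l); set B := comb L x (fun l => u l + (- 1) * v l).
  have SA : S A by exact: seminormed_comb.
  have SB : S B by exact: seminormed_comb.
  rewrite nZZ ?cabs_rc; last exact: seminormedD.
  rewrite ger0_norm ?invr_ge0 //.
  have AB := nZD SA SB; have A0 := nZ_ge0 SA; have B0 := nZ_ge0 SB.
  have AB0 := nZ_ge0 (seminormedD SA SB).
  have : nZ (A + B) ^+ 2 <= (nZ A + nZ B) ^+ 2 by rewrite ler_sqr ?nnegrE ?addr_ge0.
  have := sqr_ge0 (nZ A - nZ B); rewrite exprMn; nra.
Qed.

(** The left side is the second moment of the scalar Gaussian sum with coefficients [r], which the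
    functional bound dominates at each [om]. *)
Lemma gq_functional x L (r : nat -> R) (c : R) : (forall l, S (x l)) ->
  (forall u : nat -> R, `|\sum_(l < L) u l * r l| <= c * nZ (comb L x u)) ->
  ((sigma2 * \sum_(l < L) r l ^+ 2)%:E <= (c ^+ 2)%:E * gq x L)%E.
Proof.
move=> Sx rc; have -> : \sum_(l < L) r l ^+ 2 = \sum_(l < L) r l * r l.
  by apply: eq_bigr => l _; rewrite expr2.
have sqrE om : \sum_(i < L) \sum_(j < L) g i om * g j om * (r i * r j) =
    (\sum_(l < L) g l om * r l) ^+ 2.
  rewrite expr2 mulr_suml; apply: eq_bigr => i _.
  by rewrite mulr_sumr; apply: eq_bigr => j _; ring.
have [/integrableP[mq _] <-] := gauss_quadratic hg L (fun i j => r i * r j).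
rewrite /gq -ge0_integralZl ?lee_fin ?sqr_ge0 //; last 2 first.
- exact: measurable_gq.
- by move=> om _; rewrite lee_fin sqr_ge0.
apply: ge0_le_lower_integral => om _; first by rewrite lee_fin sqrE sqr_ge0.
rewrite -EFinM lee_fin -exprMn sqrE -real_normK ?num_real //.
rewrite ler_sqr ?nnegrE ?normr_ge0 //; first exact: rc.
exact: le_trans (normr_ge0 _) (rc (g^~ om)).
Qed.

(** A crude estimate from [(a + b)^2 <= 2 a^2 + 2 b^2], from which finiteness of all Gaussian second
    moments follows by induction. *)
Lemma gq_succ x L : (forall l, S (x l)) ->
  (gq x L.+1 <= 2%:E * gq x L + (2 * nZ (x L) ^+ 2 * sigma2)%:E)%E.
Proof.
move=> Sx; rewrite EFinM -(gauss_sqr hg L) /gq.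
rewrite -ge0_integralZl //; last 2 first.
- exact: measurable_gq.
- by move=> om _; rewrite lee_fin sqr_ge0.
have mgL : measurable_fun setT (fun om => (g L om ^+ 2)%:E).
  by apply/measurable_EFinP; apply: measurable_funX; exact: measurable_gauss.
rewrite -ge0_integralZl //; last 2 first.
- by move=> om _; rewrite lee_fin sqr_ge0.
- by rewrite lee_fin mulr_ge0 ?sqr_ge0.
have m1 : measurable_fun setT (fun om => 2%:E * (nZ (comb L x (g^~ om)) ^+ 2)%:E)%E.
  by apply: measurable_funeM; exact: measurable_gq.
have m2 : measurable_fun setT (fun om => (2 * nZ (x L) ^+ 2)%:E * (g L om ^+ 2)%:E)%E.
  exact: measurable_funeM.
have p1 om : (0 <= 2%:E * (nZ (comb L x (g^~ om)) ^+ 2)%:E)%E.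
  by rewrite mule_ge0 ?lee_fin ?sqr_ge0.
have p2 om : (0 <= (2 * nZ (x L) ^+ 2)%:E * (g L om ^+ 2)%:E)%E.
  by apply: mule_ge0; rewrite lee_fin ?sqr_ge0 // mulr_ge0 ?sqr_ge0.
rewrite -ge0_integralD //.
apply: ge0_le_lower_integral => [om _|om _]; first by rewrite lee_fin sqr_ge0.
rewrite -!EFinM -EFinD lee_fin.
rewrite {1}/comb big_ord_recr /= -/(comb L x (g^~ om)).
set A := comb _ _ _; set B := rc _ *: _.
have SA : S A by exact: seminormed_comb.
have SB : S B by exact: seminormedZ.
have -> : 2 * nZ (x L) ^+ 2 * g L om ^+ 2 = 2 * nZ B ^+ 2.
  by rewrite /B nZZ // cabs_rc exprMn real_normK ?num_real //; ring.
have AB := nZD SA SB; have A0 := nZ_ge0 SA; have B0 := nZ_ge0 SB.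
have AB0 := nZ_ge0 (seminormedD SA SB).
have : nZ (A + B) ^+ 2 <= (nZ A + nZ B) ^+ 2 by rewrite ler_sqr ?nnegrE ?addr_ge0.
by have := sqr_ge0 (nZ A - nZ B); nra.
Qed.

Lemma gq_ge0 x L : (0 <= gq x L)%E.
Proof. by apply: integral_ge0 => om _; rewrite lee_fin sqr_ge0. Qed.

Lemma gq_fin_num x L : (forall l, S (x l)) -> gq x L \is a fin_num.
Proof.
move=> Sx; rewrite ge0_fin_numE ?gq_ge0 //; elim: L => [|L IH].
  rewrite /gq integral0_eq ?ltry // => om _; rewrite /comb big_ord0.
  by rewrite -(scale0r 0) nZZ ?cabs0 ?mul0r ?expr0n //; exact: seminormed0.
apply: le_lt_trans (gq_succ _ Sx) _; rewrite lte_add_pinfty ?ltry //.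
by rewrite lte_mul_pinfty.
Qed.

End OneSpace.

Lemma gq_law dO (Omega : measurableType dO) (P : probability Omega R)
    dO' (Omega' : measurableType dO') (P' : probability Omega' R) g g' x L :
  (forall K, gauss_seq P K g) -> (forall K, gauss_seq P' K g') ->
  (forall l, S (x l)) -> gq P g x L = gq P' g' x L.
Proof.
move=> hg hg' Sx; rewrite /gq.
under eq_integral do rewrite -tcomb_vec.
under [RHS]eq_integral do rewrite -tcomb_vec.
apply: (gauss_seq_law (phi := EFin \o @tcomb L x) (hg L) (hg' L)) => [|t].
  by apply/measurable_EFinP; exact: measurable_tcomb.
by rewrite lee_fin sqr_ge0.
Qed.

End GaussSums.

(** * The dual space and the finite trace bound *)

Section Duality.
Context {R : realType} (X : normedModType R[i]).
Local Notation C := R[i].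
Local Notation nX := (@Xnorm R X).
Local Notation nX' := (@Xdual_norm R X).
Local Notation X' := (@is_Xdual R X).
Implicit Types (x : X) (y : X -> C).

Lemma normr_Xnorm x : `|x| = rc (nX x).
Proof.
have : 0 <= `|x| by [].
by rewrite lecE /= => /andP[/eqP E _]; apply: complex_eq => //=; rewrite /cim E.
Qed.

Lemma Xnorm_ge0 x : 0 <= nX x.
Proof. by have := normr_ge0 x; rewrite normr_Xnorm lecE /= => /andP[]. Qed.

Lemma Xnorm_eq0 x : nX x = 0 -> x = 0.
Proof. by move=> x0; apply/normr0_eq0; rewrite normr_Xnorm x0. Qed.

Lemma seminormed_Xnorm : seminormed setT nX.
Proof.
split=> // [x y _ _|a x _].
  by have := ler_normD x y; rewrite !normr_Xnorm -rcD lecE /= => /andP[].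
by have := normrZ a x; rewrite !normr_Xnorm normc_cabs -rcM => -[].
Qed.

Lemma dual0 y : X' y -> y 0 = 0.
Proof.
move=> [yl _]; have := yl 1 0 0; rewrite scaler0 add0r mul1r => /eqP.
by rewrite -subr_eq subrr => /eqP <-.
Qed.

Lemma dualD y u v : X' y -> y (u + v) = y u + y v.
Proof. by move=> [yl _]; have := yl 1 u v; rewrite scale1r mul1r. Qed.

Lemma dualZ y a u : X' y -> y (a *: u) = a * y u.
Proof. by move=> Yy; have [yl _] := Yy; have := yl a u 0; rewrite !addr0 dual0 // addr0. Qed.

Lemma dualN y u : X' y -> y (- u) = - y u.
Proof. by move=> Yy; rewrite -scaleN1r dualZ // mulN1r. Qed.

Lemma dualB y u v : X' y -> y (u - v) = y u - y v.
Proof. by move=> Yy; rewrite dualD // dualN. Qed.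

Let unit_vals y := [set cabs (y x) | x in [set x | nX x <= 1]].

Let unit_vals_ub y : X' y -> has_sup (unit_vals y).
Proof.
move=> [yl [c yc]]; split.
  exists (cabs (y 0)); exists 0 => //=.
  by rewrite /Xnorm normr0 ler01.
exists `|c| => _ [x /= x1 <-]; apply: le_trans (yc x) _.
apply: (@le_trans _ _ (`|c| * nX x)).
  by rewrite ler_wpM2r ?Xnorm_ge0 // ler_norm.
by rewrite -[leRHS]mulr1 ler_wpM2l.
Qed.

Lemma dual_norm_le y x : X' y -> cabs (y x) <= nX' y * nX x.
Proof.
move=> Yy; have [x0|x0] := eqVneq (nX x) 0.
  by rewrite (Xnorm_eq0 x0) dual0 // cabs0 /Xnorm normr0 /= mulr0.
have xp : 0 < nX x by rewrite lt0r x0 Xnorm_ge0.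
rewrite -ler_pdivrMr //.
have -> : cabs (y x) / nX x = cabs (y (rc (nX x)^-1 *: x)).
  by rewrite dualZ // cabsM cabs_rc ger0_norm ?invr_ge0 ?Xnorm_ge0 // mulrC.
apply: ub_le_sup; first by case: (unit_vals_ub Yy).
exists (rc (nX x)^-1 *: x) => //=; rewrite (nZZ seminormed_Xnorm) // cabs_rc.
by rewrite ger0_norm ?invr_ge0 ?Xnorm_ge0 // mulVf.
Qed.

Lemma dual_norm_lub y c : 0 <= c -> (forall x, cabs (y x) <= c * nX x) -> nX' y <= c.
Proof.
move=> c0 yc; apply: ge_sup.
  exists (cabs (y 0)); exists 0 => //=.
  by rewrite /Xnorm normr0 ler01.
move=> _ [x /= x1 <-]; apply: le_trans (yc x) _.
by rewrite -[leRHS]mulr1 ler_wpM2l.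
Qed.

Lemma dual_norm_ge0 y : X' y -> 0 <= nX' y.
Proof.
move=> Yy; apply: le_trans (cabs_ge0 (y 0)) _.
by apply: ub_le_sup; [case: (unit_vals_ub Yy)|exists 0 => //=; rewrite /Xnorm normr0 ler01].
Qed.

Lemma is_XdualZ a y : X' y -> X' (a *: y).
Proof.
move=> [yl [c yc]]; split; first by move=> b u v; rewrite !cfun_scaleE yl mulrDr mulrCA.
exists (cabs a * c) => x; rewrite cfun_scaleE cabsM -mulrA.
by rewrite ler_wpM2l ?cabs_ge0.
Qed.

Lemma is_XdualD y y' : X' y -> X' y' -> X' (y + y').
Proof.
move=> [yl [c yc]] [yl' [c' yc']]; split.
  by move=> b u v; rewrite !cfun_addE yl yl'; ring.
exists (c + c') => x; rewrite cfun_addE mulrDl.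
by apply: le_trans (cabsD _ _) _; rewrite lerD.
Qed.

Lemma seminormed_dual : @seminormed R _ X' nX'.
Proof.
have dZ a y : X' y -> nX' (a *: y) <= cabs a * nX' y.
  move=> Yy; apply: dual_norm_lub => [|x].
    by rewrite mulr_ge0 ?cabs_ge0 ?dual_norm_ge0.
  by rewrite cfun_scaleE cabsM -mulrA ler_wpM2l ?cabs_ge0 // dual_norm_le.
split.
- split; first by move=> a x x' /=; rewrite mulr0 addr0.
  by exists 0 => x; rewrite /= cabs0 mul0r.
- exact: is_XdualD.
- exact: is_XdualZ.
- move=> y y' Yy Yy'; apply: dual_norm_lub => [|x].
    by rewrite addr_ge0 ?dual_norm_ge0.
  rewrite cfun_addE mulrDl; apply: le_trans (cabsD _ _) _.
  by rewrite lerD ?dual_norm_le.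
- move=> a y Yy; apply/eqP; rewrite eq_le dZ //=.
  have [->|a0] := eqVneq a 0.
    by rewrite cabs0 mul0r dual_norm_ge0 //; exact: is_XdualZ.
  have a0' : cabs a != 0 by apply: contra_neq a0; exact: cabs_eq0.
  (* The reverse half of homogeneity is the direct half for the scalar [a^-1]. *)
  have := dZ a^-1 (a *: y) (is_XdualZ a Yy).
  rewrite scalerA mulVf // scale1r => H.
  have E : cabs a * cabs a^-1 = 1 by rewrite -cabsM mulfV // cabs1.
  apply: (@le_trans _ _ (cabs a * (cabs a^-1 * nX' (a *: y)))).
    by rewrite ler_wpM2l ?cabs_ge0.
  by rewrite mulrA E mul1r.
Qed.

Lemma dual_comb y L (x : nat -> X) u : X' y ->
  y (comb L x u) = \sum_(l < L) rc (u l) * y (x l).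
Proof.
move=> Yy; rewrite /comb; elim: L => [|L IH]; first by rewrite !big_ord0 dual0.
by rewrite !big_ord_recr /= dualD // dualZ // IH.
Qed.

Lemma comb_dual L (y : nat -> X -> C) u x :
  comb L y u x = \sum_(l < L) rc (u l) * y l x.
Proof. by rewrite /comb fct_sumE. Qed.

Section TraceBound.
Context {dO} {Omega : measurableType dO} (P : probability Omega R).
Variable g : nat -> Omega -> R.
Hypothesis hg : forall K, gauss_seq P K g.

(** Both sums run over the same Gaussians, so the expectation of their pairing is [sigma2] times the
    trace. At each [om], completing a square bounds twice the pairing by [s |A|^2 + s^-1 |B|^2]. *)
Lemma trace_bound N (x : nat -> X) (y : nat -> X -> C) (s : R) : 0 < s ->
  (forall k, X' (y k)) ->
  ((2 * sigma2 * \sum_(i < N) cre (y i (x i)))%:E <=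
    s%:E * gq nX P g x N + s^-1%:E * gq nX' P g y N)%E.
Proof.
move=> s0 Yy.
have [Iq Eq] := gauss_quadratic hg N (fun i k => cre (y k (x i))).
have mx : measurable_fun setT (fun om => (nX (comb N x (g^~ om)) ^+ 2)%:E).
  exact: (measurable_gq seminormed_Xnorm hg).
have my : measurable_fun setT (fun om => (nX' (comb N y (g^~ om)) ^+ 2)%:E).
  exact: (measurable_gq seminormed_dual hg).
rewrite -mulrA EFinM -Eq -integralZl // /gq.
rewrite -!ge0_integralZl //; last 4 first.
- by move=> om _; rewrite lee_fin sqr_ge0.
- by rewrite lee_fin invr_ge0 ltW.
- by move=> om _; rewrite lee_fin sqr_ge0.
- by rewrite lee_fin ltW.
have Ix : P.-integrable setT (fun om => (nX (comb N x (g^~ om)) ^+ 2)%:E).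
  apply/integrableP; split=> //.
  under eq_integral do rewrite gee0_abs ?lee_fin ?sqr_ge0 //.
  by have := gq_fin_num seminormed_Xnorm hg N (x := x); rewrite ge0_fin_numE ?gq_ge0 //; apply.
have Iy : P.-integrable setT (fun om => (nX' (comb N y (g^~ om)) ^+ 2)%:E).
  apply/integrableP; split=> //.
  under eq_integral do rewrite gee0_abs ?lee_fin ?sqr_ge0 //.
  by have := gq_fin_num seminormed_dual hg N Yy; rewrite ge0_fin_numE ?gq_ge0.
rewrite -integralD //; [|exact: integrableZl..].
apply: le_integral => //.
- exact: integrableZl.
- by apply: integrableD => //; exact: integrableZl.
- move=> om _; rewrite -!EFinM -EFinD lee_fin.
  set A := comb N x _; set B := comb N y _.
  have SB : X' B by exact: seminormed_comb seminormed_dual _ _ _ Yy.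
  have -> : \sum_(i < N) \sum_(j < N) g i om * g j om * cre (y j (x i)) = cre (B A).
    rewrite /A dual_comb // cre_sum; apply: eq_bigr => i _.
    rewrite cre_rcM /B comb_dual cre_sum mulr_sumr; apply: eq_bigr => j _.
    by rewrite cre_rcM mulrA.
  have BA : cre (B A) <= nX' B * nX A.
    apply: le_trans (dual_norm_le _ SB); exact: le_trans (ler_norm _) (cre_le_cabs _).
  have A0 := Xnorm_ge0 A; have B0 := dual_norm_ge0 SB.
  pose t := Num.sqrt s; have ts : t ^+ 2 = s by rewrite sqr_sqrtr // ltW.
  have t0 : 0 < t by rewrite sqrtr_gt0.
  have -> : s * nX A ^+ 2 + s^-1 * nX' B ^+ 2 =
      (t * nX A - t^-1 * nX' B) ^+ 2 + 2 * (nX' B * nX A).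
    by rewrite -ts; field; rewrite gt_eqF.
  by have := sqr_ge0 (t * nX A - t^-1 * nX' B); lra.
Qed.

End TraceBound.
End Duality.

(** * The Hilbert space H *)

Section Fatou.
Context d (T : measurableType d) (R : realType) (mu : {measure set T -> \bar R}).

Lemma limn_einf_le (u : (\bar R)^nat) c : (forall k, u k <= c)%E -> (limn_einf u <= c)%E.
Proof.
move=> uc; rewrite limn_einf_lim; apply: lime_le; first exact: is_cvg_einfs.
near=> n; apply: le_trans (uc n).
by apply: ereal_inf_lbound; exists n => /=.
Unshelve. all: by end_near. Qed.

Lemma fatou_le (D : set T) (f_ : (T -> \bar R)^nat) (f : T -> \bar R) c :
  measurable D -> (forall k, measurable_fun D (f_ k)) ->
  (forall k x, D x -> 0 <= f_ k x)%E ->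
  (forall x, D x -> f_ ^~ x @ \oo --> f x) ->
  (forall k, \int[mu]_(x in D) f_ k x <= c)%E -> (\int[mu]_(x in D) f x <= c)%E.
Proof.
move=> mD mf f0 ff fc.
have -> : (\int[mu]_(x in D) f x = \int[mu]_(x in D) limn_einf (f_^~ x))%E.
  apply: eq_integral => x /[!inE] Dx; rewrite limn_einf_lim.
  by have /cvg_lim <- := cvg_einfs (ff x Dx).
exact: le_trans (fatou mu mD mf f0) (limn_einf_le fc).
Qed.

End Fatou.

(** * Completeness of real L^2 *)

Section L2Complete.
Context d (T : measurableType d) (R : realType) (mu : {measure set T -> \bar R}).
Variables (D : set T) (mD : measurable D) (u : nat -> T -> R).
Hypothesis mu_ : forall n, measurable_fun D (u n).
Hypothesis u_cauchy : forall eps : R, 0 < eps -> exists N, forall n m,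
  (N <= n)%N -> (N <= m)%N -> (\int[mu]_(x in D) ((u n x - u m x) ^+ 2)%:E <= eps%:E)%E.

Let subseq : exists k : nat -> nat, (forall j, (j <= k j)%N) /\
  (forall j, (k j <= k j.+1)%N) /\ forall j n m,
  (k j <= n)%N -> (k j <= m)%N ->
  (\int[mu]_(x in D) ((u n x - u m x) ^+ 2)%:E <= (8^-1 ^+ j)%:E)%E.
Proof.
have /choice[N NP] : forall j, exists N, forall n m, (N <= n)%N -> (N <= m)%N ->
    (\int[mu]_(x in D) ((u n x - u m x) ^+ 2)%:E <= (8^-1 ^+ j)%:E)%E.
  by move=> j; apply: u_cauchy; rewrite exprn_gt0 // invr_gt0.
(* Partial sums of [(N i).+1] are nondecreasing, exceed each [N j] and dominate [j]. *)
exists (fun j => \sum_(i < j.+1) (N i).+1)%N; split.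
  by elim=> // j IH; rewrite big_ord_recr /= addnS ltnS (leq_trans IH) ?leq_addr.
split=> [j|]; first by rewrite [leqRHS]big_ord_recr leq_addr.
have Nk j : (N j <= \sum_(i < j.+1) (N i).+1)%N.
  by rewrite big_ord_recr /= (leq_trans (leqnSn _)) // leq_addl.
by move=> j n m jn jm; apply: NP; exact: leq_trans (Nk j) _.
Qed.

(** The Riesz-Fischer argument: a rapidly converging subsequence converges almost everywhere, and
    Fatou's lemma shows that its limit is the limit in mean square. *)
Lemma L2_complete : exists v : T -> R, measurable_fun D v /\ forall eps : R, 0 < eps ->
  exists N, forall n, (N <= n)%N ->
  (\int[mu]_(x in D) ((u n x - v x) ^+ 2)%:E <= eps%:E)%E.
Proof.
have [K [Kj [KS KP]]] := subseq.
pose dd j x := u (K j.+1) x - u (K j) x.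
have mdd j : measurable_fun D (dd j) by exact: measurable_funB.
have dd_small j : (\int[mu]_(x in D) (dd j x ^+ 2)%:E <= (8^-1 ^+ j)%:E)%E.
  by apply: KP => //; exact: KS.
(* The weight [4 ^+ j] against the bound [8^-1 ^+ j] leaves a convergent geometric series of
   integrals, while finiteness of the sum at a point forces [dd j x] to decay like [2^-1 ^+ j]. *)
pose f j x := ((4 ^+ j)%:E * (dd j x ^+ 2)%:E)%E.
have f0 j x : D x -> (0 <= f j x)%E.
  by move=> _; apply: mule_ge0; rewrite lee_fin ?sqr_ge0 // exprn_ge0.
have mf j : measurable_fun D (f j).
  by apply: measurable_funeM; apply/measurable_EFinP; exact: measurable_funX.
pose S x := (\sum_(j <oo) f j x)%E.
have mS : measurable_fun D S.
  by apply: ge0_emeasurable_sum => // j x Dx _; exact: f0.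
have S0 x : D x -> (0 <= S x)%E by move=> Dx; apply: nneseries_ge0 => j _ _; exact: f0.
have geo n : \sum_(0 <= j < n) 2^-1 ^+ j = 2 - 2 * 2^-1 ^+ n :> R.
  elim: n => [|n IH]; first by rewrite big_geq // expr0; ring.
  by rewrite big_nat_recr //= IH exprS; field.
have intS : (\int[mu]_(x in D) S x <= 2%:E)%E.
  rewrite integral_nneseries //; apply: lime_le.
    by apply: is_cvg_nneseries => j _ _; apply: integral_ge0 => x; exact: f0.
  near=> n; apply: (@le_trans _ _ (\sum_(0 <= j < n) (2^-1 ^+ j)%:E)%E).
    apply: lee_sum => j _.
    have m2 : measurable_fun D (fun x => (dd j x ^+ 2)%:E).
      by apply/measurable_EFinP; exact: measurable_funX.
    have p2 x : D x -> (0 <= (dd j x ^+ 2)%:E)%E by rewrite lee_fin sqr_ge0.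
    rewrite ge0_integralZl ?lee_fin ?exprn_ge0 //.
    rewrite (_ : 2^-1 ^+ j = 4 ^+ j * 8^-1 ^+ j); last first.
      by rewrite -exprMn; congr (_ ^+ _); field.
    by rewrite EFinM lee_pmul2l // lte_fin exprn_gt0.
  rewrite sumEFin lee_fin.
  by rewrite geo gerBl mulr_ge0 // exprn_ge0 // invr_ge0.
have IS : mu.-integrable D S.
  apply/integrableP; split=> //.
  under eq_integral => x /[!inE] Dx do rewrite gee0_abs ?S0 //.
  exact: le_lt_trans intS (ltry _).
have [N [mN N0 subN]] := integrable_ae mD IS.
have SN x : D x -> ~ N x -> S x \is a fin_num.
  by move=> Dx Nx; apply: contrapT => Sx; apply: Nx; apply: subN => /= /(_ Dx).
have cvgu x : D x -> ~ N x -> cvgn (fun j => u (K j) x).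
  move=> Dx Nx; have Sx := SN x Dx Nx.
  pose s := fine (S x); have s0 : 0 <= s by rewrite fine_ge0 // S0.
  have dds j : `|dd j x| <= Num.sqrt s * 2^-1 ^+ j.
    have : (f j x <= S x)%E.
      rewrite /S (@nneseriesD1 _ _ j) // => [|i _]; last exact: f0.
      by rewrite leeDl // nneseries_ge0 // => i _ _; exact: f0.
    rewrite -(fineK Sx) -/s /f -EFinM lee_fin => fs.
    rewrite -ler_sqr ?nnegrE ?normr_ge0 ?mulr_ge0 ?sqrtr_ge0 ?exprn_ge0 ?invr_ge0 //.
    rewrite real_normK ?num_real // exprMn sqr_sqrtr //.
    rewrite -exprM mulnC exprM (_ : 2^-1 ^+ 2 = 4^-1 :> R); last by field.
    by rewrite exprVn ler_pdivlMr ?exprn_gt0 // mulrC.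
  have cdd : cvgn (series (fun j => dd j x)).
    apply: normed_cvg; apply: (@series_le_cvg _ _ (fun j => Num.sqrt s * 2^-1 ^+ j)).
    - by move=> j; exact: normr_ge0.
    - by move=> j; rewrite mulr_ge0 ?sqrtr_ge0 ?exprn_ge0 ?invr_ge0.
    - exact: dds.
    - apply: is_cvg_geometric_series; rewrite ger0_norm ?invr_ge0 //.
      by rewrite invf_lt1 // ltr1n.
  rewrite (_ : (fun j => u (K j) x) = fun j => series (dd ^~ x) j + u (K 0%N) x).
    by apply: is_cvgD => //; exact: is_cvg_cst.
  apply/funext; elim=> [|j IH]; first by rewrite /series /= big_geq // add0r.
  by rewrite seriesSr addrAC -IH /dd addrC subrK.
(* Setting the sequence to [0] on the null set [N] makes it converge at every point of [D], so that
   the limit is measurable. *)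
pose h j x := u (K j) x * \1_(~` N) x.
have mh j : measurable_fun D (h j).
  apply: measurable_funM => //; apply: measurable_funTS.
  by apply: measurable_indic; exact: measurableC.
have cvgh x : D x -> h^~ x @ \oo --> limn (h^~ x).
  move=> Dx; rewrite /h indicE; case: (boolP (x \in ~` N)) => [|_].
    rewrite inE /= => Nx; have := cvgu x Dx Nx.
    by under [in X in _ -> X]eq_fun do rewrite mulr1.
  by under eq_fun do rewrite mulr0; exact: is_cvg_cst.
pose v x := limn (h^~ x).
have mv : measurable_fun D v by exact: (measurable_fun_cvg mh cvgh).
exists v; split=> // eps eps0; have [M MP] := u_cauchy eps0.
exists M => n Mn; rewrite (ge0_negligible_integral mN) //; last 2 first.
- by apply/measurable_EFinP; apply: measurable_funX; exact: measurable_funB.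
- by move=> x _; rewrite lee_fin sqr_ge0.
have mDN : measurable (D `\` N) by exact: measurableD.
have sDN : D `\` N `<=` D by move=> x [].
apply: (@fatou_le _ _ _ _ _ (fun j x => ((u n x - u (K (j + M)%N) x) ^+ 2)%:E)) => //.
- move=> j; apply/measurable_EFinP; apply: measurable_funX.
  by apply: measurable_funB; exact: measurable_funS (mu_ _).
- by move=> j x _; rewrite lee_fin sqr_ge0.
- move=> x [Dx Nx]; apply: cvg_EFin; first by near=> j.
  have hu : h^~ x = fun j => u (K j) x.
    by apply/funext => j; rewrite /h indicE mem_set // mulr1.
  have /= cu := cvgh x Dx; rewrite hu in cu.
  rewrite /v hu.
  have cB : (fun j => u n x - u (K (j + M)%N) x) @ \oo --> u n x - limn (fun j => u (K j) x).
    by apply: cvgB; [exact: cvg_cst|rewrite (cvg_shiftn M (fun j => u (K j) x))].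
  rewrite expr2; under eq_fun do rewrite /= expr2.
  exact: cvgM.
- move=> j; apply: le_trans (MP n (K (j + M)%N) Mn _); last first.
    by rewrite (leq_trans _ (Kj _)) // leq_addl.
  apply: ge0_subset_integral => //.
  + apply/measurable_EFinP; apply: measurable_funX; exact: measurable_funB.
  + by move=> x _; rewrite lee_fin sqr_ge0.
Unshelve. all: by end_near. Qed.

End L2Complete.

(** * Bessel's inequality and Parseval's identity *)

Section PreHilbert.
Context {R : realType}.
Local Notation C := R[i].
Variables (V : lmodType C) (H : V -> Prop) (ip : V -> V -> R).

(* A complex vector space is used as a real one: only real scalars [rc a]
   and a real inner product occur. *)
Definition prehilbert : Prop :=
  [/\ H 0, forall x y, H x -> H y -> H (x + y), forall a x, H x -> H (rc a *: x) &
   [/\ forall x y, H x -> H y -> ip x y = ip y x,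
      forall x y z, H x -> H y -> H z -> ip (x + y) z = ip x z + ip y z,
      forall a x y, H x -> H y -> ip (rc a *: x) y = a * ip x y &
      forall x, H x -> 0 <= ip x x]].

Hypothesis ph : prehilbert.

Let H0 : H 0. Proof. by case: ph. Qed.
Let HD x y : H x -> H y -> H (x + y). Proof. by case: ph => _ + _ _; apply. Qed.
Let HZ a x : H x -> H (rc a *: x). Proof. by case: ph => _ _ + _; apply. Qed.
Let HB x y : H x -> H y -> H (x - y).
Proof. by move=> Hx Hy; rewrite -scaleN1r -rc1 -rcN; exact/HD/HZ. Qed.
Let ipC x y : H x -> H y -> ip x y = ip y x. Proof. by case: ph => _ _ _ [+ _ _ _]; apply. Qed.
Let ipDl x y z : H x -> H y -> H z -> ip (x + y) z = ip x z + ip y z.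
Proof. by case: ph => _ _ _ [_ + _ _]; apply. Qed.
Let ipZl a x y : H x -> H y -> ip (rc a *: x) y = a * ip x y.
Proof. by case: ph => _ _ _ [_ _ + _]; apply. Qed.
Let ip_ge0 x : H x -> 0 <= ip x x. Proof. by case: ph => _ _ _ [_ _ _]; apply. Qed.
Let ipBl x y z : H x -> H y -> H z -> ip (x - y) z = ip x z - ip y z.
Proof.
move=> Hx Hy Hz; rewrite -scaleN1r -rc1 -rcN ipDl ?ipZl ?mulN1r //; exact: HZ.
Qed.
Let ipBr x y z : H x -> H y -> H z -> ip z (x - y) = ip z x - ip z y.
Proof.
by move=> Hx Hy Hz; rewrite ipC ?ipBl // 1?ipC // ?(ipC (x := y)) //; exact: HB.
Qed.
Let ip0l x : H x -> ip 0 x = 0.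
Proof. by move=> Hx; rewrite -(scale0r 0) -rc0 ipZl // mul0r. Qed.

Let sqrB x y : H x -> H y -> ip (x - y) (x - y) = ip x x - 2 * ip x y + ip y y.
Proof.
move=> Hx Hy; have Hxy := HB Hx Hy.
by rewrite ipBl // !ipBr // (ipC Hy Hx); ring.
Qed.

(** The form may be degenerate: if [ip y y = 0], the nonnegative polynomial [Q] is affine in [t] and
    would take the value [-1] unless [ip x y = 0]. Otherwise [Q] is evaluated at its minimum. *)
Lemma cauchy_schwarz x y : H x -> H y -> ip x y ^+ 2 <= ip x x * ip y y.
Proof.
move=> Hx Hy.
have Q t : 0 <= ip x x - 2 * (t * ip x y) + t ^+ 2 * ip y y.
  have Hty := HZ t Hy; have := ip_ge0 (HB Hx Hty).
  rewrite sqrB // (ipC Hx Hty) !ipZl // (ipC Hy Hty) ipZl // (ipC Hy Hx).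
  by congr (0 <= _); ring.
have [y0|y0] := eqVneq (ip y y) 0.
  have [xy0|xy0] := eqVneq (ip x y) 0; first by rewrite xy0 y0 mulr0 expr0n.
  have := Q ((ip x x + 1) / (2 * ip x y)); rewrite y0 mulr0 addr0.
  have -> : 2 * ((ip x x + 1) / (2 * ip x y) * ip x y) = ip x x + 1 by field.
  by have := ip_ge0 Hx; lra.
have yp : 0 < ip y y by rewrite lt0r y0 ip_ge0.
have := Q (ip x y / ip y y).
have -> : ip x x - 2 * (ip x y / ip y y * ip x y) + (ip x y / ip y y) ^+ 2 * ip y y =
    (ip x x * ip y y - ip x y ^+ 2) / ip y y by field.
by rewrite pmulr_lge0 ?invr_gt0 // subr_ge0.
Qed.

Lemma prehilbert_comb N (h : nat -> V) c : (forall i, H (h i)) -> H (comb N h c).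
Proof.
move=> Hh; rewrite /comb; by elim/big_ind : _ => // i _; exact: HZ.
Qed.

Lemma ip_combl N (h : nat -> V) c x : (forall i, H (h i)) -> H x ->
  ip (comb N h c) x = \sum_(i < N) c i * ip (h i) x.
Proof.
move=> Hh Hx; elim: N => [|N IH]; first by rewrite /comb !big_ord0 ip0l.
rewrite /comb !big_ord_recr /= -/(comb N h c) ipDl ?IH ?ipZl //.
- exact: prehilbert_comb.
- exact: HZ.
Qed.

Lemma ip_combr N (h : nat -> V) c x : (forall i, H (h i)) -> H x ->
  ip x (comb N h c) = \sum_(i < N) c i * ip x (h i).
Proof.
move=> Hh Hx; rewrite ipC ?ip_combl //; last exact: prehilbert_comb.
by apply: eq_bigr => i _; rewrite ipC.
Qed.

(** The squared distance from [x] to the combination [s] is nonnegative. Norms are at most [1],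
    rather than equal to [1], because a piece of measure zero will contribute the zero vector. *)
Lemma bessel N (h : nat -> V) x : (forall i, H (h i)) -> H x ->
  (forall i j, i != j -> ip (h i) (h j) = 0) -> (forall i, ip (h i) (h i) <= 1) ->
  \sum_(i < N) ip (h i) x ^+ 2 <= ip x x.
Proof.
move=> Hh Hx orth h1; pose c i := ip (h i) x; pose s := comb N h c.
have Hs : H s by exact: prehilbert_comb.
have := ip_ge0 (HB Hx Hs); rewrite sqrB //.
have -> : ip x s = \sum_(i < N) c i ^+ 2.
  by rewrite ip_combr //; apply: eq_bigr => i _; rewrite (ipC Hx) // expr2.
have : ip s s <= \sum_(i < N) c i ^+ 2.
  rewrite ip_combl //; apply: ler_sum => i _; rewrite ip_combr //.
  rewrite (bigD1 i) //= big1 ?addr0 => [|j ji]; last first.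
    by rewrite orth ?mulr0 // eq_sym.
  by rewrite mulrA -expr2 -[leRHS]mulr1 ler_wpM2l ?sqr_ge0.
by rewrite /c; lra.
Qed.

Section Basis.
Variable eps : nat -> V.
Hypothesis Heps : forall l, H (eps l).
Hypothesis eps_orth : forall l m, ip (eps l) (eps m) = (l == m)%:R.
Hypothesis eps_total : forall x, H x -> (forall l, ip x (eps l) = 0) -> ip x x = 0.
Hypothesis complete : forall u : nat -> V, (forall n, H (u n)) ->
  (forall e : R, 0 < e -> exists N, forall n m, (N <= n)%N -> (N <= m)%N ->
    ip (u n - u m) (u n - u m) <= e) ->
  exists v, H v /\ forall e : R, 0 < e -> exists N, forall n, (N <= n)%N ->
    ip (u n - v) (u n - v) <= e.

Lemma ip_comb_basis N d : ip (comb N eps d) (comb N eps d) = \sum_(l < N) d l ^+ 2.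
Proof.
rewrite ip_combl //; last exact: prehilbert_comb.
apply: eq_bigr => l _; rewrite ip_combr // expr2; congr (_ * _).
rewrite -[RHS](sum_delta d (ltn_ord l)); apply: eq_bigr => j _.
by rewrite eps_orth mulrC eq_sym.
Qed.

(** Bessel makes the partial expansions of [f] a Cauchy sequence. Its limit [v] has the coefficients
    of [f], so [f - v] has norm zero by totality, and Cauchy-Schwarz replaces [v] by [f] in the
    product with [h]. *)
Lemma parseval f h : H f -> H h ->
  (fun M => \sum_(l < M) ip f (eps l) * ip (eps l) h) @ \oo --> ip f h.
Proof.
move=> Hf Hh; pose c l := ip f (eps l); pose u M := comb M eps c.
have Hu M : H (u M) by exact: prehilbert_comb.
have uE M x : H x -> ip (u M) x = \sum_(l < M) c l * ip (eps l) x.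
  by move=> Hx; rewrite ip_combl.
have bound M : \sum_(l < M) c l ^+ 2 <= ip f f.
  rewrite /c; under eq_bigr => l _ do rewrite ipC //.
  apply: bessel => // [i j /negbTE ij|i]; by rewrite eps_orth ?ij ?eqxx.
have uB n m : (m <= n)%N -> ip (u n - u m) (u n - u m) =
    \sum_(l < n) c l ^+ 2 - \sum_(l < m) c l ^+ 2.
  move=> mn; have umn : ip (u m) (u n) = \sum_(l < m) c l ^+ 2.
    rewrite uE //; apply: eq_bigr => l _; rewrite expr2; congr (_ * _).
    rewrite ip_combr // -[RHS](sum_delta c (leq_trans (ltn_ord l) mn)).
    by apply: eq_bigr => j _; rewrite eps_orth mulrC eq_sym.
  by rewrite sqrB // !ip_comb_basis (ipC (Hu n) (Hu m)) umn; ring.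
pose S M := \sum_(l < M) c l ^+ 2.
have ndS : nondecreasing_seq S.
  by apply/nondecreasing_seqP => n; rewrite /S big_ord_recr lerDl sqr_ge0.
have cS : cvgn S.
  apply: nondecreasing_is_cvgn => //; exists (ip f f) => _ [M _ <-]; exact: bound.
have [||v [Hv vP]] := complete (u := u) => //.
  move=> e e0; have /cvgrPdist_le /(_ _ e0) [N _ NP] := cS.
  have main n m : (N <= m)%N -> (m <= n)%N -> ip (u n - u m) (u n - u m) <= e.
    move=> Nm mn; rewrite uB // -/(S n) -/(S m).
    have := NP m Nm; rewrite /= => H1.
    have := nondecreasing_cvgn_le ndS cS n => H2.
    by have := le_trans (ler_norm _) H1; lra.
  exists N => n m Nn Nm; case: (leqP m n) => mn; first exact: main.
  have -> : ip (u n - u m) (u n - u m) = ip (u m - u n) (u m - u n).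
    by rewrite !sqrB // (ipC (Hu n) (Hu m)); ring.
  by apply: main => //; exact: ltnW.
have lim_ip x : H x -> (fun M => ip (u M) x) @ \oo --> ip v x.
  move=> Hx; apply/cvgrPdist_le => e e0.
  pose k := ip x x + 1; have k0 : 0 < k by rewrite ltr_wpDl ?ip_ge0.
  have [|N NP] := vP (e ^+ 2 / k); first by rewrite divr_gt0 ?exprn_gt0.
  exists N => // n /= Nn; rewrite distrC -ipBl //.
  rewrite -ler_sqr ?nnegrE ?normr_ge0 ?(ltW e0) // real_normK ?num_real //.
  apply: le_trans (cauchy_schwarz (HB (Hu n) Hv) Hx) _.
  apply: (@le_trans _ _ (e ^+ 2 / k * k)); last by rewrite divfK ?gt_eqF.
  apply: ler_pM; rewrite ?ip_ge0 ?NP //; first exact: HB.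
  by rewrite lerDl.
have fv : ip (f - v) (f - v) = 0.
  apply: eps_total => [|l]; first exact: HB.
  rewrite ipBl //; apply/eqP; rewrite subr_eq0; apply/eqP.
  have /cvg_lim <- // := lim_ip _ (Heps l); apply/esym/cvg_lim => //.
  apply: cvg_near_cst; exists l.+1 => // n /= ln.
  rewrite uE // -[RHS](sum_delta c ln); apply: eq_bigr => j _.
  by rewrite eps_orth mulrC.
have : ip f h = ip v h.
  apply/eqP; rewrite -subr_eq0 -ipBl // -sqrf_eq0 eq_le sqr_ge0 andbT.
  by apply: le_trans (cauchy_schwarz (HB Hf Hv) Hh) _; rewrite fv mul0r.
by move=> ->; under eq_fun do rewrite -uE //; exact: lim_ip.
Qed.

End Basis.
End PreHilbert.

Section HalfSpace.
Context {R : realType} (n : nat).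
Local Notation T := (n.+1.-tuple R).

Lemma measurable_ht : measurable_fun setT (@ht R n).
Proof. exact: measurable_tnth. Qed.

Lemma measurable_uhs : measurable (@uhs R n).
Proof.
have := measurable_ht measurableT (measurable_itv `]0, +oo[).
by rewrite setTI preimage_itvoy.
Qed.

(* [rwt] is positive and measurable on all of [T], unlike a square root of [wt]. *)
Definition rwt (w : T) : R := expR (- (n.+1%:R / 2) * ln (ht w)).

Lemma rwt_gt0 w : 0 < rwt w. Proof. exact: expR_gt0. Qed.

Lemma sqr_rwt w : uhs n w -> rwt w ^+ 2 = wt w.
Proof.
rewrite /uhs /= => w0; rewrite /rwt /wt -expRM_natl.
have -> : 2%:R * (- (n.+1%:R / 2) * ln (ht w)) = - (n.+1%:R * ln (ht w)) by field.
by rewrite expRN expRM_natl lnK ?posrE.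
Qed.

Lemma wt_gt0 w : uhs n w -> 0 < @wt R n w.
Proof. by move=> w0; rewrite -sqr_rwt // exprn_gt0 // rwt_gt0. Qed.

Lemma measurable_rwt D : measurable_fun D rwt.
Proof.
apply: measurable_funTS; apply: measurableT_comp; first exact: measurable_expR.
apply: measurable_funM => //; apply: measurableT_comp; first exact: measurable_ln.
exact: measurable_ht.
Qed.

Lemma measurable_wt : measurable_fun (uhs n) (@wt R n).
Proof.
apply: (eq_measurable_fun (fun w => rwt w ^+ 2)).
  by move=> w /[!inE]; exact: sqr_rwt.
by apply: measurable_funX; exact: measurable_rwt.
Qed.

End HalfSpace.

(** * H as a real Hilbert space *)

Section WeightedL2.
Context {R : realType} (n : nat).
Local Notation C := R[i].
Local Notation T := (n.+1.-tuple R).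
Variable lam1 : {measure set T -> \bar R}.
Local Notation D := (@uhs R n).
Implicit Types f h : T -> C.

Let mD : measurable D := @measurable_uhs R n.

Definition kernel f h (w : T) : R := (cre (f w) * cre (h w) + cim (f w) * cim (h w)) * wt w.

(** The real part of the inner product of H, by which H becomes a Hilbert space over the reals. *)
Definition rip f h : R := Rintegral lam1 D (kernel f h).

Lemma measurable_kernel f h : cmeasurable D f -> cmeasurable D h ->
  measurable_fun D (kernel f h).
Proof.
move=> [mf1 mf2] [mh1 mh2]; apply: measurable_funM; last exact: measurable_wt.
by apply: measurable_funD; apply: measurable_funM.
Qed.

Lemma kernel_sqr f w : kernel f f w = cabs (f w) ^+ 2 * wt w.
Proof. by rewrite /kernel sqr_cabs !expr2. Qed.

Lemma kernel_ge0 f w : D w -> 0 <= kernel f f w.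
Proof. by move=> Dw; rewrite kernel_sqr mulr_ge0 ?sqr_ge0 // ltW // wt_gt0. Qed.

Lemma Hnorm2E f : (Hnorm2 lam1 f = \int[lam1]_(w in D) (kernel f f w)%:E)%E.
Proof. by apply: eq_integral => w _; rewrite kernel_sqr. Qed.

Lemma integrable_kernel f h : inH lam1 f -> inH lam1 h ->
  lam1.-integrable D (EFin \o kernel f h).
Proof.
move=> [mf f_fin] [mh h_fin].
have I k : cmeasurable D k -> (Hnorm2 lam1 k < +oo)%E ->
    lam1.-integrable D (EFin \o kernel k k).
  move=> mk k_fin; apply/integrableP; split.
    by apply/measurable_EFinP; exact: measurable_kernel.
  under eq_integral => w /[!inE] Dw do rewrite /= ger0_norm ?kernel_ge0 //.
  by rewrite -Hnorm2E.
apply: (le_integrable mD _ _ (integrableD mD (I f mf f_fin) (I h mh h_fin))).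
  by apply/measurable_EFinP; exact: measurable_kernel.
move=> w Dw /=; rewrite lee_fin [leRHS]ger0_norm; last first.
  by rewrite addr_ge0 ?kernel_ge0.
rewrite /kernel -mulrDl normrM (gtr0_norm (wt_gt0 Dw)) ler_wpM2r ?(ltW (wt_gt0 Dw)) //.
set a := cre _; set b := cre _; set c := cim _; set e := cim _.
rewrite ler_norml; apply/andP; split.
  by have := sqr_ge0 (a + b); have := sqr_ge0 (c + e);
     have := sqr_ge0 a; have := sqr_ge0 b; have := sqr_ge0 c; have := sqr_ge0 e; nra.
by have := sqr_ge0 (a - b); have := sqr_ge0 (c - e);
   have := sqr_ge0 a; have := sqr_ge0 b; have := sqr_ge0 c; have := sqr_ge0 e; nra.
Qed.

Lemma rip_Hnorm2 f : inH lam1 f -> (Hnorm2 lam1 f = (rip f f)%:E)%E.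
Proof.
move=> Hf; rewrite Hnorm2E /rip /Rintegral fineK //.
exact: (integrable_fin_num mD (integrable_kernel Hf Hf)).
Qed.

Lemma inH0 : inH lam1 0.
Proof.
split; first by split; exact: measurable_cst.
rewrite Hnorm2E integral0_eq ?ltry // => w _.
by rewrite /kernel /= !mul0r addr0 mul0r.
Qed.

Lemma inH_dominated f h (k : R) : inH lam1 h -> cmeasurable D f -> 
  (forall w, D w -> cabs (f w) <= k * cabs (h w)) -> inH lam1 f.
Proof.
move=> Hh mf fh; split=> //; rewrite Hnorm2E.
apply: (@le_lt_trans _ _ (\int[lam1]_(w in D) ((k ^+ 2)%:E * (kernel h h w)%:E))%E).
  apply: ge0_le_lower_integral => w Dw; first by rewrite lee_fin kernel_ge0.
  rewrite -EFinM lee_fin !kernel_sqr mulrA ler_wpM2r ?(ltW (wt_gt0 Dw)) //.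
  rewrite -exprMn ler_sqr ?nnegrE ?cabs_ge0 ?fh //.
  exact: le_trans (cabs_ge0 _) (fh w Dw).
rewrite ge0_integralZl ?lee_fin ?sqr_ge0 //; last 2 first.
- by apply/measurable_EFinP; apply: measurable_kernel; exact: Hh.1.
- by move=> w Dw; rewrite lee_fin kernel_ge0.
by rewrite lte_mul_pinfty ?lee_fin ?sqr_ge0 // -Hnorm2E Hh.2.
Qed.

Lemma inHZ (a : C) f : inH lam1 f -> inH lam1 (a *: f).
Proof.
move=> Hf; have [[mf1 mf2] _] := Hf.
apply: (@inH_dominated _ f (cabs a)) => //; last first.
  by move=> w _; rewrite -cabsM.
split.
  rewrite (_ : _ \o _ = fun w => cre a * cre (f w) - cim a * cim (f w)).
    by apply: measurable_funB; apply: measurable_funM.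
  by apply/funext => w; rewrite /= -creM.
rewrite (_ : _ \o _ = fun w => cre a * cim (f w) + cim a * cre (f w)).
  by apply: measurable_funD; apply: measurable_funM.
by apply/funext => w; rewrite /= -cimM.
Qed.

Lemma inHD f h : inH lam1 f -> inH lam1 h -> inH lam1 (f + h).
Proof.
move=> Hf Hh; have [[mf1 mf2] _] := Hf; have [[mh1 mh2] _] := Hh.
have mfh : cmeasurable D (f + h).
  split.
    rewrite (_ : _ \o _ = fun w => cre (f w) + cre (h w)).
      exact: measurable_funD.
    by apply/funext => w; rewrite /= -creD.
  rewrite (_ : _ \o _ = fun w => cim (f w) + cim (h w)).
    exact: measurable_funD.
  by apply/funext => w; rewrite /= -cimD.
split=> //; rewrite Hnorm2E.
have If := integrable_kernel Hf Hf; have Ih := integrable_kernel Hh Hh.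
apply: (@le_lt_trans _ _ (\int[lam1]_(w in D)
    (2%:E * (kernel f f w)%:E + 2%:E * (kernel h h w)%:E))%E).
  apply: ge0_le_lower_integral => w Dw; first by rewrite lee_fin kernel_ge0.
  rewrite -!EFinM -EFinD lee_fin !kernel_sqr !mulrA -mulrDl.
  rewrite ler_wpM2r ?(ltW (wt_gt0 Dw)) //.
  have := cabsD (f w) (h w); have := cabs_ge0 (f w); have := cabs_ge0 (h w).
  have := cabs_ge0 ((f + h) w); rewrite -/((f + h) w) => p0 p1 p2 p3.
  have : cabs ((f + h) w) ^+ 2 <= (cabs (f w) + cabs (h w)) ^+ 2.
    by rewrite ler_sqr ?nnegrE ?addr_ge0.
  by have := sqr_ge0 (cabs (f w) - cabs (h w)); nra.
rewrite integralD //; [|exact: integrableZl..].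
rewrite !integralZl // lte_add_pinfty // lte_mul_pinfty //.
- by rewrite -Hnorm2E; exact: Hf.2.
- by rewrite -Hnorm2E; exact: Hh.2.
Qed.

Lemma prehilbert_inH : prehilbert (inH lam1) rip.
Proof.
split; [exact: inH0|exact: inHD|by move=> a x; exact: inHZ|split].
- by move=> f h _ _; apply: eq_Rintegral => w _; rewrite /kernel; ring.
- move=> f1 f2 h H1 H2 Hh; rewrite /rip -RintegralD //; try exact: integrable_kernel.
  by apply: eq_Rintegral => w _; rewrite /kernel cfun_addE creD cimD; ring.
- move=> a f h Hf Hh; rewrite /rip -RintegralZl //; last exact: integrable_kernel.
  by apply: eq_Rintegral => w _; rewrite /kernel cfun_scaleE cre_rcM cim_rcM; ring.
- by move=> f Hf; apply: Rintegral_ge0 => w; exact: kernel_ge0.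
Qed.

Lemma integral_kernel f : inH lam1 f ->
  (\int[lam1]_(w in D) (kernel f f w)%:E = (rip f f)%:E)%E.
Proof. by move=> Hf; rewrite -Hnorm2E rip_Hnorm2. Qed.

(** Multiplying real and imaginary parts by [rwt] reduces the claim to [L2_complete]; dividing the
    two limits by [rwt] gives [v], which differs from some [u N0] by an element of H. *)
Lemma inH_complete (u : nat -> T -> C) : (forall k, inH lam1 (u k)) ->
  (forall e : R, 0 < e -> exists N, forall k m, (N <= k)%N -> (N <= m)%N ->
    rip (u k - u m) (u k - u m) <= e) ->
  exists v, inH lam1 v /\ forall e : R, 0 < e -> exists N, forall k, (N <= k)%N ->
    rip (u k - v) (u k - v) <= e.
Proof.
move=> Hu uC.
have HB f h : inH lam1 f -> inH lam1 h -> inH lam1 (f - h).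
  by move=> Hf Hh; rewrite -scaleN1r; apply: inHD => //; exact: inHZ.
pose part (p : C -> R) k w := p (u k w) * rwt w.
have mpart p : (forall k, measurable_fun D (p \o u k)) -> forall k, measurable_fun D (part p k).
  by move=> mp k; apply: measurable_funM; [exact: mp|exact: measurable_rwt].
have kernelE k m w : D w -> kernel (u k - u m) (u k - u m) w =
    (part (@cre R) k w - part (@cre R) m w) ^+ 2 + (part (@cim R) k w - part (@cim R) m w) ^+ 2.
  move=> Dw; rewrite kernel_sqr sqr_cabs -sqr_rwt // /part.
  by rewrite creD cimD !(creN, cimN); ring.
have ex p : (forall k, measurable_fun D (p \o u k)) ->
    (forall k m w, D w -> (part p k w - part p m w) ^+ 2 <= kernel (u k - u m) (u k - u m) w) ->
    exists v : T -> R, measurable_fun D v /\ forall e : R, 0 < e -> exists N, forall k,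
      (N <= k)%N -> (\int[lam1]_(w in D) ((part p k w - v w) ^+ 2)%:E <= e%:E)%E.
  move=> mp pk; apply: L2_complete => //; first exact: mpart.
  move=> e e0; have [N NP] := uC e e0; exists N => k m Nk Nm.
  have Hkm := HB _ _ (Hu k) (Hu m).
  apply: (@le_trans _ _ (\int[lam1]_(w in D) (kernel (u k - u m) (u k - u m) w)%:E)%E).
    by apply: ge0_le_lower_integral => w Dw; rewrite lee_fin ?sqr_ge0 ?pk.
  by rewrite integral_kernel // lee_fin NP.
have mre k : measurable_fun D (@cre R \o u k) by case: (Hu k) => -[].
have mim k : measurable_fun D (@cim R \o u k) by case: (Hu k) => -[].
have [|a [ma aP]] := ex (@cre R) mre.
  by move=> k m w Dw; rewrite kernelE // lerDl sqr_ge0.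
have [|b [mb bP]] := ex (@cim R) mim.
  by move=> k m w Dw; rewrite kernelE // lerDr sqr_ge0.
have mir : measurable_fun D (fun w => (@rwt R n w)^-1).
  rewrite (_ : (fun _ => _) = fun w => expR (- (- (n.+1%:R / 2) * ln (ht w)))).
    apply: measurable_funTS; apply: measurableT_comp; first exact: measurable_expR.
    apply: measurableT_comp => //; apply: measurable_funM => //.
    by apply: measurableT_comp; [exact: measurable_ln|exact: measurable_ht].
  by apply/funext => w; rewrite expRN.
pose v w : C := cmk (a w / rwt w) (b w / rwt w).
have mv : cmeasurable D v by split; apply: measurable_funM.
have kvE k w : D w -> kernel (u k - v) (u k - v) w =
    (part (@cre R) k w - a w) ^+ 2 + (part (@cim R) k w - b w) ^+ 2.
  move=> Dw; rewrite kernel_sqr sqr_cabs -sqr_rwt // /part.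
  rewrite creD cimD !(creN, cimN) /=.
  by field; rewrite gt_eqF // rwt_gt0.
have muv k : cmeasurable D (u k - v).
  have [[m1 m2] _] := Hu k; have [mv1 mv2] := mv; split.
    rewrite (_ : _ \o _ = fun w => cre (u k w) - cre (v w)).
      exact: measurable_funB.
    by apply/funext => w; rewrite /= creD creN.
  rewrite (_ : _ \o _ = fun w => cim (u k w) - cim (v w)).
    exact: measurable_funB.
  by apply/funext => w; rewrite /= cimD cimN.
have ikv e : 0 < e -> exists N, forall k, (N <= k)%N ->
    (\int[lam1]_(w in D) (kernel (u k - v) (u k - v) w)%:E <= e%:E)%E.
  move=> e0; have e20 : 0 < e / 2 by rewrite divr_gt0.
  have [N NP] := aP _ e20; have [M MP] := bP _ e20.
  exists (maxn N M) => k; rewrite geq_max => /andP[Nk Mk].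
  under eq_integral => w /[!inE] Dw do rewrite kvE // EFinD.
  rewrite ge0_integralD //.
  - rewrite [e in leRHS](_ : e = e / 2 + e / 2); last by field.
    by rewrite EFinD leeD ?NP ?MP.
  - by move=> w _; rewrite lee_fin sqr_ge0.
  - by apply/measurable_EFinP; apply: measurable_funX; apply: measurable_funB => //; exact: mpart.
  - by move=> w _; rewrite lee_fin sqr_ge0.
  - by apply/measurable_EFinP; apply: measurable_funX; apply: measurable_funB => //; exact: mpart.
have Huv : exists N, forall k, (N <= k)%N -> inH lam1 (u k - v).
  have [N NP] := ikv 1 ltr01; exists N => k Nk; split=> //.
  by rewrite Hnorm2E (le_lt_trans (NP k Nk)) // ltry.
have [N0 N0P] := Huv.
exists v; split.
  have -> : v = u N0 - (u N0 - v) by rewrite opprB addrC subrK.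
  by apply: HB => //; exact: N0P.
move=> e e0; have [N NP] := ikv e e0; exists (maxn N N0) => k.
rewrite geq_max => /andP[Nk N0k].
by rewrite -lee_fin -integral_kernel ?NP //; exact: N0P.
Qed.

End WeightedL2.

(** * Trace duality *)

Section RealBasis.
Context {R : realType} (n : nat).
Local Notation C := R[i].
Local Notation T := (n.+1.-tuple R).
Variable lam1 : {measure set T -> \bar R}.
Local Notation D := (@uhs R n).
Local Notation rip := (rip lam1).

Lemma cre_Hip f h : cre (Hip lam1 f h) = rip f h.
Proof.
apply: eq_Rintegral => w _; rewrite /kernel /= mulrC -/(rc _) cre_rcM creM /=.
by rewrite mulrN opprK mulrC.
Qed.

Lemma cim_Hip f h : cim (Hip lam1 f h) = rip f (ci *: h).
Proof.
apply: eq_Rintegral => w _; rewrite /kernel /= mulrC -/(rc _) cim_rcM cimM /=.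
by rewrite cfun_scaleE creM cimM /=; ring.
Qed.

Lemma rip_ciZ f h : rip (ci *: f) (ci *: h) = rip f h.
Proof.
apply: eq_Rintegral => w _; rewrite /kernel !cfun_scaleE !creM !cimM /=; ring.
Qed.

(** The vectors [e j] and [ci *: e j] interleaved: an orthonormal basis of H over the reals. The
    order matches the even and odd real Gaussians that [cgauss] combines. *)
Definition real_basis (e : nat -> T -> C) (l : nat) : T -> C :=
  if odd l then ci *: e l./2 else e l./2.

Section Basis.
Variable e : nat -> T -> C.
Hypothesis he : is_ONB lam1 e.

Lemma inH_real_basis l : inH lam1 (real_basis e l).
Proof.
have [He _ _] := he; rewrite /real_basis; case: ifP => _ //; exact: inHZ.
Qed.

Lemma real_basis_orth l m : rip (real_basis e l) (real_basis e m) = (l == m)%:R.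
Proof.
have [He eo _] := he; have [_ _ _ [ripC _ _ _]] := prehilbert_inH lam1.
have E1 i j : rip (e i) (e j) = (i == j)%:R.
  by rewrite -cre_Hip eo; case: (i == j).
have E2 i j : rip (e i) (ci *: e j) = 0.
  by rewrite -cim_Hip eo; case: (i == j).
have lm : (l == m) = (odd l == odd m) && (l./2 == m./2).
  apply/eqP/andP => [->|[/eqP o /eqP h]]; first by rewrite !eqxx.
  by rewrite -(odd_double_half l) -(odd_double_half m) o h.
rewrite lm /real_basis; case: (odd l); case: (odd m) => /=.
- by rewrite rip_ciZ E1.
- by rewrite ripC ?E2 //; exact: inHZ.
- by rewrite E2.
- by rewrite E1.
Qed.

Lemma real_basis_total x : inH lam1 x ->
  (forall l, rip x (real_basis e l) = 0) -> rip x x = 0.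
Proof.
move=> Hx x0; have [He _ et] := he.
have : Hnorm2 lam1 x = 0%E.
  apply: et => // j; apply: complex_eq.
    by rewrite cre_Hip; have := x0 j.*2; rewrite /real_basis odd_double doubleK.
  by rewrite cim_Hip; have := x0 j.*2.+1; rewrite /real_basis /= odd_double /= uphalf_double.
by rewrite rip_Hnorm2 // => -[].
Qed.

Lemma parseval_H f h : inH lam1 f -> inH lam1 h ->
  (fun M => \sum_(l < M) rip f (real_basis e l) * rip (real_basis e l) h) @ \oo --> rip f h.
Proof.
apply: (parseval (prehilbert_inH lam1)).
- exact: inH_real_basis.
- exact: real_basis_orth.
- exact: real_basis_total.
- exact: inH_complete.
Qed.

End Basis.

Definition conjf (p : T -> C) : T -> C := fun w => cconj (p w).

Lemma inH_conjf p : inH lam1 p -> inH lam1 (conjf p).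
Proof.
move=> Hp; have [[m1 m2] _] := Hp.
apply: (@inH_dominated _ _ _ _ p 1) => //; last by move=> w _; rewrite cabs_cconj mul1r.
by split => //; apply: measurableT_comp m2.
Qed.

Lemma cre_Hint p h : cre (Hint lam1 (fun w => p w * h w)) = rip h (conjf p).
Proof.
by apply: eq_Rintegral => w _; rewrite /kernel /= mulrC -/(rc _) cre_rcM creM /=; ring.
Qed.

Lemma cim_Hint p h : inH lam1 p -> inH lam1 h ->
  cim (Hint lam1 (fun w => p w * h w)) = - rip (ci *: h) (conjf p).
Proof.
move=> Hp Hh; have [_ _ _ [_ _ ripZ _]] := prehilbert_inH lam1.
rewrite -mulN1r -ripZ; [|exact: inHZ|exact: inH_conjf].
apply: eq_Rintegral => w _; rewrite /kernel /= mulrC -/(rc _) cim_rcM cimM.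
by rewrite cfun_scaleE cre_rcM cim_rcM cfun_scaleE creM cimM /=; ring.
Qed.

End RealBasis.

Section GammaRep.
Context {R : realType} (n : nat).
Local Notation C := R[i].
Local Notation T := (n.+1.-tuple R).
Variable lam1 : {measure set T -> \bar R}.
Variables (Z : lmodType C) (S : set Z) (nZ : Z -> R).
Local Notation rip := (rip lam1).

(** A Gauss norm rewritten with real data, where [x l] plays the role of the image of [eps l]. The
    last clause has [M.*2] and [2 * v ^+ 2] because each complex term consists of two real ones and
    carries a factor [1 / sqrt 2]. *)
Inductive gamma_rep (Phi : T -> Z) (v : R) : Prop := GammaRep
  (Iop : (T -> C) -> Z) (eps : nat -> T -> C) (x : nat -> Z)
  dO (Omega : measurableType dO) (P : probability Omega R) (g : nat -> Omega -> R)
  of (forall K, gauss_seq P K g)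
  & (forall l, S (x l))
  & (forall l, inH lam1 (eps l))
  & (forall l m, rip (eps l) (eps m) = (l == m)%:R)
  & (forall h, inH lam1 h -> S (Iop h))
  & (forall h phi, inH lam1 h -> is_dual S nZ phi ->
      phi (Iop h) = Hint lam1 (fun w => phi (Phi w) * h w))
  & (forall h phi, inH lam1 h -> is_dual S nZ phi ->
      (fun M => \sum_(l < M) rip h (eps l) * cre (phi (x l))) @ \oo --> cre (phi (Iop h)))
  & (forall phi, is_dual S nZ phi ->
      (fun M => \sum_(l < M) cre (phi (x l)) ^+ 2) @ \oo -->
        rip (conjf (phi \o Phi)) (conjf (phi \o Phi)))
  & (fun M => fine (gq nZ P g x M.*2)) @ \oo --> 2 * v ^+ 2.

Hypothesis sn : seminormed S nZ.

Lemma sum_double (V : zmodType) (F : nat -> V) N :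
  \sum_(l < N.*2) F l = \sum_(j < N) (F j.*2 + F j.*2.+1).
Proof.
elim: N => [|N IH]; first by rewrite !big_ord0.
by rewrite doubleS !big_ord_recr /= IH addrA.
Qed.

Lemma is_dualZ phi (a : C) u : is_dual S nZ phi -> S u -> phi (a *: u) = a * phi u.
Proof.
move=> [pl _] Su; have S0 := seminormed0 sn.
have p0 : phi 0 = 0.
  have := pl 1 0 0 S0 S0; rewrite scaler0 add0r mul1r => /eqP.
  by rewrite -subr_eq subrr => /eqP <-.
by have := pl a u 0 Su S0; rewrite addr0 p0 addr0.
Qed.

Lemma gamma_valueP (Phi : T -> Z) v : gamma_value S nZ lam1 Phi v -> gamma_rep Phi v.
Proof.
move=> [_ [wPhi [Iop [e [hI [he gg]]]]]].
move: gg => [dO [Om [P [g [hg [_ cv]]]]]].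
(* [Iop] is known only through functionals, so [ci] is kept outside it instead of relying on
   [Iop (ci *: e) = ci *: Iop e]. *)
pose x l := if odd l then ci *: Iop (e l./2) else Iop (e l./2).
have [He eo et] := he.
have SI h : inH lam1 h -> S (Iop h) by move=> Hh; have [] := hI h Hh.
have IE h phi : inH lam1 h -> is_dual S nZ phi ->
    phi (Iop h) = Hint lam1 (fun w => phi (Phi w) * h w).
  by move=> Hh; have [_] := hI h Hh; apply.
have Sx l : S (x l).
  by rewrite /x; case: ifP => _; [apply: (seminormedZ sn)|]; exact: SI.
have hg' K : gauss_seq P K g by exact: iid_std_gauss_seq.
have xE phi l : is_dual S nZ phi ->
    cre (phi (x l)) = rip (real_basis e l) (conjf (phi \o Phi)).
  move=> dphi; rewrite /x /real_basis; case: ifP => _; last first.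
    by rewrite IE // cre_Hint.
  rewrite is_dualZ ?creM //=; last exact: SI.
  by rewrite mul0r mul1r sub0r IE // cim_Hint ?opprK //; exact: wPhi.
apply: (@GammaRep _ _ Iop (real_basis e) x dO Om P g) => //.
- exact: inH_real_basis.
- exact: real_basis_orth.
- move=> h phi Hh dphi; rewrite IE // cre_Hint.
  under eq_fun do under eq_bigr do rewrite xE //.
  by apply: parseval_H => //; apply: inH_conjf; exact: wPhi.
- move=> phi dphi; have Hp := inH_conjf (wPhi phi dphi).
  have [_ _ _ [ripC _ _ _]] := prehilbert_inH lam1.
  have xxE M : \sum_(l < M) cre (phi (x l)) ^+ 2 =
      \sum_(l < M) rip (conjf (phi \o Phi)) (real_basis e l) *
                    rip (real_basis e l) (conjf (phi \o Phi)).
    apply: eq_bigr => l _; rewrite xE // expr2; congr (_ * _).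
    by rewrite ripC //; exact: inH_real_basis.
  by under eq_fun do rewrite xxE; exact: parseval_H.
have s2 : (Num.sqrt 2^-1 : R) ^+ 2 = 2^-1 by rewrite sqr_sqrtr.
have gE N om : gsum g e Iop N om = rc (Num.sqrt 2^-1) *: comb N.*2 x (g^~ om).
  rewrite /gsum /comb (sum_double (fun l => rc (g l om) *: x l)) scaler_sumr.
  apply: eq_bigr => j _; rewrite /x /= odd_double /= doubleK uphalf_double.
  rewrite scalerA -scalerDl scalerA; congr (_ *: _).
  rewrite sqrtrV // /cgauss; apply: complex_eq;
    rewrite ?(creM, cimM, creD, cimD) /= ?(creM, cimM) /=; ring.
have EE N : (\int[P]_om ((nZ (gsum g e Iop N om)) ^+ 2)%:E)%E =
    (2^-1%:E * gq nZ P g x N.*2)%E.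
  rewrite /gq -ge0_integralZl ?lee_fin ?invr_ge0 //; last 2 first.
  - exact: (measurable_gq sn hg').
  - by move=> om _; rewrite lee_fin sqr_ge0.
  apply: eq_integral => om _; rewrite gE (nZZ sn); last exact: (seminormed_comb sn).
  by rewrite cabs_rc exprMn real_normK ?num_real // s2 EFinM.
have gf N : gq nZ P g x N \is a fin_num by apply: (gq_fin_num sn hg').
have cv2 := cvgM cv cv; rewrite -expr2 in cv2.
rewrite (_ : (fun M => _) = fun M => 2 * (Num.sqrt (fine (\int[P]_om ((nZ (gsum g e Iop M om)) ^+ 2)%:E)%E) ^+ 2)).
  by apply: cvgM; [exact: cvg_cst|exact: cv2].
apply/funext => M; rewrite EE fineM // sqr_sqrtr /=; first by field.
by rewrite mulr_ge0 ?invr_ge0 // fine_ge0 // gq_ge0.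
Qed.

End GammaRep.

(** * Strong measurability *)

Section StrongMeasurability.
Context {R : realType} d (T : measurableType d) (D : set T).
Local Notation C := R[i].

(** A sublevel set of [psi \o s] is a finite union of level sets of [s], so [psi] may be
    arbitrary. *)
Lemma measurable_fun_finite_range (U : Type) (s : T -> U) (psi : U -> R) :
  finite_set (range s) -> (forall z, measurable (D `&` s @^-1` [set z])) ->
  measurable_fun D (psi \o s).
Proof.
move=> fs ms; apply: measurable_lt_sets => a.
rewrite (_ : _ `&` _ =
    \bigcup_(z in range s `&` [set z | psi z < a]) (D `&` s @^-1` [set z])).
  apply: fin_bigcup_measurable => [|z _]; last exact: ms.
  exact: finite_setIl.
apply/seteqP; split => [w [Dw /= pw]|w [z [_ /= pz] [Dw /= sw]]].
  by exists (s w) => //; split => //=; exists w.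
by split=> //=; rewrite sw.
Qed.

Variables (Z : lmodType C) (S : set Z) (nZ : Z -> R).
Hypothesis sn : seminormed S nZ.

Lemma nZ_subC x y : S x -> S y -> nZ (x - y) = nZ (y - x).
Proof.
move=> Sx Sy; have Sxy : S (x - y).
  by rewrite -scaleN1r; apply: (seminormedD sn) => //; exact: (seminormedZ sn).
transitivity (nZ (- 1 *: (x - y))); last by rewrite scaleN1r opprB.
by rewrite (nZZ sn) // cabsN cabs1 mul1r.
Qed.

Lemma nZ_distr x y : S x -> S y -> `|nZ x - nZ y| <= nZ (x - y).
Proof.
move=> Sx Sy.
have SN u : S u -> S (- u) by rewrite -scaleN1r; exact: (seminormedZ sn).
have SB u v : S u -> S v -> S (u - v) by move=> Su Sv; exact: (seminormedD sn Su (SN _ Sv)).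
have H u v : S u -> S v -> nZ u - nZ v <= nZ (u - v).
  move=> Su Sv; rewrite lerBlDr; have := nZD sn (SB _ _ Su Sv) Sv.
  by rewrite subrK.
rewrite ler_norml H // andbT lerNl opprB.
by apply: le_trans (H _ _ Sy Sx) _; rewrite nZ_subC.
Qed.

Lemma strongly_measurable_dist Phi x : strongly_measurable S nZ D Phi -> S x ->
  measurable_fun D (fun w => nZ (Phi w - x)).
Proof.
move=> [SPhi [s [Ss fs ms cs]]] Sx.
have SB u v : S u -> S v -> S (u - v).
  by move=> Su Sv; apply: (seminormedD sn Su); rewrite -scaleN1r; exact: (seminormedZ sn).
apply: (@measurable_fun_cvg _ _ _ D (fun k w => nZ (s k w - x))) => [k|w Dw].
  exact: (@measurable_fun_finite_range _ (s k) (fun z => nZ (z - x))).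
apply/cvgrPdist_le => e e0.
have /cvgrPdist_le /(_ _ e0) [N _ NP] := cs w Dw; exists N => // k Nk.
apply: le_trans (nZ_distr (SB _ _ (SPhi _ Dw) Sx) (SB _ _ (Ss _ _) Sx)) _.
have := NP k Nk; rewrite /= sub0r normrN => H; apply: le_trans H.
by rewrite opprB addrA subrK nZ_subC ?ler_norm //; exact: SPhi.
Qed.

Lemma strongly_measurable_norm Phi : strongly_measurable S nZ D Phi ->
  measurable_fun D (fun w => nZ (Phi w)).
Proof.
move=> /strongly_measurable_dist /(_ (seminormed0 sn)).
by under eq_fun do rewrite subr0.
Qed.

(** The countably many values of the approximating simple functions come arbitrarily close to every
    value of [Phi] on [D]. *)
Lemma strongly_measurable_dense Phi : strongly_measurable S nZ D Phi ->
  exists x : nat -> Z, (forall i, S (x i)) /\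
    forall w (e : R), D w -> 0 < e -> exists i, nZ (Phi w - x i) < e.
Proof.
move=> [SPhi [s [Ss fs _ cs]]].
have /choice[r rP] : forall k, exists r : seq Z, range (s k) = [set` r].
  by move=> k; have /finite_seqP[r rE] := fs k; exists r.
(* The code is a pair: a simple function and a position in the list of its values. Other codes and
   positions past the end give [0], which lies in [S]. *)
pose x i := if unpickle i is Some kj then nth 0 (r kj.1) kj.2 else 0.
exists x; split.
  move=> i; rewrite /x; case: unpickle => [[k j]|]; last exact: (seminormed0 sn).
  have [jr|jr] := ltnP j (size (r k)); last first.
    by rewrite nth_default //; exact: (seminormed0 sn).
  have : [set` r k] (nth 0 (r k) j) by rewrite /= mem_nth.
  by rewrite -rP => -[w _ <-].
move=> w e Dw e0; have /cvgrPdist_lt /(_ _ e0) [N _ NP] := cs w Dw.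
have : [set` r N] (s N w) by rewrite -rP; exists w.
move=> /= sr; exists (pickle (N, index (s N w) (r N))).
rewrite /x pickleK /= nth_index //; have := NP N (leqnn N).
rewrite /= sub0r normrN; apply: le_lt_trans.
by rewrite nZ_subC ?ler_norm //; exact: SPhi.
Qed.

End StrongMeasurability.

Section PairingMeasurability.
Context {R : realType} d (T : measurableType d) (D : set T) (X : normedModType R[i]).
Local Notation C := R[i].
Variables (F : T -> X) (G : T -> X -> C).
Hypothesis mF : strongly_measurable setT (@Xnorm R X) D F.
Hypothesis mG : strongly_measurable (@is_Xdual R X) (@Xdual_norm R X) D G.

(** Pairing the two simple approximations gives functions of finite range that converge pointwise to
    [G w (F w)]. *)
Lemma cmeasurable_pairing : cmeasurable D (fun w => G w (F w)).
Proof.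
have [_ [s [_ fs ms cs]]] := mF; have [XG [t [Xt ft mt ct]]] := mG.
pose u k w := (s k w, t k w).
have fu k : finite_set (range (u k)).
  apply: (@sub_finite_set _ _ (range (s k) `*` range (t k))).
    by move=> _ [w _ <-]; split; exists w.
  exact: finite_setX.
have mu k z : measurable (D `&` u k @^-1` [set z]).
  rewrite (_ : _ `&` _ = (D `&` s k @^-1` [set z.1]) `&` (D `&` t k @^-1` [set z.2])).
    exact: measurableI.
  apply/seteqP; split => [w [Dw /= <-]//|w [[Dw /= e1] [_ /= e2]]].
  by split => //=; rewrite /u e1 e2; case: (z).
have key w : D w -> forall e : R, 0 < e -> \forall k \near \oo,
    cabs (t k w (s k w) - G w (F w)) <= e.
  move=> Dw e e0.
  pose b := Xdual_norm (G w); pose a := Xnorm (F w).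
  have b0 : 0 <= b by apply: dual_norm_ge0; exact: XG.
  have a0 : 0 <= a by exact: Xnorm_ge0.
  (* The three error terms are at most [de], [de * a] and [b * de]; the cap at [1] reduces a product
     of two errors to a single [de]. *)
  pose de := Num.min 1 (e / (a + b + 1)).
  have k0 : 0 < a + b + 1 by rewrite ltr_wpDl ?addr_ge0.
  have de0 : 0 < de by rewrite lt_min ltr01 divr_gt0.
  have de1 : de <= 1 by rewrite ge_min lexx.
  have dee : de * (a + b + 1) <= e.
    by rewrite -ler_pdivlMr // ge_min lexx orbT.
  have [N _ NP] := (cvgrPdist_le _ _).1 (cs w Dw) _ de0.
  have [M _ MP] := (cvgrPdist_le _ _).1 (ct w Dw) _ de0.
  exists (maxn N M) => // k; rewrite /= geq_max => /andP[Nk Mk].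
  have := NP k Nk; rewrite /= sub0r normrN => /(le_trans (ler_norm _)) sN.
  have := MP k Mk; rewrite /= sub0r normrN => /(le_trans (ler_norm _)) tM.
  have XtG : is_Xdual (t k w - G w).
    by rewrite -scaleN1r; apply: is_XdualD => //; apply: is_XdualZ; exact: XG.
  have -> : t k w (s k w) - G w (F w) =
      (t k w - G w) (s k w - F w) + (t k w - G w) (F w) + G w (s k w - F w).
    have E z : (t k w - G w) z = t k w z - G w z by [].
    by rewrite !E !dualB //; [ring|exact: XG].
  have B1 := dual_norm_le (s k w - F w) XtG.
  have B2 := dual_norm_le (F w) XtG.
  have B3 := dual_norm_le (s k w - F w) (XG w Dw).
  have C1 := cabsD ((t k w - G w) (s k w - F w) + (t k w - G w) (F w)) (G w (s k w - F w)).
  have C2 := cabsD ((t k w - G w) (s k w - F w)) ((t k w - G w) (F w)).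
  have p1 := Xnorm_ge0 (s k w - F w); have p2 := dual_norm_ge0 XtG.
  rewrite -/a -/b in B2 B3.
  have E1 : Xdual_norm (t k w - G w) * Xnorm (s k w - F w) <= de by nra.
  have E2 : Xdual_norm (t k w - G w) * a <= de * a by rewrite ler_wpM2r.
  have E3 : b * Xnorm (s k w - F w) <= b * de by rewrite ler_wpM2l.
  lra.
split.
  apply: (@measurable_fun_cvg _ _ _ D (fun k w => cre (t k w (s k w)))) => [k|w Dw].
    exact: (@measurable_fun_finite_range _ _ _ _ _ (u k) (fun z => cre (z.2 z.1))).
  apply/cvgrPdist_le => e e0; apply: filterS (key w Dw e e0) => k.
  by rewrite distrC /= -creN -creD; exact: le_trans (cre_le_cabs _).
apply: (@measurable_fun_cvg _ _ _ D (fun k w => cim (t k w (s k w)))) => [k|w Dw].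
  exact: (@measurable_fun_finite_range _ _ _ _ _ (u k) (fun z => cim (z.2 z.1))).
apply/cvgrPdist_le => e e0; apply: filterS (key w Dw e e0) => k.
by rewrite distrC /= -cimN -cimD; exact: le_trans (cim_le_cabs _).
Qed.

End PairingMeasurability.

Lemma strongly_measurable_cst {R : realType} d (T : measurableType d) (D : set T)
    (Z : lmodType R[i]) (S : set Z) (nZ : Z -> R) z :
  seminormed S nZ -> measurable D -> S z -> strongly_measurable S nZ D (fun _ => z).
Proof.
move=> sn mD Sz; split=> //; exists (fun _ _ => z); split=> //.
- by move=> _; apply: sub_finite_set (finite_set1 z) => _ [w _ <-].
- move=> _ z'; rewrite preimage_cst; case: ifP => _; first by rewrite setIT.
  by rewrite setI0.
- move=> w _; rewrite subrr -(scale0r 0) (nZZ sn) ?cabs0 ?mul0r; first exact: cvg_cst.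
  exact: (seminormed0 sn).
Qed.

Section TraceCore.
Context {R : realType} (n : nat).
Local Notation C := R[i].
Local Notation T := (n.+1.-tuple R).
Variable lam1 : {measure set T -> \bar R}.
Local Notation rip := (rip lam1).

Lemma cvg_double (u : nat -> R) (l : R) : u @ \oo --> l -> (fun M => u M.*2) @ \oo --> l.
Proof.
move=> /cvgrPdist_le cu; apply/cvgrPdist_le => e e0.
have [N _ NP] := cu e e0; exists N => // M /= NM.
by apply: NP; rewrite /= -addnn (leq_trans NM) // leq_addr.
Qed.

Lemma lim_le_lim (u w : nat -> R) (a b : R) : u @ \oo --> a -> w @ \oo --> b ->
  (forall k, u k <= w k) -> a <= b.
Proof. by move=> ua wb uw; apply: (ler_cvg_to ua wb); apply: nearW. Qed.

Lemma cvg_sum_ord N (f : 'I_N -> nat -> R) (l : 'I_N -> R) :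
  (forall i, f i @ \oo --> l i) ->
  (fun k => \sum_(i < N) f i k) @ \oo --> \sum_(i < N) l i.
Proof.
elim: N f l => [|N IH] f l fl.
  by rewrite big_ord0; under eq_fun do rewrite big_ord0; exact: cvg_cst.
rewrite big_ord_recr; under eq_fun do rewrite big_ord_recr.
by apply: cvgD; [exact: IH|exact: fl].
Qed.

Lemma cvgMl (u : nat -> R) (c l : R) : u @ \oo --> l -> (fun k => c * u k) @ \oo --> c * l.
Proof. by move=> ul; apply: cvgM => //; exact: cvg_cst. Qed.

(** The limit of [gq_functional]: Parseval turns the sum of squares into the squared norm of
    [phi \o Phi] in H. This weak estimate is what settles the [0 * oo] cases. *)
Lemma gamma_rep_functional (Z : lmodType C) (S : set Z) (nZ : Z -> R) Phi v phi c :
  seminormed S nZ -> gamma_rep lam1 S nZ Phi v -> is_dual S nZ phi -> 0 <= c ->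
  (forall z, S z -> cabs (phi z) <= c * nZ z) ->
  sigma2 * rip (conjf (phi \o Phi)) (conjf (phi \o Phi)) <= 2 * c ^+ 2 * v ^+ 2.
Proof.
move=> sn [Iop eps x dO Om P g hg Sx _ _ _ _ _ cphi cg] dphi c0 phic.
have c1 := cvg_double (cphi phi dphi).
rewrite (_ : 2 * c ^+ 2 * v ^+ 2 = c ^+ 2 * (2 * v ^+ 2)); last by ring.
apply: (lim_le_lim (cvgMl (c := sigma2) c1) (cvgMl (c := c ^+ 2) cg)) => M /=.
have gf : gq nZ P g x M.*2 \is a fin_num by apply: (gq_fin_num sn hg).
rewrite -lee_fin [leRHS]EFinM fineK //; apply: (@gq_functional _ _ _ _ sn _ _ P g hg x _ (fun l => cre (phi (x l))) c Sx) => u.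
have [pl _] := dphi.
have phi_comb L : phi (comb L x u) = \sum_(l < L) rc (u l) * phi (x l).
  rewrite /comb; elim: L => [|L IH].
    by rewrite !big_ord0 -(scale0r 0) (is_dualZ sn) ?mul0r //; exact: (seminormed0 sn).
  rewrite !big_ord_recr /= addrC pl ?IH 1?addrC //.
  exact: (seminormed_comb sn).
have -> : \sum_(l < M.*2) u l * cre (phi (x l)) = cre (phi (comb M.*2 x u)).
  by rewrite phi_comb cre_sum; apply: eq_bigr => l _; rewrite cre_rcM.
apply: le_trans (cre_le_cabs _) (phic _ _).
exact: (seminormed_comb sn).
Qed.

Variable X : normedModType C.
Local Notation nX := (@Xnorm R X).
Local Notation nX' := (@Xdual_norm R X).
Local Notation X' := (@is_Xdual R X).

Lemma is_dual_Xdual y : X' y -> is_dual setT nX y.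
Proof. by move=> [yl [c yc]]; split=> [a u v _ _|]; [exact: yl|exists c => z _; exact: yc]. Qed.

Lemma is_dual_eval z : is_dual X' nX' (fun y => y z).
Proof.
split=> // ; exists (nX z) => y Yy; rewrite mulrC; exact: dual_norm_le.
Qed.

Definition orthogonal_contraction (h : nat -> T -> C) : Prop :=
  [/\ forall i, inH lam1 (h i), forall i j, i != j -> rip (h i) (h j) = 0 &
      forall i, rip (h i) (h i) <= 1].

(** The inner sum is the product of [h i] with the combination of the [eps l], so the claim is
    Bessel's inequality for the family [h]. *)
Lemma orthogonal_contraction_coef h (eps : nat -> T -> C) N M :
  orthogonal_contraction h -> (forall l, inH lam1 (eps l)) ->
  (forall l m, rip (eps l) (eps m) = (l == m)%:R) ->
  forall d : nat -> R,
    \sum_(i < N) (\sum_(l < M) rip (h i) (eps l) * d l) ^+ 2 <= \sum_(l < M) d l ^+ 2.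
Proof.
move=> [Hh ho h1] Heps eo d; have ph := prehilbert_inH lam1.
rewrite -(ip_comb_basis ph Heps eo).
have Hc : inH lam1 (comb M eps d) by exact: (prehilbert_comb ph).
apply: le_trans (bessel ph N Hh Hc ho h1).
apply: ler_sum => i _; rewrite (ip_combr ph) //.
by under eq_bigr do rewrite mulrC.
Qed.

(* [Iop] and [Iop'] stand for the operators [I_F] and [I_G]; the pairing is
   expanded in the two bases, where it becomes a finite trace. *)
Lemma trace_core F G v v' : gamma_rep lam1 setT nX F v -> gamma_rep lam1 X' nX' G v' ->
  exists Iop Iop', [/\ forall h, inH lam1 h -> X' (Iop' h),
    forall h y, inH lam1 h -> X' y -> y (Iop h) = Hint lam1 (fun w => y (F w) * h w),
    forall h z, inH lam1 h -> Iop' h z = Hint lam1 (fun w => G w z * h w) &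
    forall h k N s, orthogonal_contraction h -> orthogonal_contraction k -> 0 < s ->
      sigma2 * \sum_(i < N) cre (Iop' (k i) (Iop (h i))) <= s * v ^+ 2 + s^-1 * v' ^+ 2].
Proof.
move=> [Iop eps x dO Om P g hg _ Heps eo _ Ih Ic _ cg].
move=> [Iop' eps' y dO' Om' P' g' hg' Yy Heps' eo' SI' Ih' Ic' _ cg'].
exists Iop, Iop'; split => //.
- by move=> h z Hh Xz; apply: Ih => //; exact: is_dual_Xdual.
- by move=> h z Hh; apply: (Ih' h (fun y => y z)) => //; exact: is_dual_eval.
move=> h k N s oh ok s0; have [Hh _ _] := oh; have [Hk _ _] := ok.
pose a i l := rip (h i) (eps l); pose b i m := rip (k i) (eps' m).
have sX := seminormed_Xnorm X; have sX' := seminormed_dual X.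
have fin_bound M K : 2 * sigma2 *
    (\sum_(i < N) cre ((comb K y (b i)) (comb M x (a i)))) <=
    s * fine (gq nX P g x M) + s^-1 * fine (gq nX' P' g' y K).
  have gf : gq nX P g x M \is a fin_num by apply: (gq_fin_num sX hg).
  have gf' : gq nX' P' g' y K \is a fin_num by apply: (gq_fin_num sX' hg').
  have Yc i : X' (comb K y (b i)) by exact: (seminormed_comb sX').
  rewrite -lee_fin [leRHS]EFinD ![in leRHS]EFinM !fineK //.
  apply: le_trans (trace_bound hg N (fun i => comb M x (a i)) s0 Yc) _.
  rewrite leeD // lee_pmul2l ?lte_fin ?invr_gt0 //.
    apply: (gq_contraction sX hg) => //.
    exact: orthogonal_contraction_coef.
  (* The sum for [G] is moved to the Gaussian sequence that came with [F]. *)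
  rewrite -(gq_law sX' K hg hg' Yy).
  apply: (gq_contraction sX' hg) => //.
  exact: orthogonal_contraction_coef.
have comb_cre M K i : cre (comb K y (b i) (comb M x (a i))) =
    \sum_(l < M) a i l * (\sum_(m < K) b i m * cre (y m (x l))).
  rewrite dual_comb; last exact: (seminormed_comb sX').
  rewrite cre_sum; apply: eq_bigr => l _; rewrite cre_rcM; congr (_ * _).
  by rewrite comb_dual cre_sum; apply: eq_bigr => m _; rewrite cre_rcM.
pose Y i := Iop' (k i).
(* The two bases are exhausted one after the other: first that of [G], tested by evaluations at the
   vectors [x l], then that of [F], tested by the functionals [Iop' (k i)]. The functionals on [X']
   that occur are thus evaluations only. *)
have step M : 2 * sigma2 * (\sum_(i < N) \sum_(l < M) a i l * cre (Y i (x l))) <=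
    s * fine (gq nX P g x M) + s^-1 * (2 * v' ^+ 2).
  have cL : (fun K => 2 * sigma2 *
      (\sum_(i < N) cre ((comb K.*2 y (b i)) (comb M x (a i))))) @ \oo -->
      2 * sigma2 * (\sum_(i < N) \sum_(l < M) a i l * cre (Y i (x l))).
    apply: cvgMl; apply: cvg_sum_ord => i.
    under eq_fun do rewrite comb_cre.
    apply: cvg_sum_ord => l; apply: cvgMl.
    apply: (@cvg_double (fun K => \sum_(m < K) b i m * cre (y m (x l)))).
    exact: (Ic' (k i) (fun y => y (x l)) (Hk i) (is_dual_eval (x l))).
  have cR : (fun K => s * fine (gq nX P g x M) + s^-1 * fine (gq nX' P' g' y K.*2)) @ \oo -->
      s * fine (gq nX P g x M) + s^-1 * (2 * v' ^+ 2).
    by apply: cvgD; [exact: cvg_cst|exact: cvgMl].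
  by apply: (lim_le_lim cL cR) => K; exact: fin_bound.
have cL : (fun M => 2 * sigma2 * (\sum_(i < N) \sum_(l < M.*2) a i l * cre (Y i (x l)))) @ \oo -->
    2 * sigma2 * (\sum_(i < N) cre (Y i (Iop (h i)))).
  apply: cvgMl; apply: cvg_sum_ord => i.
  apply: (@cvg_double (fun M => \sum_(l < M) a i l * cre (Y i (x l)))).
  by apply: Ic => //; apply: is_dual_Xdual; exact: SI'.
have cR : (fun M => s * fine (gq nX P g x M.*2) + s^-1 * (2 * v' ^+ 2)) @ \oo -->
    s * (2 * v ^+ 2) + s^-1 * (2 * v' ^+ 2).
  by apply: cvgD; [exact: cvgMl|exact: cvg_cst].
have := lim_le_lim cL cR (fun M => step M.*2).
rewrite /Y; set A := \sum_(i < N) _ => H.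
have : 2 * (sigma2 * A) <= 2 * (s * v ^+ 2 + s^-1 * v' ^+ 2) by move: H; nra.
by rewrite ler_pM2l.
Qed.

End TraceCore.

(** * The pairing on one small piece of the half space *)

Section Piece.
Context {R : realType} (n : nat).
Local Notation C := R[i].
Local Notation T := (n.+1.-tuple R).
Variable lam1 : {measure set T -> \bar R}.
Local Notation D := (@uhs R n).
Local Notation rip := (rip lam1).
Variables (A : set T) (mA : measurable A) (AD : A `<=` D) (mu : R).
Hypothesis muE : (\int[lam1]_(w in A) (wt w)%:E = mu%:E)%E.

Definition wint (f : T -> R) : R := Rintegral lam1 A (fun w => f w * wt w).

Lemma mu_ge0 : 0 <= mu.
Proof.
by rewrite -lee_fin -muE; apply: integral_ge0 => w /AD Dw; rewrite lee_fin ltW // wt_gt0.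
Qed.

Let mwt : measurable_fun A (@wt R n).
Proof. by apply: (measurable_funS _ AD); [exact: measurable_uhs|exact: measurable_wt]. Qed.

Lemma integrable_wint (f : T -> R) (B : R) : measurable_fun A f -> (forall w, A w -> `|f w| <= B) ->
  lam1.-integrable A (EFin \o (fun w => f w * wt w)).
Proof.
move=> mf fB.
have I : lam1.-integrable A (EFin \o (fun w => B * wt w)).
  apply/integrableP; split; first exact/measurable_EFinP/measurable_funM.
  under eq_integral => w /[!inE] Aw.
    rewrite /= normrM (gtr0_norm (wt_gt0 (AD Aw))) EFinM; over.
  have mw : measurable_fun A (fun w => (wt w)%:E) by exact/measurable_EFinP.
  have w0 w : A w -> (0 <= (wt w)%:E)%E.
    by move=> /AD Dw; rewrite lee_fin ltW // wt_gt0.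
  by rewrite ge0_integralZl ?lee_fin //= muE -EFinM ltry.
apply: (le_integrable mA _ _ I); first exact/measurable_EFinP/measurable_funM.
move=> w Aw /=; rewrite lee_fin !normrM; apply: ler_wpM2r => //.
exact: le_trans (fB w Aw) (ler_norm _).
Qed.

Lemma wint_cst c : wint (cst c) = c * mu.
Proof.
rewrite /wint /Rintegral /=.
have I : lam1.-integrable A (EFin \o @wt R n).
  have := @integrable_wint (cst 1) 1; rewrite /comp /=.
  by under eq_fun do rewrite mul1r; apply=> // w _; rewrite normr1.
under eq_integral do rewrite EFinM; rewrite integralZl //.
by rewrite muE -EFinM.
Qed.

Lemma wint_norm (f : T -> R) (B : R) : measurable_fun A f -> (forall w, A w -> `|f w| <= B) ->
  `|wint f| <= B * mu.
Proof.
move=> mf fB; have If := integrable_wint mf fB.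
apply: le_trans (le_normr_Rintegral mA If) _; rewrite -wint_cst.
apply: le_Rintegral => //.
- exact: (integrable_abse If).
- apply: (@integrable_wint _ `|B|) => // w Aw.
- move=> w Aw; rewrite normrM (gtr0_norm (wt_gt0 (AD Aw))) ler_wpM2r //; last exact: fB.
  by rewrite ltW // wt_gt0 //; exact: AD.
Qed.

Lemma wintB (f g : T -> R) (B B' : R) : measurable_fun A f -> (forall w, A w -> `|f w| <= B) ->
  measurable_fun A g -> (forall w, A w -> `|g w| <= B') ->
  wint (fun w => f w - g w) = wint f - wint g.
Proof.
move=> mf fB mg gB.
rewrite /wint -RintegralB //; [|exact: integrable_wint fB|exact: integrable_wint gB].
by apply: eq_Rintegral => w _; rewrite mulrBl.
Qed.

(** The indicator of [A], normalised in H and multiplied by [m]. For [mu = 0] the inverse is [0],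
    and so is the whole function. *)
Definition bump (m : T -> C) (w : T) : C := m w * rc (\1_A w / Num.sqrt mu).

Let DA : D `&` A = A. Proof. exact: setIidr. Qed.

Lemma cre_Hint_bump (q m : T -> C) (B : R) : measurable_fun A (fun w => cre (q w * m w)) ->
  (forall w, A w -> `|cre (q w * m w)| <= B) ->
  cre (Hint lam1 (fun w => q w * bump m w)) =
  (Num.sqrt mu)^-1 * wint (fun w => cre (q w * m w)).
Proof.
move=> mq qB; rewrite /wint -RintegralZl //; last exact: integrable_wint qB.
rewrite -{1}DA Rintegral_mkcondr; apply: eq_Rintegral => w _.
rewrite patchE /bump /= mulrA !(mulrC _ (rc _)) !cre_rcM indicE.
by case: ifP => _ /=; rewrite ?mul0r ?mulr0 //; ring.
Qed.

Lemma cim_Hint_bump (q m : T -> C) (B : R) : measurable_fun A (fun w => cim (q w * m w)) ->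
  (forall w, A w -> `|cim (q w * m w)| <= B) ->
  cim (Hint lam1 (fun w => q w * bump m w)) =
  (Num.sqrt mu)^-1 * wint (fun w => cim (q w * m w)).
Proof.
move=> mq qB; rewrite /wint -RintegralZl //; last exact: integrable_wint qB.
rewrite -{1}DA Rintegral_mkcondr; apply: eq_Rintegral => w _.
rewrite patchE /bump /= mulrA !(mulrC _ (rc _)) !cim_rcM indicE.
by case: ifP => _ /=; rewrite ?mul0r ?mulr0 //; ring.
Qed.

Variables (m : T -> C).
Hypotheses (mm : cmeasurable D m) (m1 : forall w, D w -> cabs (m w) <= 1).

Lemma kernel_bump w : kernel (bump m) (bump m) w =
  ((cabs (m w) ^+ 2 * (Num.sqrt mu)^-2 * wt w) * \1_A w).
Proof.
rewrite kernel_sqr /bump cabsM cabs_rc exprMn real_normK ?num_real // expr_div_n.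
by rewrite indicE; case: (w \in A) => /=; rewrite ?expr1n ?expr0n /=; ring.
Qed.

Lemma inH_bump : inH lam1 (bump m) /\ rip (bump m) (bump m) <= 1.
Proof.
have cm : cmeasurable D (bump m).
  have mi : measurable_fun D (fun w => \1_A w / Num.sqrt mu).
    by apply: measurable_funM => //; apply: measurable_funTS; exact: measurable_indic.
  have [mm1 mm2] := mm; split.
    rewrite (_ : _ \o _ = fun w => (\1_A w / Num.sqrt mu) * cre (m w)).
      exact: measurable_funM.
    by apply/funext => w; rewrite /bump /= mulrC cre_rcM.
  rewrite (_ : _ \o _ = fun w => (\1_A w / Num.sqrt mu) * cim (m w)).
    exact: measurable_funM.
  by apply/funext => w; rewrite /bump /= mulrC cim_rcM.
have H1 : (Hnorm2 lam1 (bump m) <= 1)%E.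
  rewrite Hnorm2E.
  apply: (@le_trans _ _ (\int[lam1]_(w in D) (((Num.sqrt mu)^-2 * wt w) * \1_A w)%:E)%E).
    apply: ge0_le_lower_integral => w Dw; first by rewrite lee_fin kernel_ge0.
    rewrite lee_fin kernel_bump; apply: ler_wpM2r.
      by rewrite indicE.
    apply: ler_wpM2r; first by rewrite ltW // wt_gt0.
    rewrite -[leRHS]mul1r; apply: ler_wpM2r; first by rewrite invr_ge0 sqr_ge0.
    by rewrite -(expr1n _ 2) ler_sqr ?nnegrE ?cabs_ge0 // m1.
  have -> : (\int[lam1]_(w in D) (((Num.sqrt mu)^-2 * wt w) * \1_A w)%:E =
      \int[lam1]_(w in A) ((Num.sqrt mu)^-2 * wt w)%:E)%E.
    rewrite -[in RHS]DA integral_mkcondr; apply: eq_integral => w _.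
    by rewrite patchE indicE; case: ifP => _ /=; rewrite ?mulr1 ?mulr0.
  under eq_integral do rewrite EFinM.
  have mw : measurable_fun A (fun w => (wt w)%:E) by exact/measurable_EFinP.
  have w0 w : A w -> (0 <= (wt w)%:E)%E.
    by move=> /AD Dw; rewrite lee_fin ltW // wt_gt0.
  rewrite ge0_integralZl ?lee_fin ?invr_ge0 ?sqr_ge0 //.
  rewrite muE -EFinM lee_fin sqr_sqrtr ?mu_ge0 //.
  by have [->|m0] := eqVneq mu 0; [rewrite mulr0|rewrite mulVf].
have Hb : inH lam1 (bump m) by split=> //; apply: le_lt_trans H1 (ltry _).
by split=> //; rewrite -lee_fin -rip_Hnorm2.
Qed.

Variable X : normedModType C.
Local Notation nX := (@Xnorm R X).
Local Notation nX' := (@Xdual_norm R X).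
Local Notation X' := (@is_Xdual R X).
Variables (F : T -> X) (G : T -> X -> C) (b e : R) (x : X).
Hypothesis mF : strongly_measurable setT nX D F.
Hypothesis mG : strongly_measurable X' nX' D G.
Hypotheses (b0 : 0 <= b).
Hypothesis Gb : forall w, A w -> nX' (G w) <= b.
Hypothesis Fx : forall w, A w -> nX (F w - x) <= e.
Hypothesis mGF : forall w, D w -> m w * G w (F w) = rc (cabs (G w (F w))).

Let cmM (p q : T -> C) : cmeasurable D p -> cmeasurable D q -> cmeasurable D (fun w => p w * q w).
Proof.
move=> [p1 p2] [q1 q2]; split.
  rewrite (_ : _ \o _ = fun w => cre (p w) * cre (q w) - cim (p w) * cim (q w)).
    by apply: measurable_funB; exact: measurable_funM.
  by apply/funext => w; rewrite /= creM.
rewrite (_ : _ \o _ = fun w => cre (p w) * cim (q w) + cim (p w) * cre (q w)).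
  by apply: measurable_funD; exact: measurable_funM.
by apply/funext => w; rewrite /= cimM.
Qed.

Let mAD (f : T -> R) : measurable_fun D f -> measurable_fun A f.
Proof. by apply: measurable_funS => //; exact: measurable_uhs. Qed.

(** Here [z] and [y] stand for the integrals of [F] and [m G] over the piece, divided by
    [k = sqrt mu]. In real parts, [y z] is [k^-1] times the integral of [y (F w)], which is close to
    [k * y x]; and [k * y x] is the integral of [m w * G w x], which is close to that of
    [cabs (G w (F w))]. Exchanging [F w] and [x] costs [2 * b * e * mu] the first time and
    [b * e * mu] the second. *)
Lemma piece_bound z y : X' y ->
  (forall y', X' y' -> y' z = Hint lam1 (fun w => y' (F w) * bump (cst 1) w)) ->
  (forall x', y x' = Hint lam1 (fun w => G w x' * bump m w)) ->
  wint (fun w => cabs (G w (F w))) <= cre (y z) + 3 * b * e * mu.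
Proof.
move=> Yy zE yE; have [XG _] := mG.
pose k := Num.sqrt mu.
have cmGx x' : cmeasurable D (fun w => G w x' * m w).
  apply: cmM => //; apply: (cmeasurable_pairing (F := fun _ => x')) => //.
  by apply: strongly_measurable_cst => //; [exact: seminormed_Xnorm|exact: measurable_uhs].
have Gx' x' w : A w -> cabs (G w x' * m w) <= b * nX x'.
  move=> Aw; rewrite cabsM -[leRHS]mulr1; apply: ler_pM; rewrite ?cabs_ge0 ?m1 //; last exact: AD.
  apply: le_trans (dual_norm_le _ (XG w (AD Aw))) _.
  by rewrite ler_wpM2r ?Xnorm_ge0 ?Gb.
have cmF y' : X' y' -> cmeasurable D (fun w => y' (F w)).
  move=> Yy'; apply: (cmeasurable_pairing (G := fun _ => y')) => //.
  by apply: strongly_measurable_cst => //; [exact: seminormed_dual|exact: measurable_uhs].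
have cabs_le (q : C) : cabs q <= `|cre q| + `|cim q|.
  rewrite -ler_sqr ?nnegrE ?cabs_ge0 ?addr_ge0 // sqr_cabs sqrrD !real_normK ?num_real //.
  by rewrite addrAC lerDl mulrn_wge0 // mulr_ge0.
have k0 : 0 <= k by exact: sqrtr_ge0.
have kmu : k^-1 * mu = k.
  have [k00|kn0] := eqVneq k 0.
    by rewrite k00 -(sqr_sqrtr mu_ge0) -/k k00 expr0n mulr0.
  by rewrite -(sqr_sqrtr mu_ge0) -/k; field.
(* The factor [2] comes from estimating real and imaginary parts separately. *)
have ynorm x' : cabs (y x') <= 2 * b * k * nX x'.
  apply: le_trans (cabs_le _) _; rewrite yE.
  have [mre mim] := cmGx x'.
  have bre w : A w -> `|cre (G w x' * m w)| <= b * nX x'.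
    by move=> Aw; apply: le_trans (cre_le_cabs _) (Gx' _ _ Aw).
  have bim w : A w -> `|cim (G w x' * m w)| <= b * nX x'.
    by move=> Aw; apply: le_trans (cim_le_cabs _) (Gx' _ _ Aw).
  rewrite (cre_Hint_bump (mAD mre) bre) (cim_Hint_bump (mAD mim) bim).
  rewrite !normrM (ger0_norm (x := k^-1)) ?invr_ge0 // -mulrDr.
  have W1 := wint_norm (mAD mre) bre; have W2 := wint_norm (mAD mim) bim.
  apply: (@le_trans _ _ (k^-1 * (2 * (b * nX x' * mu)))).
    by rewrite ler_wpM2l ?invr_ge0 //; lra.
  have -> : k^-1 * (2 * (b * nX x' * mu)) = 2 * b * nX x' * (k^-1 * mu) by ring.
  by rewrite kmu mulrAC.
have Fd w : A w -> cabs (y (F w - x)) <= 2 * b * k * e.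
  move=> Aw; apply: le_trans (ynorm _) _; rewrite ler_wpM2l ?Fx //.
  by rewrite !mulr_ge0.
have [myF _] := cmF y Yy.
have byF w : A w -> `|cre (y (F w))| <= 2 * b * k * e + cabs (y x).
  move=> Aw; apply: le_trans (cre_le_cabs _) _.
  rewrite -(subrK x (F w)) dualD //; apply: le_trans (cabsD _ _) _.
  by rewrite lerD2r Fd.
have zre : cre (y z) = k^-1 * wint (fun w => cre (y (F w))).
  have E : (fun w => cre (y (F w) * cst (1 : C) w)) = fun w => cre (y (F w)).
    by apply/funext => w; rewrite mulr1.
  have := @cre_Hint_bump (fun w => y (F w)) (cst 1) (2 * b * k * e + cabs (y x)).
  rewrite E -zE // => -> //; first exact: mAD.
  by move=> w Aw; rewrite mulr1; exact: byF.
have H1 : `|wint (fun w => cre (y (F w))) - cre (y x) * mu| <= 2 * b * k * e * mu.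
  rewrite -wint_cst -(wintB (mAD myF) byF _ (B' := `|cre (y x)|)) //.
  apply: wint_norm.
    by apply: measurable_funB => //; exact: mAD.
  move=> w Aw; rewrite /= -creN -creD -dualN // -dualD //.
  by apply: le_trans (cre_le_cabs _) (Fd w Aw).
have [mGx _] := cmGx x.
have bGx w : A w -> `|cre (G w x * m w)| <= b * nX x.
  by move=> Aw; apply: le_trans (cre_le_cabs _) (Gx' _ _ Aw).
have H2 : cre (y x) = k^-1 * wint (fun w => cre (G w x * m w)).
  by rewrite yE (cre_Hint_bump (mAD mGx) bGx).
have cmp : cmeasurable D (fun w => G w (F w) * m w).
  by apply: cmM => //; exact: cmeasurable_pairing.
have pE w : A w -> cre (G w (F w) * m w) = cabs (G w (F w)).
  by move=> Aw; rewrite mulrC mGF //; exact: AD.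
have wE : wint (fun w => cabs (G w (F w))) = wint (fun w => cre (G w (F w) * m w)).
  by apply: eq_Rintegral => w /[!inE] Aw; rewrite pE.
have bGF w : A w -> cabs (G w (F w - x) * m w) <= b * e.
  move=> Aw; apply: le_trans (Gx' _ _ Aw) _.
  by rewrite ler_wpM2l ?Fx.
have bp w : A w -> `|cre (G w (F w) * m w)| <= b * e + b * nX x.
  move=> Aw; apply: le_trans (cre_le_cabs _) _.
  rewrite -{1}(subrK x (F w)) dualD ?mulrDl; last exact/XG/AD.
  by apply: le_trans (cabsD _ _) _; rewrite lerD ?bGF ?Gx'.
have [mp _] := cmp.
have H3 : `|wint (fun w => cre (G w (F w) * m w)) - wint (fun w => cre (G w x * m w))| <= b * e * mu.
  rewrite -(wintB (mAD mp) bp (mAD mGx) bGx).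
  apply: wint_norm; first by apply: measurable_funB; exact: mAD.
  move=> w Aw; rewrite -creN -creD -mulNr -mulrDl -dualN; last exact/XG/AD.
  rewrite -dualD; last exact/XG/AD.
  by apply: le_trans (cre_le_cabs _) (bGF w Aw).
have mu0 := mu_ge0.
have [k00|kn0] := eqVneq k 0.
  have mu00 : mu = 0 by rewrite -(sqr_sqrtr mu_ge0) -/k k00 expr0n.
  rewrite wE zre k00 invr0 mul0r mu00 mulr0 addr0.
  have := wint_norm (mAD mp) bp; by rewrite mu00 mulr0 normr_le0 => /eqP ->.
rewrite wE zre.
set P := wint (fun w => cre (y (F w))) in H1 *.
set Q := wint (fun w => cre (G w x * m w)) in H2 H3.
set U := wint (fun w => cre (G w (F w) * m w)) in H3 *.
have E1 : k^-1 * P >= k^-1 * (cre (y x) * mu - 2 * b * k * e * mu).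
  rewrite ler_wpM2l ?invr_ge0 //; move: H1; rewrite ler_norml => /andP[].
  lra.
have E2 : k^-1 * (cre (y x) * mu - 2 * b * k * e * mu) = Q - 2 * b * e * mu.
  rewrite H2; have -> : k^-1 * (k^-1 * Q * mu - 2 * b * k * e * mu) =
    k^-1 * (k^-1 * mu) * Q - 2 * b * k * e * (k^-1 * mu) by ring.
  rewrite kmu mulVf // mul1r; congr (_ - _).
  by rewrite -[in RHS](sqr_sqrtr mu0) -/k; ring.
move: H3; rewrite ler_norml => /andP[_ H3].
rewrite E2 in E1; lra.
Qed.

End Piece.

Section TraceInequality.
Context {R : realType} (n : nat).
Local Notation C := R[i].
Local Notation T := (n.+1.-tuple R).
Variable lam1 : {measure set T -> \bar R}.
Local Notation D := (@uhs R n).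
Variable X : normedModType C.
Local Notation nX := (@Xnorm R X).
Local Notation nX' := (@Xdual_norm R X).
Local Notation X' := (@is_Xdual R X).
Variables (F : T -> X) (G : T -> X -> C).

Let p w := G w (F w).

Definition phase (q : C) : C := cconj q * rc (cabs q)^-1.

Lemma phaseM q : phase q * q = rc (cabs q).
Proof.
rewrite /phase mulrAC [cconj q * q]mulrC mul_cconj -rcM; congr rc.
by have [->|q0] := eqVneq (cabs q) 0; [rewrite invr0 mulr0|rewrite expr2 mulfK].
Qed.

Lemma cabs_phase q : cabs (phase q) <= 1.
Proof.
rewrite /phase cabsM cabs_cconj cabs_rc ger0_norm ?invr_ge0 ?cabs_ge0 //.
by have [->|q0] := eqVneq (cabs q) 0; [rewrite mul0r ler01|rewrite divff].
Qed.

(** The form as a real power gives measurability of the inverse modulus at once, zeros of [q]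
    included. *)
Lemma cabs_powR (q : C) : (cabs q)^-1 = (cre q ^+ 2 + cim q ^+ 2) `^ (- 2^-1).
Proof. by rewrite powRN powR12_sqrt // addr_ge0 ?sqr_ge0. Qed.

Lemma cmeasurable_phase d' (T' : measurableType d') (E : set T') (q : T' -> C) :
  cmeasurable E q -> cmeasurable E (fun w => phase (q w)).
Proof.
move=> [q1 q2].
have mi : measurable_fun E (fun w => (cabs (q w))^-1).
  under eq_fun do rewrite cabs_powR.
  apply: (measurableT_comp (measurable_powR _)).
  by apply: measurable_funD; exact: measurable_funX.
split.
  rewrite (_ : _ \o _ = fun w => (cabs (q w))^-1 * cre (q w)).
    exact: measurable_funM.
  by apply/funext => w; rewrite /comp /phase [cconj _ * _]mulrC cre_rcM.
rewrite (_ : _ \o _ = fun w => - ((cabs (q w))^-1 * cim (q w))).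
  by apply: measurableT_comp => //; exact: measurable_funM.
by apply/funext => w; rewrite /comp /phase [cconj _ * _]mulrC cim_rcM /= mulrN.
Qed.

Hypothesis mF : strongly_measurable setT nX D F.
Hypothesis mG : strongly_measurable X' nX' D G.

Let cmp : cmeasurable D p. Proof. exact: cmeasurable_pairing. Qed.

Lemma measurable_cabs_pairing : measurable_fun D (fun w => cabs (p w)).
Proof.
have [p1 p2] := cmp.
rewrite (_ : (fun w => _) = fun w => (cre (p w) ^+ 2 + cim (p w) ^+ 2) `^ 2^-1).
  apply: (measurableT_comp (measurable_powR _)).
  by apply: measurable_funD; exact: measurable_funX.
by apply/funext => w; rewrite powR12_sqrt // addr_ge0 ?sqr_ge0.
Qed.

Variables (v v' : R).
Hypothesis hF : gamma_rep lam1 setT nX F v.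
Hypothesis hG : gamma_rep lam1 X' nX' G v'.

Lemma orthogonal_bumps (A : nat -> set T) (mu : nat -> R) (m : T -> C) :
  (forall i, measurable (A i)) -> (forall i, A i `<=` D) -> trivIset setT A ->
  (forall i, \int[lam1]_(w in A i) (wt w)%:E = (mu i)%:E)%E ->
  cmeasurable D m -> (forall w, D w -> cabs (m w) <= 1) ->
  orthogonal_contraction lam1 (fun i => bump (A i) (mu i) m).
Proof.
move=> mA AD tA muE mm m1; split.
- by move=> i; have [] := inH_bump (mA i) (AD i) (muE i) mm m1.
- have b0 k w : ~ A k w -> bump (A k) (mu k) m w = 0.
    by move=> Akw; rewrite /bump indicE memNset // mul0r rc0 mulr0.
  move=> i j ij; rewrite /rip /Rintegral integral0_eq // => w Dw.
  have [Aiw|Aiw] := pselect (A i w); last first.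
    by rewrite /kernel b0 //= !mul0r addr0 mul0r.
  have Ajw : ~ A j w.
    by move=> Ajw; move/eqP : ij; apply; apply: (tA i j) => //; exists w.
  by rewrite /kernel (b0 j) //= !mulr0 addr0 mul0r.
- by move=> i; have [] := inH_bump (mA i) (AD i) (muE i) mm m1.
Qed.

(** The set is cut into countably many disjoint pieces on which [F] stays within [e] of a fixed
    vector. Summing [piece_bound] yields the trace estimated in [trace_core] plus an error of at
    most [3 * b * e * nu], which vanishes with [e]. *)
Lemma trace_on_set (A : set T) (nu b s : R) : measurable A -> A `<=` D ->
  (\int[lam1]_(w in A) (wt w)%:E = nu%:E)%E ->
  0 <= b -> (forall w, A w -> nX' (G w) <= b) -> 0 < s ->
  (\int[lam1]_(w in A) (cabs (p w) * wt w)%:E <=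
    (sigma2^-1 * (s * v ^+ 2 + s^-1 * v' ^+ 2))%:E)%E.
Proof.
move=> mA AD nuE b0 Gb s0.
have [Iop [Iop' [SI' IE IE' tr]]] := trace_core hF hG.
have nu0 : 0 <= nu := mu_ge0 AD nuE.
have mwt : measurable_fun A (fun w => (wt w)%:E).
  apply/measurable_EFinP; apply: (measurable_funS _ AD).
    exact: measurable_uhs.
  exact: measurable_wt.
have wt0 w : A w -> (0 <= (wt w)%:E)%E.
  by move=> /AD Dw; rewrite lee_fin ltW // wt_gt0.
have mpw : measurable_fun A (fun w => (cabs (p w) * wt w)%:E).
  apply/measurable_EFinP; apply: measurable_funM; last exact/measurable_EFinP.
  by apply: (measurable_funS _ AD measurable_cabs_pairing); exact: measurable_uhs.
have pw0 w : A w -> (0 <= (cabs (p w) * wt w)%:E)%E.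
  by move=> /AD Dw; rewrite lee_fin mulr_ge0 ?cabs_ge0 // ltW // wt_gt0.
set K := sigma2^-1 * _.
have key e : 0 < e -> (\int[lam1]_(w in A) (cabs (p w) * wt w)%:E <=
    (K + 3 * b * e * nu)%:E)%E.
  move=> e0.
  have [x [_ xd]] := strongly_measurable_dense (seminormed_Xnorm X) mF.
  pose B i := A `&` [set w | nX (F w - x i) < e].
  have mB i : measurable (B i).
    have := strongly_measurable_dist (seminormed_Xnorm X) mF (x := x i) I.
    move=> /(_ (@measurable_uhs R n)) /(_ `]-oo, e[%classic (measurable_itv _)).
    rewrite preimage_itvNyo => mDe.
    rewrite (_ : B i = A `&` (D `&` [set w | nX (F w - x i) < e])).
      exact: measurableI.
    by rewrite setIA (setIidl AD).
  pose Ai i := seqDU B i.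
  have mAi i : measurable (Ai i) by apply: measurableD => //; exact: bigsetU_measurable.
  have tAi : trivIset setT Ai by exact: trivIset_seqDU.
  have AiB i : Ai i `<=` B i by exact: subset_seqDU.
  have AiA i : Ai i `<=` A by move=> w /AiB [].
  have AiD i : Ai i `<=` D by move=> w /AiA /AD.
  have UA : \bigcup_i Ai i = A.
    rewrite -seqDU_bigcup_eq; apply/seteqP; split => [w [i _ []]//|w Aw].
    by have [i xi] := xd w e (AD _ Aw) e0; exists i.
  pose mu i := fine (\int[lam1]_(w in Ai i) (wt w)%:E)%E.
  have muE i : (\int[lam1]_(w in Ai i) (wt w)%:E = (mu i)%:E)%E.
    rewrite /mu fineK // ge0_fin_numE; last first.
      by apply: integral_ge0 => w /AiA; exact: wt0.
    apply: (@le_lt_trans _ _ (\int[lam1]_(w in A) (wt w)%:E)%E).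
      exact: ge0_subset_integral.
    by rewrite nuE ltry.
  pose m w := phase (p w).
  have mm : cmeasurable D m by exact: cmeasurable_phase.
  have m1 w : D w -> cabs (m w) <= 1 by move=> _; exact: cabs_phase.
  have c1 : cmeasurable D (cst 1 : T -> C) by split; exact: measurable_cst.
  have cc1 w : D w -> cabs ((cst 1 : T -> C) w) <= 1 by rewrite /= cabs1.
  have oh := orthogonal_bumps mAi AiD tAi muE c1 cc1.
  have ok := orthogonal_bumps mAi AiD tAi muE mm m1.
  have [Hh _ _] := oh; have [Hk _ _] := ok.
  pose J i := wint lam1 (Ai i) (fun w => cabs (p w)).
  have piece i : J i <= cre (Iop' (bump (Ai i) (mu i) m) (Iop (bump (Ai i) (mu i) (cst 1)))) +
      3 * b * e * mu i.
    have Gb' w : Ai i w -> nX' (G w) <= b by move=> /AiA; exact: Gb.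
    have Fx w : Ai i w -> nX (F w - x i) <= e by move=> /AiB [_ /ltW].
    have mp w : D w -> m w * G w (F w) = rc (cabs (G w (F w))) by move=> _; exact: phaseM.
    have Y := SI' _ (Hk i).
    have zE y' : X' y' -> y' (Iop (bump (Ai i) (mu i) (cst 1))) =
        Hint lam1 (fun w => y' (F w) * bump (Ai i) (mu i) (cst 1) w).
      by move=> Yy'; apply: IE => //; exact: Hh.
    have yE x' := IE' _ x' (Hk i).
    exact: (piece_bound (mAi i) (AiD i) (muE i) mm m1 mF mG b0 Gb' Fx mp Y zE yE).
  have JE i : (\int[lam1]_(w in Ai i) (cabs (p w) * wt w)%:E = (J i)%:E)%E.
    rewrite /J /wint /Rintegral fineK //.
    apply: (integrable_fin_num (mAi i)).
    apply: (integrable_wint (mAi i) (AiD i) (muE i) (B := b * (nX (x i) + e))).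
      by apply: (measurable_funS _ (AiD i) measurable_cabs_pairing); exact: measurable_uhs.
    move=> w Aw; rewrite ger0_norm ?cabs_ge0 //.
    have XG : X' (G w) by case: mG => + _; apply; exact: AiD Aw.
    apply: le_trans (dual_norm_le _ XG) _.
    apply: ler_pM; rewrite ?dual_norm_ge0 ?Xnorm_ge0 ?Gb //; first exact: AiA Aw.
    have [_ /= /ltW H] := AiB i w Aw.
    rewrite -(subrK (x i) (F w)) addrC.
    by apply: le_trans (nZD (seminormed_Xnorm X) I I) _; rewrite lerD2l.
  have sum_mu N : \sum_(i < N) mu i <= nu.
    rewrite -lee_fin -nuE -UA ge0_integral_bigcup //; last 2 first.
    - by rewrite UA.
    - by move=> w; rewrite UA; exact: wt0.
    rewrite -sumEFin; under eq_bigr do rewrite -muE.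
    rewrite -(big_mkord xpredT (fun i => \int[lam1]_(w in Ai i) (wt w)%:E)%E).
    apply: nneseries_lim_ge => i _ _; apply: integral_ge0 => w /AiA; exact: wt0.
  rewrite -[X in (\int[lam1]_(w in X) _)%E]UA ge0_integral_bigcup //; last 2 first.
  - by rewrite UA.
  - by move=> w; rewrite UA; exact: pw0.
  apply: lime_le.
    by apply: is_cvg_nneseries => i _ _; apply: integral_ge0 => w /AiA; exact: pw0.
  apply: nearW => N; rewrite big_mkord; under eq_bigr do rewrite JE.
  rewrite sumEFin lee_fin.
  have sg := @sigma2_gt0 R.
  apply: (@le_trans _ _ (\sum_(i < N) (cre (Iop' (bump (Ai i) (mu i) m)
      (Iop (bump (Ai i) (mu i) (cst 1)))) + 3 * b * e * mu i))).
    by apply: ler_sum => i _; exact: piece.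
  rewrite big_split /= lerD //.
    have := tr _ _ N s oh ok s0; rewrite /K mulrC -ler_pdivlMr // => H.
    by rewrite mulrC.
  rewrite -mulr_sumr; apply: ler_wpM2l; last exact: sum_mu.
  by apply: mulr_ge0; [exact: mulr_ge0|exact: ltW].
apply/lee_addgt0Pr => e e0.
pose c := 3 * b * nu + 1; have c0 : 0 < c by rewrite /c ltr_wpDl // mulr_ge0 // mulr_ge0.
apply: le_trans (key (e / c) _) _; first by rewrite divr_gt0.
rewrite -EFinD lee_fin lerD2l.
have -> : 3 * b * (e / c) * nu = e * (3 * b * nu / c) by ring.
rewrite -[leRHS]mulr1 ler_wpM2l ?(ltW e0) // ler_pdivrMr // mul1r.
by rewrite /c lerDl.
Qed.

End TraceInequality.

(** The minimum over [s] is at [s = b / a], where both terms equal [a * b]. Adding [e] to [a] and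
    [b] keeps the quotient positive and defined when one of them is zero. *)
Lemma le_optimize {R : realType} (x : \bar R) (k a b : R) : 0 <= k -> 0 <= a -> 0 <= b ->
  (forall s, 0 < s -> (x <= (k * (s * a ^+ 2 + s^-1 * b ^+ 2))%:E)%E) ->
  (x <= (k * (2 * (a * b)))%:E)%E.
Proof.
move=> k0 a0 b0 H; pose K := k * (a + b) + 1.
have K0 : 0 < K by rewrite ltr_wpDl // mulr_ge0 ?addr_ge0.
apply/lee_addgt0Pr => e' e'0; pose e := e' / K.
have e0 : 0 < e by rewrite divr_gt0.
have ae : 0 < a + e by rewrite ltr_wpDl.
have be : 0 < b + e by rewrite ltr_wpDl.
apply: le_trans (H ((b + e) / (a + e)) _) _; first by rewrite divr_gt0.
rewrite -EFinD lee_fin invf_div.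
have H1 : (b + e) / (a + e) * a ^+ 2 <= (b + e) * a.
  rewrite mulrAC ler_pdivrMr // expr2.
  by have := mulr_ge0 (mulr_ge0 (ltW be) a0) (ltW e0); lra.
have H2 : (a + e) / (b + e) * b ^+ 2 <= (a + e) * b.
  rewrite mulrAC ler_pdivrMr // expr2.
  by have := mulr_ge0 (mulr_ge0 (ltW ae) b0) (ltW e0); lra.
have eK : e * K = e' by rewrite /e divfK // gt_eqF.
have E : k * ((b + e) * a + (a + e) * b) = k * (2 * (a * b)) + e * (K - 1).
  by rewrite /K; ring.
apply: (@le_trans _ _ (k * ((b + e) * a + (a + e) * b))).
  by rewrite ler_wpM2l // lerD.
by rewrite E lerD2l mulrBr mulr1 eK gerBl ltW.
Qed.

Section LebesgueCubes.
Context {R : realType} (n : nat).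
Variable lam : {measure set (n.-tuple R) -> \bar R}.
Hypothesis hlam : is_lebesgue_n lam.

Definition cube (b : nat) : set (n.-tuple R) := box (fun _ => `](- b%:R), b%:R]%classic).

Lemma measurable_cube b : measurable (cube b).
Proof. by apply: measurable_box => j; exact: measurable_itv. Qed.

Lemma cubeE b x : cube b x <-> forall i, - b%:R < tnth x i <= b%:R.
Proof. by split=> H i; move: (H i); rewrite /= in_itv. Qed.

Lemma near_cube x : \forall b \near \oo, cube b x.
Proof.
pose m := \sum_(i < n) `|tnth x i|.
exists (Num.truncn m).+1 => // b /= mb; apply/cubeE => i.
have im : `|tnth x i| <= m.
  by rewrite /m (bigD1 i) //= lerDl; apply: sumr_ge0 => j _.
have : `|tnth x i| < b%:R.
  apply: le_lt_trans im _; apply: lt_le_trans (truncnS_gt m) _.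
  by rewrite ler_nat.
by rewrite ltr_norml => /andP[-> /ltW].
Qed.

Lemma lebesgue_cube b : (lam (cube b) < +oo)%E.
Proof.
have := hlam (a := nseq_tuple n (- b%:R)) (b := nseq_tuple n b%:R) _.
have -> : [set x | forall i, tnth (nseq_tuple n (- b%:R)) i < tnth x i <= tnth (nseq_tuple n b%:R) i]
    = cube b.
  apply/seteqP; split => x /= H.
    by apply/cubeE => i; have := H i; rewrite !tnth_nseq.
  by move=> i; rewrite !tnth_nseq; move/cubeE : H.
by move=> ->; [rewrite ltry|move=> i; rewrite !tnth_nseq; have := ler0n R b; lra].
Qed.

Lemma lebesgue_sigma_finite : sigma_finite setT lam.
Proof.
exists cube; last by move=> b; split; [exact: measurable_cube|exact: lebesgue_cube].
apply/seteqP; split => // x _; have [b _ H] := near_cube x.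
exists b => //; exact: (H b (leqnn b)).
Qed.

End LebesgueCubes.

Section TraceInequality.
Context {R : realType} (n : nat).
Local Notation C := R[i].
Local Notation T := (n.+1.-tuple R).
Variable lam1 : {measure set T -> \bar R}.
Hypothesis hlam1 : is_lebesgue_n lam1.
Local Notation D := (@uhs R n).
Variable X : normedModType C.
Local Notation nX := (@Xnorm R X).
Local Notation nX' := (@Xdual_norm R X).
Local Notation X' := (@is_Xdual R X).

Lemma gamma_value_ge0 (Z : lmodType C) (S : set Z) (nZ : Z -> R) Phi v :
  gamma_value S nZ lam1 Phi v -> 0 <= v.
Proof.
move=> [_ [_ [Iop [e [_ [_ [dO [Om [P [g [_ [_ cv]]]]]]]]]]]].
have <- := cvg_lim (@Rhausdorff R) cv.
apply: limr_ge; first by apply/cvg_ex; exists v.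
by apply: nearW => N; exact: sqrtr_ge0.
Qed.

Lemma gamma_value_functional (Z : lmodType C) (S : set Z) (nZ : Z -> R) Phi v phi c :
  seminormed S nZ -> gamma_value S nZ lam1 Phi v -> is_dual S nZ phi -> 0 <= c ->
  (forall z, S z -> cabs (phi z) <= c * nZ z) ->
  (\int[lam1]_(w in D) (cabs (phi (Phi w)) ^+ 2 * wt w)%:E <=
    (2 * sigma2^-1 * c ^+ 2 * v ^+ 2)%:E)%E.
Proof.
move=> sn gv dphi c0 phic; have wk := gv.2.1 phi dphi.
have H := gamma_rep_functional sn (gamma_valueP sn gv) dphi c0 phic.
have Hc := inH_conjf wk.
have -> : (\int[lam1]_(w in D) (cabs (phi (Phi w)) ^+ 2 * wt w)%:E =
    Hnorm2 lam1 (conjf (phi \o Phi)))%E.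
  by apply: eq_integral => w _; rewrite /conjf cabs_cconj.
rewrite (rip_Hnorm2 Hc) lee_fin.
have -> : 2 * sigma2^-1 * c ^+ 2 * v ^+ 2 = (2 * c ^+ 2 * v ^+ 2) / sigma2 :> R by ring.
by rewrite ler_pdivlMr ?sigma2_gt0 // mulrC.
Qed.

Variables (F : T -> X) (G : T -> X -> C).
Let p w := G w (F w).

(** The half space is exhausted by bounded sets that stay at height at least [b.+1%:R^-1] and on
    which [G] is bounded. They have finite weighted measure, so [trace_on_set] applies, and Fatou's
    lemma passes to the limit. *)
Lemma trace_param v v' s :
  strongly_measurable setT nX D F -> strongly_measurable X' nX' D G ->
  gamma_rep lam1 setT nX F v -> gamma_rep lam1 X' nX' G v' -> 0 < s ->
  (\int[lam1]_(w in D) (cabs (p w) * wt w)%:E <=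
    (sigma2^-1 * (s * v ^+ 2 + s^-1 * v' ^+ 2))%:E)%E.
Proof.
move=> mF mG hF hG s0.
pose B b := [set w : T | nX' (G w) <= b%:R].
pose H b := [set w : T | b.+1%:R^-1 <= ht w].
pose A b := (D `&` B b) `&` (cube b `&` H b).
have mD : measurable D := @measurable_uhs R n.
have mDB b : measurable (D `&` B b).
  have := strongly_measurable_norm (seminormed_dual X) mG.
  move=> /(_ mD) /(_ `]-oo, b%:R]%classic (measurable_itv _)).
  by rewrite preimage_itvNyc.
have mH b : measurable (H b).
  have := @measurable_ht R n measurableT `[b.+1%:R^-1, +oo[%classic (measurable_itv _).
  by rewrite setTI preimage_itvcy.
have mA b : measurable (A b).
  apply: measurableI => //; apply: measurableI => //; exact: measurable_cube.
have AD b : A b `<=` D by move=> w [[]].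
have mwt : measurable_fun D (fun w => (wt w)%:E).
  by apply/measurable_EFinP; exact: measurable_wt.
have mpw : measurable_fun D (fun w => (cabs (p w) * wt w)%:E).
  apply/measurable_EFinP; apply: measurable_funM; last exact/measurable_EFinP.
  exact: measurable_cabs_pairing.
have pw0 w : D w -> (0 <= (cabs (p w) * wt w)%:E)%E.
  by move=> Dw; rewrite lee_fin mulr_ge0 ?cabs_ge0 // ltW // wt_gt0.
have wt_fin b : (\int[lam1]_(w in A b) (wt w)%:E < +oo)%E.
  apply: (@le_lt_trans _ _ (\int[lam1]_(w in A b) (b.+1%:R ^+ n.+1)%:E)%E).
    apply: ge0_le_lower_integral => w [[Dw _] [_ Hw]].
      by rewrite lee_fin ltW // wt_gt0.
    rewrite lee_fin /wt -[leRHS]invrK lef_pV2 ?posrE ?exprn_gt0 ?invr_gt0 ?exprn_gt0 ?ltr0n //.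
    by rewrite -exprVn lerXn2r // nnegrE ?invr_ge0 // ltW.
  rewrite integral_cst // lte_mul_pinfty ?lee_fin ?exprn_ge0 //.
  apply: le_lt_trans (lebesgue_cube hlam1 b); apply: le_measure; rewrite ?inE //.
    exact: measurable_cube.
  by move=> w [_ []].
apply: (@fatou_le _ _ _ _ D
  (fun b => (fun w => (cabs (p w) * wt w)%:E) \_ (A b))) => //.
- move=> b; apply/measurable_restrict => //.
  by apply: (measurable_funS mD _ mpw) => w [].
- by move=> b w Dw; rewrite /patch; case: ifP => // _; exact: pw0.
- move=> w Dw; apply: cvg_near_cst.
  have h0 : 0 < ht w by exact: Dw.
  have Bw : \forall b \near \oo, B b w.
    exists (Num.truncn (nX' (G w))).+1 => // b /= bw; rewrite /B /=.
    by apply: ltW; apply: lt_le_trans (truncnS_gt _) _; rewrite ler_nat.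
  have Hw : \forall b \near \oo, H b w.
    exists (Num.truncn (ht w)^-1).+1 => // b /= bw; rewrite /H /=.
    rewrite -[leRHS]invrK lef_pV2 ?posrE ?invr_gt0 ?ltr0n //.
    apply: ltW; apply: lt_trans (_ : b%:R < _); last by rewrite ltr_nat.
    by apply: lt_le_trans (truncnS_gt _) _; rewrite ler_nat.
  near=> b; rewrite /patch mem_set //; split; split => //; near: b => //.
  exact: near_cube.
- move=> b; rewrite -integral_mkcondr setIidr //.
  apply: (@trace_on_set _ _ _ _ F G mF mG v v' hF hG (A b)
    (fine (\int[lam1]_(w in A b) (wt w)%:E)%E) b%:R s) => //.
    rewrite fineK // ge0_fin_numE //; apply: integral_ge0 => w /AD Dw.
    by rewrite lee_fin ltW // wt_gt0.
  by move=> w [[_ +] _].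
Unshelve. all: by end_near. Qed.

Lemma trace_inequality v v' :
  gamma_value setT nX lam1 F v -> gamma_value X' nX' lam1 G v' ->
  (\int[lam1]_(w in D) (cabs (p w) * wt w)%:E <= (sigma2^-1 * (2 * (v * v')))%:E)%E.
Proof.
move=> gF gG; apply: le_optimize.
- by rewrite invr_ge0 ltW // sigma2_gt0.
- exact: gamma_value_ge0 gF.
- exact: gamma_value_ge0 gG.
move=> s s0; apply: trace_param s0; [exact: gF.1|exact: gG.1|..].
  exact: (gamma_valueP (seminormed_Xnorm X) gF).
exact: (gamma_valueP (seminormed_dual X) gG).
Qed.

End TraceInequality.

(** * Balls and the lower semicontinuous envelope *)

(* [edist] alone would be the extended distance of the analysis library. *)
Local Notation edist := Defs.edist.

Section Euclid.
Context {R : realType} (n : nat).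
Implicit Types x y z : n.-tuple R.

Lemma edist_ge0 x y : 0 <= edist x y. Proof. exact: sqrtr_ge0. Qed.

Lemma sqr_edist x y : edist x y ^+ 2 = \sum_(i < n) (tnth x i - tnth y i) ^+ 2.
Proof. by rewrite sqr_sqrtr // sumr_ge0 // => i _; exact: sqr_ge0. Qed.

Lemma edistC x y : edist x y = edist y x.
Proof.
by rewrite /edist; congr Num.sqrt; apply: eq_bigr => i _; rewrite -sqrrN opprB.
Qed.

Lemma edistxx x : edist x x = 0.
Proof. by rewrite /edist big1 ?sqrtr0 // => i _; rewrite subrr expr2 mul0r. Qed.

(** The Cauchy-Schwarz inequality behind it is [2 u v <= s u^2 + v^2 / s], summed over the
    coordinates and optimised in [s]. *)
Lemma edist_triangle x y z : edist x z <= edist x y + edist y z.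
Proof.
rewrite -ler_sqr ?nnegrE ?addr_ge0 ?edist_ge0 //.
pose u i := tnth x i - tnth y i; pose v i := tnth y i - tnth z i.
suff H : \sum_(i < n) 2 * (u i * v i) <= 1 * (2 * (edist x y * edist y z)).
  have -> : edist x z ^+ 2 =
      edist x y ^+ 2 + \sum_(i < n) 2 * (u i * v i) + edist y z ^+ 2.
    rewrite !sqr_edist -!big_split /=; apply: eq_bigr => i _; rewrite /u /v; ring.
  by rewrite sqrrD lerD2r lerD2l; apply: le_trans H _; lra.
rewrite -lee_fin; apply: le_optimize; rewrite ?edist_ge0 // => s s0.
rewrite lee_fin mul1r !sqr_edist !mulr_sumr -big_split /=; apply: ler_sum => i _.
rewrite -/(u i) -/(v i) -subr_ge0.
have -> : s * u i ^+ 2 + s^-1 * v i ^+ 2 - 2 * (u i * v i) = s^-1 * (s * u i - v i) ^+ 2.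
  by field; rewrite gt_eqF.
by rewrite mulr_ge0 ?sqr_ge0 // invr_ge0 ltW.
Qed.

Lemma coord_edist x y i : `|tnth x i - tnth y i| <= edist x y.
Proof.
rewrite -sqrtr_sqr ler_sqrt; last by apply: sumr_ge0 => j _; exact: sqr_ge0.
by rewrite (bigD1 i) //= lerDl; apply: sumr_ge0 => j _; exact: sqr_ge0.
Qed.

(* the factor [n.+1] rather than [sqrt n] also serves [n = 0] *)
Lemma edist_lt_coord x y s : 0 < s -> (forall i, `|tnth x i - tnth y i| <= s) ->
  edist x y < n.+1%:R * s.
Proof.
move=> s0 H; rewrite -(ltr_pXn2r (n := 2)) ?nnegrE ?edist_ge0 ?mulr_ge0 ?(ltW s0) //.
rewrite sqr_edist; apply: (@le_lt_trans _ _ (\sum_(i < n) s ^+ 2)).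
  apply: ler_sum => i _; rewrite -real_normK ?num_real // lerXn2r ?nnegrE //.
  exact: ltW.
rewrite sumr_const card_ord -[X in X < _]mulr_natl exprMn ltr_pM2r ?exprn_gt0 //.
by rewrite -natrX ltr_nat; rewrite expnS expn1 leq_pmulr.
Qed.

End Euclid.

Section BallVolume.
Context {R : realType} (n : nat).
Variable lam : {measure set (n.-tuple R) -> \bar R}.
Hypothesis hlam : is_lebesgue_n lam.
Implicit Types (x c : n.-tuple R) (r s : R).

Definition sbox c s : set (n.-tuple R) :=
  [set x | forall i, tnth c i - s < tnth x i <= tnth c i + s].

Lemma measurable_sbox c s : measurable (sbox c s).
Proof.
rewrite (_ : sbox c s = \bigcap_(i in [set: 'I_n])
    ((@tnth n R)^~ i @^-1` `]tnth c i - s, tnth c i + s]%classic)).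
  apply: fin_bigcap_measurable => // i _; rewrite -[X in measurable X]setTI.
  by apply: measurable_tnth => //; exact: measurable_itv.
apply/seteqP; split => x /= H i; first by move=> _; rewrite /= in_itv; exact: H.
by have := H i I; rewrite /= in_itv.
Qed.

Lemma lebesgue_sbox c s : 0 <= s -> lam (sbox c s) = ((2 * s) ^+ n)%:E.
Proof.
move=> s0.
pose a := [tuple tnth c i - s | i < n]; pose b := [tuple tnth c i + s | i < n].
have := hlam (a := a) (b := b) _.
have -> : [set x | forall i, tnth a i < tnth x i <= tnth b i] = sbox c s.
  by apply/seteqP; split => x H i; move: (H i); rewrite !tnth_mktuple.
move=> ->; last by move=> i; rewrite !tnth_mktuple; lra.
congr EFin; rewrite (eq_bigr (fun=> 2 * s)); first by rewrite prodr_const card_ord.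
by move=> i _; rewrite !tnth_mktuple; ring.
Qed.

Lemma measurable_edistl c : measurable_fun setT (fun x => edist x c).
Proof.
rewrite (_ : (fun x => _) = fun x => (\sum_(i < n) (tnth x i - tnth c i) ^+ 2) `^ 2^-1).
  apply: (measurableT_comp (measurable_powR _)).
  apply: measurable_sum => i; apply: measurable_funX; apply: measurable_funB => //.
  exact: measurable_tnth.
by apply/funext => x; rewrite powR12_sqrt // sumr_ge0 // => i _; exact: sqr_ge0.
Qed.

Lemma measurable_eball c r : measurable (eball c r).
Proof.
have := measurable_edistl c measurableT (measurable_itv `]-oo, r[).
by rewrite setTI preimage_itvNyo.
Qed.

Lemma eball_le c r : 0 < r -> (lam (eball c r) <= ((2 * r) ^+ n)%:E)%E.
Proof.
move=> r0; rewrite -(lebesgue_sbox c (ltW r0)).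
apply: le_measure; rewrite ?inE; [exact: measurable_eball|exact: measurable_sbox|].
move=> x /= xr i; have := le_lt_trans (coord_edist x c i) xr.
by rewrite ltr_norml => /andP[x1 x2]; apply/andP; split; lra.
Qed.

Lemma eball_ge c r : 0 < r -> (((2 * (r / n.+1%:R)) ^+ n)%:E <= lam (eball c r))%E.
Proof.
move=> r0; have s0 : 0 < r / n.+1%:R by rewrite divr_gt0 // ltr0n.
rewrite -(lebesgue_sbox c (ltW s0)).
apply: le_measure; rewrite ?inE; [exact: measurable_sbox|exact: measurable_eball|].
move=> x /= H; have -> : r = n.+1%:R * (r / n.+1%:R) by rewrite mulrC divfK ?pnatr_eq0.
apply: edist_lt_coord => // i; have := H i.
move: (r / _) => s /andP[x1 x2].
by rewrite ler_norml; apply/andP; split; lra.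
Qed.

Lemma eball_fin c r : (lam (eball c r) < +oo)%E.
Proof.
have [r0|r0] := ltP 0 r; first by apply: le_lt_trans (eball_le c r0) _; rewrite ltry.
rewrite (_ : eball c r = set0) ?measure0 ?ltry //.
apply/seteqP; split => // x /= xr; have := edist_ge0 x c.
by rewrite leNgt (lt_le_trans xr r0).
Qed.

Lemma eball_gt0 c r : 0 < r -> (0 < lam (eball c r))%E.
Proof.
move=> r0; apply: lt_le_trans (eball_ge c r0).
by rewrite lte_fin exprn_gt0 // mulr_gt0 // divr_gt0 // ltr0n.
Qed.

End BallVolume.

Section RationalBalls.
Context {R : realType} (n : nat).
Local Notation V := (n.-tuple R).
Implicit Types (x y : V) (f : V -> \bar R).

(* Codes of no pair give the radius 0, hence the empty ball. *)
Definition rball (m : nat) : V * R :=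
  if unpickle m is Some cr
  then ([tuple ratr (tnth (cr : n.-tuple rat * rat).1 i) | i < n], ratr cr.2)
  else ([tuple 0 | i < n], 0).

Lemma rballP x (d a b : R) : 0 < d -> 0 <= a -> a < b ->
  exists m, edist x (rball m).1 < d /\ a < (rball m).2 < b.
Proof.
move=> d0 a0 ab.
pose s := d / n.+1%:R; have s0 : 0 < s by rewrite divr_gt0 // ltr0n.
have /choice[k kP] : forall i : 'I_n, exists k : rat, `|tnth x i - ratr k| <= s.
  move=> i; have [|k] := @rat_in_itvoo R (tnth x i - s) (tnth x i + s); first lra.
  rewrite in_itv /= => /andP[k1 k2]; exists k.
  by rewrite ler_norml; apply/andP; split; lra.
have [r] := rat_in_itvoo ab; rewrite in_itv /= => rab.
exists (pickle ([tuple k i | i < n], r)).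
rewrite /rball pickleK /=; split=> //.
have -> : d = n.+1%:R * s by rewrite mulrC divfK ?pnatr_eq0.
by apply: edist_lt_coord => // i; rewrite !tnth_mktuple.
Qed.

(** For nonnegative [c] this is the supremum over the rational balls that contain [x]; the
    indicators display it as a countable supremum of measurable functions. *)
Definition rat_sup (c : nat -> \bar R) x : \bar R :=
  ereal_sup [set (c m * (\1_(eball (rball m).1 (rball m).2) x)%:E)%E | m in setT].

Lemma measurable_rat_sup c : measurable_fun setT (rat_sup c).
Proof.
rewrite (_ : rat_sup c = fun x => esups (fun m =>
    (c m * (\1_(eball (rball m).1 (rball m).2) x)%:E)%E) 0).
  apply: measurable_fun_esups => m; apply: measurable_funeM.
  by apply/measurable_EFinP; apply: measurable_indic; exact: measurable_eball.
apply/funext => x; rewrite /rat_sup /esups /=; congr ereal_sup.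
apply/seteqP; split => _ [m _ <-]; by exists m.
Qed.

Lemma rat_sup_ge c x m : edist x (rball m).1 < (rball m).2 -> (c m <= rat_sup c x)%E.
Proof.
move=> xm; apply: ereal_sup_ubound; exists m => //.
by rewrite indicE mem_set // mule1.
Qed.

Lemma rat_sup_le c x (k : \bar R) : (0 <= k)%E ->
  (forall m, edist x (rball m).1 < (rball m).2 -> (c m <= k)%E) -> (rat_sup c x <= k)%E.
Proof.
move=> k0 H; apply: ge_ereal_sup => _ [m _ <-].
rewrite indicE; have [xm|xm] := pselect (eball (rball m).1 (rball m).2 x).
  by rewrite mem_set // mule1; exact: H.
by rewrite memNset // mule0.
Qed.

Lemma rat_sup_ge0 c x : (forall m, 0 <= c m)%E -> (0 <= rat_sup c x)%E.
Proof.
move=> c0; apply: ereal_sup_ge; exists (c 0%N * (\1_(eball (rball 0).1 (rball 0).2) x)%:E)%E.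
  by exists 0%N.
by rewrite mule_ge0 // lee_fin.
Qed.

Definition lsc_env f : V -> \bar R :=
  rat_sup (fun m => ereal_inf (f @` eball (rball m).1 (rball m).2)).

Lemma measurable_lsc_env f : measurable_fun setT (lsc_env f).
Proof. exact: measurable_rat_sup. Qed.

Lemma lsc_env_ge0 f x : (forall y, 0 <= f y)%E -> (0 <= lsc_env f x)%E.
Proof.
by move=> f0; apply: rat_sup_ge0 => m; apply: le_ereal_inf_tmp => _ [y _ <-].
Qed.

Lemma lsc_env_le f x : (forall y, 0 <= f y)%E -> (lsc_env f x <= f x)%E.
Proof.
move=> f0; apply: rat_sup_le => // m xm.
by apply: ereal_inf_lbound; exists x.
Qed.

Lemma lsc_env_lt f x (a d : R) : 0 < d -> (lsc_env f x < a%:E)%E ->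
  exists y, edist y x < d /\ (f y < a%:E)%E.
Proof.
move=> d0 fa.
have d20 : 0 < d / 2 by rewrite divr_gt0.
have d40 : 0 < d / 4 by rewrite divr_gt0.
have d42 : d / 4 < d / 2 by lra.
(* A radius between [d / 4] and [d / 2] around a centre closer than [d / 4] gives a ball that
   contains [x] and stays within distance [d] of it. *)
have [m [xm /andP[m1 m2]]] := rballP x d40 (ltW d40) d42.
have /ereal_inf_lt[_ [y /= ym <-] fy] :
    (ereal_inf (f @` eball (rball m).1 (rball m).2) < a%:E)%E.
  by apply: le_lt_trans fa; apply: rat_sup_ge; exact: lt_trans m1.
exists y; split=> //.
apply: le_lt_trans (edist_triangle y (rball m).1 x) _.
rewrite (edistC _ x); have : edist y (rball m).1 < (rball m).2 by exact: ym.
lra.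
Qed.

End RationalBalls.
(** * The pairing on truncated cones *)

Lemma le_mul_gt {R : realType} (x : \bar R) (k a : R) : 0 <= k ->
  (forall b, a < b -> (x <= (k * b)%:E)%E) -> (x <= (k * a)%:E)%E.
Proof.
move=> k0 H; apply/lee_addgt0Pr => e e0.
have K0 : 0 < k + 1 by rewrite ltr_wpDl.
apply: le_trans (H (a + e / (k + 1)) _) _; first by rewrite ltrDl divr_gt0.
rewrite -EFinD lee_fin mulrDr lerD2l mulrCA ler_piMr ?(ltW e0) //.
by rewrite ler_pdivrMr // mul1r lerDl.
Qed.

Section Cones.
Context {R : realType} (n : nat).
Local Notation T := (n.+1.-tuple R).
Local Notation V := (n.-tuple R).
Local Notation D := (@uhs R n).
Implicit Types (x : V) (h : R) (w : T).

Lemma measurable_edist_hy : measurable_fun setT (fun wx : T * V => edist (hy wx.1) wx.2).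
Proof.
rewrite (_ : (fun _ => _) = fun wx : T * V =>
    (\sum_(i < n) (tnth wx.1 (inord i.+1) - tnth wx.2 i) ^+ 2) `^ 2^-1).
  apply: (measurableT_comp (measurable_powR _)).
  apply: measurable_sum => i; apply: measurable_funX; apply: measurable_funB.
    by apply: (measurableT_comp (measurable_tnth _)); exact: measurable_fst.
  by apply: (measurableT_comp (measurable_tnth _)); exact: measurable_snd.
apply/funext => wx; rewrite powR12_sqrt ?sumr_ge0 // => [|i _]; last exact: sqr_ge0.
by rewrite /edist; congr Num.sqrt; apply: eq_bigr => i _; rewrite tnth_behead.
Qed.

Lemma measurable_cone_rel :
  measurable [set wx : T * V | D wx.1 /\ edist (hy wx.1) wx.2 < ht wx.1].
Proof.
have mht : measurable_fun setT (fun wx : T * V => ht wx.1).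
  by apply: measurableT_comp; [exact: measurable_ht|exact: measurable_fst].
have m1 : measurable_fun setT (fun wx : T * V => ht wx.1 - edist (hy wx.1) wx.2).
  by apply: measurable_funB => //; exact: measurable_edist_hy.
have M1 := mht measurableT _ (measurable_itv `]0, +oo[).
have M2 := m1 measurableT _ (measurable_itv `]0, +oo[).
have := measurableI _ _ M1 M2; rewrite !setTI !preimage_itvoy.
by congr measurable; apply/seteqP; split => -[w x] /= [H1 H2]; split=> //;
  move: H2; rewrite subr_gt0.
Qed.

Lemma measurable_cone x : measurable (cone x).
Proof.
have := measurable_ysection x measurable_cone_rel.
congr measurable; apply/seteqP; split => w; rewrite /ysection /= inE //=.
Qed.

Lemma measurable_cone_h x h : measurable (cone_h x h).
Proof.
have := @measurable_ht R n measurableT `]-oo, h[%classic (measurable_itv _).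
rewrite setTI preimage_itvNyo => mh.
exact: measurableI (measurable_cone x) mh.
Qed.

Lemma cone_sub_uhs x : cone x `<=` D. Proof. by move=> w []. Qed.
Variable lam1 : {measure set T -> \bar R}.

(** The cone is defined by a strict inequality, so each of its points lies in the cones at all
    sufficiently close vertices. Along vertices tending to [x] the truncations of [f] thus converge
    pointwise on [cone_h x h]. *)
Lemma cone_fatou (f : T -> \bar R) (c : \bar R) x h :
  measurable_fun D f -> (forall w, D w -> 0 <= f w)%E ->
  (forall d : R, 0 < d -> exists x', edist x' x < d /\
    (\int[lam1]_(w in cone_h x' h `&` cone x) f w <= c)%E) ->
  (\int[lam1]_(w in cone_h x h) f w <= c)%E.
Proof.
move=> mf f0 H.
have /choice[u uP] : forall k : nat, exists x', edist x' x < k.+1%:R^-1 /\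
    (\int[lam1]_(w in cone_h x' h `&` cone x) f w <= c)%E.
  by move=> k; apply: H; rewrite invr_gt0 ltr0n.
have cD : cone_h x h `<=` D by move=> w [[]].
have mD : measurable D := @measurable_uhs R n.
apply: (@fatou_le _ _ _ _ (cone_h x h) (fun k => f \_ (cone_h (u k) h))).
- exact: measurable_cone_h.
- move=> k; apply: (measurable_restrict f (measurable_cone_h _ _) (measurable_cone_h _ _)).1.
  by apply: (measurable_funS mD _ mf) => w [/cD].
- by move=> k w /cD Dw; rewrite /patch; case: ifP => // _; exact: f0.
- move=> w [[Dw wx] wh]; apply: cvg_near_cst.
  have g0 : 0 < ht w - edist (hy w) x by rewrite subr_gt0.
  exists (Num.truncn (ht w - edist (hy w) x)^-1).+1 => // k /= kN.
  rewrite /patch mem_set //; split => //; split => //.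
  apply: le_lt_trans (edist_triangle (hy w) x (u k)) _.
  rewrite -ltrBrDl edistC; apply: lt_trans (uP k).1 _.
  rewrite -[ltRHS]invrK ltf_pV2 ?posrE ?invr_gt0 ?ltr0n //.
  apply: lt_le_trans (truncnS_gt _) _; rewrite ler_nat.
  exact: leq_trans kN _.
- move=> k; rewrite -integral_mkcondr; apply: le_trans (uP k).2.
  apply: lower_integral_subset => [w [[cw _] uw]//|w [_ [Dw _]]]; exact: f0.
Qed.

Variable X : normedModType R[i].
Local Notation C := R[i].
Local Notation nX := (@Xnorm R X).
Local Notation nX' := (@Xdual_norm R X).
Local Notation X' := (@is_Xdual R X).

Lemma gamma_norm_ge0 (Z : lmodType C) (S : set Z) (nZ : Z -> R) Phi :
  (0 <= gamma_norm S nZ lam1 Phi)%E.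
Proof.
by apply: le_ereal_inf_tmp => _ [v /gamma_value_ge0 v0 <-]; rewrite lee_fin.
Qed.

Lemma gamma_norm_lt (Z : lmodType C) (S : set Z) (nZ : Z -> R) Phi (a : R) :
  (gamma_norm S nZ lam1 Phi < a%:E)%E ->
  exists v, gamma_value S nZ lam1 Phi v /\ v < a.
Proof. by move=> /ereal_inf_lt[_ [v gv <-]]; rewrite lte_fin; exists v. Qed.

Lemma restr_functional (Z : lmodType C) (S : set Z) (nZ : Z -> R) Phi A v phi c :
  seminormed S nZ -> A `<=` D -> gamma_value S nZ lam1 (restr A Phi) v ->
  is_dual S nZ phi -> 0 <= c -> (forall z, S z -> cabs (phi z) <= c * nZ z) ->
  (\int[lam1]_(w in A) (cabs (phi (Phi w)) ^+ 2 * wt w)%:E <=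
    (2 * sigma2^-1 * c ^+ 2 * v ^+ 2)%:E)%E.
Proof.
move=> sn AD gv dphi c0 phic.
apply: le_trans (gamma_value_functional sn gv dphi c0 phic).
rewrite -(setIidr AD) integral_mkcondr setIidr //; apply: ge0_le_lower_integral => w Dw.
  by rewrite /patch; case: ifP => // _; rewrite lee_fin mulr_ge0 ?sqr_ge0 // ltW // wt_gt0.
rewrite /patch; case: ifPn => [/[!inE] Aw|_].
  by rewrite /restr asboolT.
by rewrite lee_fin mulr_ge0 ?sqr_ge0 // ltW // wt_gt0.
Qed.

Variables (F : T -> X) (G : T -> X -> C).
Hypothesis hlam1 : is_lebesgue_n lam1.
Hypothesis mF : strongly_measurable setT nX D F.
Hypothesis mG : strongly_measurable X' nX' D G.

Local Notation p w := (G w (F w)).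

Definition pairing_density w : \bar R := (cabs (p w) * wt w)%:E.
Local Notation g := pairing_density.

Lemma measurable_pairing_density : measurable_fun D g.
Proof.
apply/measurable_EFinP; apply: measurable_funM; last exact: measurable_wt.
exact: measurable_cabs_pairing.
Qed.

Lemma pairing_density_ge0 w : D w -> (0 <= g w)%E.
Proof. by move=> Dw; rewrite /pairing_density lee_fin mulr_ge0 ?cabs_ge0 // ltW // wt_gt0. Qed.

Lemma trace_restr A B v v' : A `<=` D ->
  gamma_value setT nX lam1 (restr A F) v -> gamma_value X' nX' lam1 (restr B G) v' ->
  (\int[lam1]_(w in A `&` B) g w <= (sigma2^-1 * (2 * (v * v')))%:E)%E.
Proof.
move=> AD gF gG; apply: le_trans (trace_inequality hlam1 gF gG).
have ABD : A `&` B `<=` D by move=> w [/AD].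
rewrite -(setIidr ABD) integral_mkcondr; apply: ge0_le_lower_integral => w Dw.
  by rewrite /patch; case: ifP => // _; exact: pairing_density_ge0.
rewrite /patch; case: ifPn => [/[!inE] [[Aw Bw]]|_].
  by rewrite /restr !asboolT.
by rewrite lee_fin mulr_ge0 ?cabs_ge0 // ltW // wt_gt0.
Qed.

(** A point with nonzero pairing has some [q i w != 0], and each of the countably many [q i] has
    norm zero on [A]. *)
Lemma null_pairing A (q : nat -> T -> C) : measurable A -> A `<=` D ->
  (forall i, cmeasurable D (q i)) ->
  (forall i (e : R), 0 < e -> (\int[lam1]_(w in A) (cabs (q i w) ^+ 2 * wt w)%:E <= e%:E)%E) ->
  (forall w, A w -> (forall i, q i w = 0) -> p w = 0) ->
  (\int[lam1]_(w in A) g w = 0)%E.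
Proof.
move=> mA AD mq q0 pq; have mD : measurable D := @measurable_uhs R n.
pose f i w := (cabs (q i w) ^+ 2 * wt w)%:E.
have f0 i w : A w -> (0 <= f i w)%E.
  by move=> /AD Dw; rewrite lee_fin mulr_ge0 ?sqr_ge0 // ltW // wt_gt0.
have mf i : measurable_fun A (f i).
  apply: (measurable_funS mD AD); apply/measurable_EFinP.
  apply: measurable_funM; last exact: measurable_wt.
  have [q1 q2] := mq i.
  rewrite (_ : (fun w => _) = fun w => cre (q i w) ^+ 2 + cim (q i w) ^+ 2).
    by apply: measurable_funD; exact: measurable_funX.
  by apply/funext => w; rewrite sqr_cabs.
have If i : (\int[lam1]_(w in A) f i w = 0)%E.
  apply/eqP; rewrite eq_le integral_ge0 ?andbT; last exact: f0.
  by apply/lee_addgt0Pr => e e0; rewrite add0e; exact: q0.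
have yf0 i w : A w -> (0 <= +oo * f i w)%E by move=> Aw; rewrite mule_ge0 ?f0.
apply/eqP; rewrite eq_le integral_ge0 ?andbT; last by move=> w /AD; exact: pairing_density_ge0.
(* Infinite weights make the sum a majorant of the pairing density, while the integral of each term
   is still [+oo * 0 = 0]. *)
apply: (@le_trans _ _ (\int[lam1]_(w in A) (\sum_(i <oo) (+oo * f i w)))%E).
  apply: ge0_le_lower_integral => w Aw; first exact: pairing_density_ge0 (AD _ Aw).
  have [/pq|] := pselect (forall i, q i w = 0).
    move=> /(_ Aw) pw; rewrite /pairing_density pw cabs0 mul0r; apply: nneseries_ge0 => i _ _; exact: yf0.
  move=> /existsNP[i /eqP qi].
  apply: (@le_trans _ _ (+oo * f i w)%E).
    rewrite gt0_mulye ?leey // lte_fin mulr_gt0 ?wt_gt0 //; last exact: AD.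
    by rewrite exprn_gt0 // lt_neqAle cabs_ge0 andbT eq_sym; apply: contra qi => /eqP/cabs_eq0 ->.
  rewrite (@nneseriesD1 _ _ i) //; last by move=> k _; exact: yf0.
  by rewrite leeDl // nneseries_ge0 // => k _ _; exact: yf0.
rewrite integral_nneseries //.
- rewrite eseries0 // => i _ _; rewrite ge0_integralZl ?If ?mule0 // => w; exact: f0.
- by move=> i; exact: measurable_funeM.
Qed.

Lemma small_bound (K e : R) : 0 <= K -> 0 < e ->
  exists d, 0 < d /\ forall v, 0 <= v -> v < d -> K * v ^+ 2 <= e.
Proof.
move=> K0 e0; have K1 : 0 < K + 1 by rewrite ltr_wpDl.
exists (Num.min 1 (e / (K + 1))); split; first by rewrite lt_min ltr01 divr_gt0.
move=> v v0; rewrite lt_min => /andP[v1 ve].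
apply: (@le_trans _ _ (K * v)).
  by rewrite ler_wpM2l // expr2 ler_piMr // ltW.
apply: (@le_trans _ _ ((K + 1) * v)); first by rewrite ler_wpM2r // lerDl.
by rewrite mulrC -ler_pdivlMr // ltW.
Qed.

(** For the case where the envelope of [A(F|h)] vanishes at [x]. The [y i] are dense among the
    values of [G]; by the weak estimate at vertices near [x], each function [y i (F w)] has norm
    zero on the cone, and a [y i] close to [G w] transfers this to the pairing. *)
Lemma null_cone_h x h :
  (forall d e : R, 0 < d -> 0 < e -> exists x', edist x' x < d /\
    exists v, gamma_value setT nX lam1 (restr (cone_h x' h) F) v /\ v < e) ->
  (\int[lam1]_(w in cone_h x h) g w = 0)%E.
Proof.
move=> H; have [y [Yy yd]] := strongly_measurable_dense (seminormed_dual X) mG.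
apply: (@null_pairing _ (fun i w => y i (F w))).
- exact: measurable_cone_h.
- by move=> w [[]].
- move=> i; apply: (@cmeasurable_pairing _ _ _ _ _ F (fun _ => y i)) => //.
  apply: strongly_measurable_cst (Yy i); [exact: seminormed_dual|exact: measurable_uhs].
- move=> i e e0.
  have c0 := dual_norm_ge0 (Yy i).
  have K0 : 0 <= 2 * sigma2^-1 * nX' (y i) ^+ 2 :> R.
    by rewrite mulr_ge0 ?sqr_ge0 // mulr_ge0 // invr_ge0 ltW // sigma2_gt0.
  have [d [d0 dP]] := small_bound K0 e0.
  apply: cone_fatou => [|w Dw|r r0].
  + apply/measurable_EFinP; apply: measurable_funM; last exact: measurable_wt.
    apply: measurable_funX; apply: (@measurable_cabs_pairing _ _ _ F (fun _ => y i)) => //.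
    apply: strongly_measurable_cst (Yy i); [exact: seminormed_dual|exact: measurable_uhs].
  + by rewrite lee_fin mulr_ge0 ?sqr_ge0 // ltW // wt_gt0.
  + have [x' [x'x [v [gv vd]]]] := H _ _ r0 d0; exists x'; split=> //.
    have AD : cone_h x' h `<=` D by move=> w [[]].
    apply: (@le_trans _ _ (\int[lam1]_(w in cone_h x' h) (cabs (y i (F w)) ^+ 2 * wt w)%:E)%E).
      apply: lower_integral_subset => [w []//|w /AD Dw].
      by rewrite lee_fin mulr_ge0 ?sqr_ge0 // ltW // wt_gt0.
    apply: le_trans (restr_functional (seminormed_Xnorm X) AD gv (is_dual_Xdual (Yy i)) c0 _) _.
      by move=> z _; exact: dual_norm_le.
    by rewrite lee_fin; apply: dP => //; exact: gamma_value_ge0 gv.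
- move=> w [[Dw _] _] y0; apply: cabs_eq0; apply/eqP; rewrite eq_le cabs_ge0 andbT.
  have XG : X' (G w) by case: mG => + _; apply.
  apply/ler_addgt0Pr => e e0; rewrite add0r.
  have a0 : 0 < nX (F w) + 1 by rewrite ltr_wpDl ?Xnorm_ge0.
  have [i Gi] := yd w (e / (nX (F w) + 1)) Dw (divr_gt0 e0 a0).
  have XGi : X' (G w - y i).
    by rewrite -scaleN1r; apply: is_XdualD => //; apply: is_XdualZ.
  have -> : p w = (G w - y i) (F w).
    have -> : (G w - y i) (F w) = G w (F w) - y i (F w) by [].
    by rewrite y0 subr0.
  apply: le_trans (dual_norm_le _ XGi) _.
  apply: (@le_trans _ _ (e / (nX (F w) + 1) * (nX (F w) + 1))).
    by apply: ler_pM; rewrite ?dual_norm_ge0 ?Xnorm_ge0 ?(ltW Gi) // lerDl.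
  by rewrite divfK // gt_eqF.
Qed.

(** For the case where [A(G)] vanishes at [x]: the tests are now evaluations of [G w] at vectors
    dense among the values of [F], and the vertex [x] itself suffices. *)
Lemma null_cone x :
  (forall e : R, 0 < e ->
    exists v, gamma_value X' nX' lam1 (restr (cone x) G) v /\ v < e) ->
  (\int[lam1]_(w in cone x) g w = 0)%E.
Proof.
move=> H; have [z [_ zd]] := strongly_measurable_dense (seminormed_Xnorm X) mF.
have sz i : strongly_measurable setT nX D (fun _ => z i).
  by apply: strongly_measurable_cst => //; [exact: seminormed_Xnorm|exact: measurable_uhs].
apply: (@null_pairing _ (fun i w => G w (z i))).
- exact: measurable_cone.
- by move=> w [].
- by move=> i; apply: (@cmeasurable_pairing _ _ _ _ _ (fun _ => z i) G).
- move=> i e e0.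
  have K0 : 0 <= 2 * sigma2^-1 * nX (z i) ^+ 2 :> R.
    by rewrite mulr_ge0 ?sqr_ge0 // mulr_ge0 // invr_ge0 ltW // sigma2_gt0.
  have [d [d0 dP]] := small_bound K0 e0; have [v [gv vd]] := H _ d0.
  have AD : cone x `<=` D by exact: cone_sub_uhs.
  apply: le_trans (restr_functional (phi := fun y : X -> C => y (z i))
    (seminormed_dual X) AD gv (is_dual_eval (z i)) (Xnorm_ge0 (z i)) _) _.
    by move=> y Yy; rewrite mulrC; exact: dual_norm_le.
  by rewrite lee_fin; apply: dP => //; exact: gamma_value_ge0 gv.
- move=> w [Dw _] y0; apply: cabs_eq0; apply/eqP; rewrite eq_le cabs_ge0 andbT.
  have XG : X' (G w) by case: mG => + _; apply.
  apply/ler_addgt0Pr => e e0; rewrite add0r.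
  have a0 : 0 < nX' (G w) + 1 by rewrite ltr_wpDl ?dual_norm_ge0.
  have [i Gi] := zd w (e / (nX' (G w) + 1)) Dw (divr_gt0 e0 a0).
  have -> : p w = G w (F w - z i) by rewrite dualB // y0 subr0.
  apply: le_trans (dual_norm_le _ XG) _.
  apply: (@le_trans _ _ ((nX' (G w) + 1) * (e / (nX' (G w) + 1)))).
    by apply: ler_pM; rewrite ?dual_norm_ge0 ?Xnorm_ge0 ?(ltW Gi) // lerDl.
  by rewrite mulrC divfK // gt_eqF.
Qed.

(** For finite positive factors, [F] is estimated on a cone with vertex [x'] near [x] and [G] on the
    cone at [x]; the trace inequality holds on the intersection, and [cone_fatou] lets [x'] tend to
    [x]. A vanishing factor is settled first, since the other one may be infinite. *)
Lemma cone_pairing_le x h :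
  (\int[lam1]_(w in cone_h x h) g w <=
    (sigma2^-1 * 2)%:E * (lsc_env (AXh lam1 F h) x * AXd lam1 G x))%E.
Proof.
have sg := @sigma2_gt0 R.
have K0 : 0 < sigma2^-1 * 2 :> R by rewrite mulr_gt0 // invr_gt0.
set a := lsc_env _ _; set b := AXd _ _ _.
have a0 : (0 <= a)%E by apply: lsc_env_ge0 => y; exact: gamma_norm_ge0.
have b0 : (0 <= b)%E by exact: gamma_norm_ge0.
have a_lt (e r : R) : (a < e%:E)%E -> 0 < r -> exists x', edist x' x < r /\
    exists v, gamma_value setT nX lam1 (restr (cone_h x' h) F) v /\ v < e.
  move=> ae r0; have [x' [x'x fx']] := lsc_env_lt r0 ae.
  by exists x'; split=> //; exact: gamma_norm_lt.
have [a_eq|a_neq] := eqVneq a 0%E.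
  rewrite null_cone_h ?mule_ge0 ?lee_fin ?(ltW K0) // => r e r0 e0.
  by apply: a_lt => //; rewrite a_eq lte_fin.
have a_gt : (0 < a)%E by rewrite lt_neqAle eq_sym a_neq.
have [b_eq|b_neq] := eqVneq b 0%E.
  apply: (@le_trans _ _ (\int[lam1]_(w in cone x) g w)%E).
    by apply: lower_integral_subset => [w []//|w [Dw _]]; exact: pairing_density_ge0.
  rewrite null_cone ?mule_ge0 ?lee_fin ?(ltW K0) // => e e0.
  by apply: gamma_norm_lt; rewrite -/(AXd lam1 G x) -/b b_eq lte_fin.
have b_gt : (0 < b)%E by rewrite lt_neqAle eq_sym b_neq.
have [b_oo|b_fin] := eqVneq b +oo%E.
  by rewrite b_oo gt0_muley // gt0_muley ?lte_fin // leey.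
have [a_oo|a_fin] := eqVneq a +oo%E.
  by rewrite a_oo gt0_mulye // gt0_muley ?lte_fin // leey.
have aE : a = (fine a)%:E by rewrite fineK // ge0_fin_numE // ltey.
have bE : b = (fine b)%:E by rewrite fineK // ge0_fin_numE // ltey.
have fa0 : 0 <= fine a by rewrite fine_ge0.
(* Gauss norms are infima, so each factor is approached strictly from above. *)
rewrite aE bE -!EFinM mulrA; apply: le_mul_gt => [|v' bv'].
  by rewrite mulr_ge0 // ltW.
have [u [gu uv']] : exists u, gamma_value X' nX' lam1 (restr (cone x) G) u /\ u < v'.
  by apply: gamma_norm_lt; rewrite -/(AXd lam1 G x) -/b bE lte_fin.
have u0 := gamma_value_ge0 gu; have v'0 : 0 <= v' by exact: ltW (le_lt_trans u0 uv').
rewrite mulrAC; apply: le_mul_gt => [|v av].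
  by rewrite mulr_ge0 // ltW.
apply: cone_fatou => [|w|r r0]; [exact: measurable_pairing_density|exact: pairing_density_ge0|].
have ae : (a < v%:E)%E by rewrite aE lte_fin.
have [x' [x'x [t [gt tv]]]] := a_lt _ _ ae r0; exists x'; split=> //.
have AD : cone_h x' h `<=` D by move=> w [[]].
apply: le_trans (trace_restr AD gt gu) _.
have t0 := gamma_value_ge0 gt.
rewrite lee_fin -!mulrA ler_wpM2l ?invr_ge0 ?(ltW sg) // ler_wpM2l // mulrC.
by apply: ler_pM => //; exact: ltW.
Qed.

End Cones.
(** * The stopping time *)

Section MeasureTools.
Context {R : realType}.

(** Sigma-finiteness is here a proved property of a bare measure; it is packed into the structures
    on which Tonelli's theorem is stated. *)
Lemma sigma_finite_tonelli d1 d2 (T1 : measurableType d1) (T2 : measurableType d2)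
    (m1 : {measure set T1 -> \bar R}) (m2 : {measure set T2 -> \bar R}) (f : T1 * T2 -> \bar R) :
  sigma_finite setT m1 -> sigma_finite setT m2 -> measurable_fun setT f ->
  (forall z, 0 <= f z)%E ->
  [/\ measurable_fun setT (fun x => \int[m2]_y f (x, y))%E,
      measurable_fun setT (fun y => \int[m1]_x f (x, y))%E &
      (\int[m1]_x \int[m2]_y f (x, y) = \int[m2]_y \int[m1]_x f (x, y))%E].
Proof.
move=> sf1 sf2 mf f0.
have i1 := @isSigmaFinite.Build _ _ _ (Measure.sort m1) sf1.
have j1 := @isSFinite.Build _ _ _ (Measure.sort m1) (sfinite_measure_sigma_finite sf1).
have i2 := @isSigmaFinite.Build _ _ _ (Measure.sort m2) sf2.
have j2 := @isSFinite.Build _ _ _ (Measure.sort m2) (sfinite_measure_sigma_finite sf2).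
pose s1 : {sigma_finite_measure set T1 -> \bar R} := HB.pack (Measure.sort m1) i1 j1.
pose s2 : {sigma_finite_measure set T2 -> \bar R} := HB.pack (Measure.sort m2) i2 j2.
split.
- exact: (measurable_fun_fubini_tonelli_F (m2 := s2) f mf f0).
- exact: (measurable_fun_fubini_tonelli_G (m1 := s1) f mf f0).
- exact: (fubini_tonelli (m1 := s1) (m2 := s2) f mf f0).
Qed.

Lemma le_poweR (q : R) (x y : \bar R) : 0 <= q -> (0 <= x -> x <= y -> x `^ q <= y `^ q)%E.
Proof.
move=> q0 x0 xy; apply: gt0_ler_poweR; rewrite ?in_itv //= ?leey ?andbT //.
exact: le_trans xy.
Qed.

Definition mean_pow d (T : measurableType d) (mu : {measure set T -> \bar R})
    (q : R) (B : set T) (f : T -> \bar R) : \bar R :=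
  (((fine (mu B))^-1%:E * \int[mu]_(y in B) (f y `^ q)) `^ q^-1)%E.

(** Chebyshev's inequality for the [q]-th power. If the mean is zero, [f] vanishes almost everywhere
    on [B]; if it is infinite, the set on the left is empty. *)
Lemma chebyshev_mean_pow d (T : measurableType d) (mu : {measure set T -> \bar R})
    (q M : R) (B : set T) (f : T -> \bar R) :
  measurable B -> (0 < mu B)%E -> (mu B < +oo)%E -> measurable_fun setT f ->
  (forall x, 0 <= f x)%E -> 0 < q -> 0 < M ->
  (mu (B `&` [set x | M%:E * mean_pow mu q B f < f x]) <= (M `^ q)^-1%:E * mu B)%E.
Proof.
move=> mB B0 Boo mf f0 q0 M0; set S := _ `&` _; set a := mean_pow mu q B f.
have a0 : (0 <= a)%E by exact: poweR_ge0.
have mS : measurable S.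
  apply: measurableI => //.
  have := mf measurableT _ (emeasurable_itv `](M%:E * a)%E, +oo[).
  rewrite setTI preimage_itvoy; congr measurable.
have [L LE] : exists L, mu B = L%:E by exists (fine (mu B)); rewrite fineK // ge0_fin_numE.
have L0 : 0 < L by rewrite -lte_fin -LE.
have q'0 : q^-1 != 0 by rewrite invr_eq0 gt_eqF.
have Mq : 0 < M `^ q by rewrite powR_gt0.
have mfq : measurable_fun setT (fun x => f x `^ q)%E.
  exact: (measurableT_comp (@measurable_poweR R q) mf).
have mfqB : measurable_fun B (fun x => f x `^ q)%E by exact: measurable_funTS.
have aE : a = (((L^-1)%:E * \int[mu]_(y in B) (f y `^ q)) `^ q^-1)%E by rewrite /a /mean_pow LE.
have SI : (\int[mu]_(x in S) (f x `^ q) <= \int[mu]_(x in B) (f x `^ q))%E.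
  by apply: (@lower_integral_subset _ _ _ mu S B (fun x => f x `^ q)%E) => [x []|x _]; rewrite ?poweR_ge0.
have I0 : (0 <= \int[mu]_(y in B) (f y `^ q))%E by apply: integral_ge0 => y _; exact: poweR_ge0.
move: I0 SI aE; case rE: (\int[mu]_(y in B) (f y `^ q))%E => [r||] //.
- rewrite lee_fin le_eqVlt => /predU1P[r0|r0] SI aE.
  + rewrite (_ : mu S = 0%E) ?mule_ge0 ?lee_fin ?invr_ge0 ?(ltW Mq) ?(ltW B0) //.
    (* On [S] the function is positive, so [+oo] times its power is infinite there, yet has integral
       zero over [B]; hence [S] is null. *)
    have H : (\int[mu]_(x in S) cst +oo x <= 0)%E.
      apply: (@le_trans _ _ (\int[mu]_(x in B) (+oo * f x `^ q))%E); last first.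
        rewrite ge0_integralZl //; last by move=> y _; exact: poweR_ge0.
        by rewrite rE -r0 mule0.
      apply: (@le_trans _ _ (\int[mu]_(x in S) (+oo * f x `^ q))%E).
        apply: ge0_le_lower_integral => [x _|x [_ /= Sx]]; first exact: leey.
        rewrite gt0_mulye // lt_neqAle poweR_ge0 andbT eq_sym poweR_eq0 // negb_and.
        rewrite gt_eqF //; apply: le_lt_trans Sx.
        by rewrite mule_ge0 // lee_fin ltW.
      apply: lower_integral_subset => [x []//|x _]; rewrite mule_ge0 //; exact: poweR_ge0.
    move: H; rewrite integral_cst //.
    have := measure_ge0 mu S; rewrite le_eqVlt => /predU1P[<-//|S0].
    by rewrite gt0_mulye // leNgt ltry.
  + have arE : a = ((L^-1 * r) `^ q^-1)%:E by rewrite aE -EFinM poweR_EFin.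
    have th0 : 0 < M `^ q * (L^-1 * r) by rewrite !mulr_gt0 // invr_gt0.
    have H : ((M `^ q * (L^-1 * r))%:E * mu S <= r%:E)%E.
      apply: le_trans SI; rewrite -integral_cst //; apply: ge0_le_lower_integral => [x _|x [_ /= Sx]].
        by rewrite lee_fin ltW.
      have -> : (M `^ q * (L^-1 * r))%:E = ((M%:E * a) `^ q)%E.
        rewrite arE -EFinM poweR_EFin; congr EFin.
        rewrite powRM ?powR_ge0 ?(ltW M0) // -powRrM mulVf ?gt_eqF // powRr1 //.
        by rewrite mulr_ge0 // ?invr_ge0 // ltW.
      apply: le_poweR; [exact: ltW|by rewrite mule_ge0 // lee_fin ltW|exact: ltW].
    rewrite LE -EFinM.
    have -> : (M `^ q)^-1 * L = (M `^ q * (L^-1 * r))^-1 * r.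
      by field; rewrite !gt_eqF.
    by rewrite EFinM lee_pdivlMl.
- move=> _ _ aE; rewrite (_ : S = set0) ?measure0 ?mule_ge0 ?lee_fin ?invr_ge0 ?(ltW Mq) ?(ltW B0) //.
  apply/seteqP; split => // x [_ /=]; rewrite -/a aE gt0_muley ?lte_fin ?invr_gt0 //.
  by rewrite poweRyr // gt0_muley ?lte_fin // ltNge leey.
Qed.

End MeasureTools.

Section CarlesonDuality.
Context {R : realType} (n : nat) (q : R) (q0 : 0 < q).
Local Notation T := (n.+1.-tuple R).
Local Notation V := (n.-tuple R).
Local Notation C := R[i].
Local Notation D := (@uhs R n).
Variables (lam : {measure set V -> \bar R}) (lam1 : {measure set T -> \bar R}).
Hypotheses (hlam : is_lebesgue_n lam) (hlam1 : is_lebesgue_n lam1).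
Variable X : normedModType C.
Variables (F : T -> X) (G : T -> X -> C).
Hypothesis mF : strongly_measurable setT (@Xnorm R X) D F.
Hypothesis mG : strongly_measurable (@is_Xdual R X) (@Xdual_norm R X) D G.

Local Notation ctr m := (@rball R n m).1.
Local Notation rad m := (@rball R n m).2.
Local Notation ball m := (eball (ctr m) (rad m)).

Let A r := lsc_env (AXh lam1 F r).
(** A measurable minorant of [Cq]: rational balls only, and envelopes in place of the area
    functionals. *)
Let C2 : V -> \bar R := rat_sup (fun m => mean_pow lam q (ball m) (A (rad m))).

Let A_ge0 r x : (0 <= A r x)%E.
Proof. by apply: lsc_env_ge0 => y; exact: gamma_norm_ge0. Qed.

Let A_le r x : (A r x <= AXh lam1 F r x)%E.
Proof. by apply: lsc_env_le => y; exact: gamma_norm_ge0. Qed.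

Let mA r : measurable_fun setT (A r). Proof. exact: measurable_lsc_env. Qed.

Let C2_ge0 x : (0 <= C2 x)%E.
Proof. by apply: rat_sup_ge0 => m; exact: poweR_ge0. Qed.

Let mC2 : measurable_fun setT C2. Proof. exact: measurable_rat_sup. Qed.

Let C2_le x : (C2 x <= Cq lam1 lam q F x)%E.
Proof.
pose S := [set cr : V * R | 0 < cr.2 /\ edist x cr.1 < cr.2].
pose val (cr : V * R) := mean_pow lam q (eball cr.1 cr.2) (AXh lam1 F cr.2).
have CqE : Cq lam1 lam q F x = ereal_sup (val @` S) by [].
have valS cr : S cr -> (val cr <= Cq lam1 lam q F x)%E.
  by move=> Scr; rewrite CqE; apply: ereal_sup_ubound; exists cr.
apply: rat_sup_le => [|m xm].
  apply: le_trans (valS (x, 1) _); first exact: poweR_ge0.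
  by split; rewrite //= edistxx.
apply: (@le_trans _ _ (val (rball n m))); last first.
  apply: valS; split=> //; exact: le_lt_trans (edist_ge0 _ _) xm.
apply: le_poweR; first by rewrite invr_ge0 ltW.
  rewrite mule_ge0 ?lee_fin ?invr_ge0 ?fine_ge0 //.
  by apply: integral_ge0 => y _; exact: poweR_ge0.
rewrite lee_wpmul2l ?lee_fin ?invr_ge0 ?fine_ge0 //.
apply: ge0_le_lower_integral => y _; first exact: poweR_ge0.
by apply: le_poweR; [exact: ltW|exact: A_ge0|exact: A_le].
Qed.

(** Its [q]-th power is twice the ratio of [(8 t)^n], the volume of a cube around a ball of radius
    [4 t], to [(2 t / n.+1)^n], the volume of a box inside a ball of radius [t]. *)
Definition good_const : R := (2 * (4 * n.+1%:R) ^+ n) `^ q^-1.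
Local Notation M := good_const.

Lemma good_const_gt0 : 0 < good_const.
Proof. by rewrite powR_gt0 // mulr_gt0 // exprn_gt0 // mulr_gt0 // ltr0n. Qed.

Lemma good_constX : good_const `^ q = 2 * (4 * n.+1%:R) ^+ n.
Proof.
by rewrite /good_const -powRrM mulVf ?gt_eqF // powRr1 // mulr_ge0 // exprn_ge0.
Qed.

Let E r := [set x : V | (A r x <= M%:E * C2 x)%E].

Let mE r : measurable (E r).
Proof.
have := measurable_lee measurableT (mA r) (measurable_funeM M%:E mC2).
by rewrite setTI.
Qed.

Let bad_set m : 0 < rad m ->
  (lam (ball m `\` E (rad m)) <= (M `^ q)^-1%:E * lam (ball m))%E.
Proof.
move=> r0; have mB := measurable_eball (ctr m) (rad m).
apply: le_trans (chebyshev_mean_pow mB (eball_gt0 hlam _ r0) (eball_fin hlam _ _)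
  (mA (rad m)) (A_ge0 (rad m)) q0 good_const_gt0).
apply: le_measure; rewrite ?inE; first exact: measurableD.
  apply: measurableI => //.
  have mAm := mA (rad m).
  have := mAm measurableT _ (emeasurable_itv `](M%:E * mean_pow lam q (ball m) (A (rad m)))%E, +oo[).
  by rewrite setTI preimage_itvoy.
move=> x [xm /= /negP]; rewrite -ltNge => H; split=> //=.
apply: le_lt_trans H; apply: lee_wpmul2l; first by rewrite lee_fin ltW // good_const_gt0.
exact: (rat_sup_ge (fun m => mean_pow lam q (ball m) (A (rad m))) xm).
Qed.

(** Half the volume of the box used inside the unit ball. *)
Definition density_const : R := 2^-1 * (2 * n.+1%:R^-1) ^+ n.
Local Notation kap := density_const.

Lemma density_const_gt0 : 0 < density_const.
Proof. by rewrite mulr_gt0 ?invr_gt0 // exprn_gt0 // mulr_gt0 // invr_gt0 ltr0n. Qed.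

(** A rational ball of radius between [2 t] and [4 t] with centre within [t] of [y] contains
    [eball y t]. By the choice of [good_const], its bad part takes at most half of the lower bound
    for the volume of [eball y t]. *)
Let good_set y t : 0 < t -> exists m, t < rad m /\
  ((kap * t ^+ n)%:E <= lam (eball y t `&` E (rad m)))%E.
Proof.
move=> t0; have t24 : 2 * t < 4 * t by lra.
have t20 : 0 <= 2 * t by lra.
have [m [ym /andP[m1 m2]]] := rballP y t0 t20 t24.
exists m; split; first lra.
have r0 : 0 < rad m by lra.
have mB := measurable_eball y t.
have sub : eball y t `<=` ball m.
  move=> z zy; have {}zy : edist z y < t := zy.
  by apply: le_lt_trans (edist_triangle z y (ctr m)) _; lra.
have H1 : (lam (eball y t) <= lam (eball y t `&` E (rad m)) + (kap * t ^+ n)%:E)%E.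
  rewrite (measureDI lam mB (mE (rad m))) addeC leeD2l //.
  apply: (@le_trans _ _ (lam (ball m `\` E (rad m)))).
    apply: le_measure; rewrite ?inE; [exact: measurableD|..].
      by apply: measurableD => //; exact: measurable_eball.
    by move=> z [/sub zm zE].
  apply: le_trans (bad_set r0) _.
  apply: (@le_trans _ _ ((M `^ q)^-1%:E * ((2 * (4 * t)) ^+ n)%:E)%E).
    apply: lee_wpmul2l; first by rewrite lee_fin invr_ge0 powR_ge0.
    apply: le_trans (eball_le hlam _ r0) _; rewrite lee_fin lerXn2r ?nnegrE; lra.
  rewrite -EFinM lee_fin good_constX /density_const.
  have N0 : n.+1%:R != 0 :> R by rewrite pnatr_eq0.
  have -> : (2 * (4 * t)) ^+ n = (4 * n.+1%:R) ^+ n * (2 * n.+1%:R^-1) ^+ n * t ^+ n.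
    by rewrite -!exprMn; congr (_ ^+ _); field.
  have : (4 * n.+1%:R) ^+ n != 0 :> R by rewrite expf_neq0 // mulf_neq0.
  by move: (_ ^+ n) => a a0; rewrite le_eqVlt; apply/orP; left; apply/eqP; field.
have := le_trans (eball_ge hlam y t0) H1.
have -> : (2 * (t / n.+1%:R)) ^+ n = kap * t ^+ n + kap * t ^+ n.
  have -> : (2 * (t / n.+1%:R)) ^+ n = (2 * n.+1%:R^-1) ^+ n * t ^+ n.
    by rewrite -exprMn; congr (_ ^+ _); ring.
  by rewrite /density_const; field.
by rewrite EFinD leeD2rE.
Qed.

Local Notation p w := (G w (F w)).
Local Notation g := (pairing_density F G).
Let gD := g \_ D.

Let gD_ge0 w : (0 <= gD w)%E.
Proof. by rewrite /gD /patch; case: ifPn => // /[!inE]; exact: pairing_density_ge0. Qed.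

Let mgD : measurable_fun setT gD.
Proof.
apply/(measurable_restrictT _ (@measurable_uhs R n)).
exact: measurable_pairing_density.
Qed.

(** Only radii of rational balls occur, so the union is countable and [U] is measurable. Its slices
    at [w] are large, and its slices at [x] are unions of truncated cones. *)
Let U : set (T * V) := [set wx | D wx.1 /\ edist (hy wx.1) wx.2 < ht wx.1] `&`
  \bigcup_m ([set wx | ht wx.1 < rad m] `&` [set wx | E (rad m) wx.2]).

Let mU : measurable U.
Proof.
apply: measurableI; first exact: measurable_cone_rel.
apply: bigcupT_measurable => m; apply: measurableI.
  have mht : measurable_fun setT (fun wx : T * V => ht wx.1).
    by apply: measurableT_comp; [exact: measurable_ht|exact: measurable_fst].
  by have := mht measurableT _ (measurable_itv `]-oo, rad m[);
    rewrite setTI preimage_itvNyo.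
have := @measurable_snd _ _ T V measurableT _ (mE (rad m)).
by rewrite setTI.
Qed.

Let f (wx : T * V) : \bar R := (gD wx.1 * (\1_U wx)%:E)%E.

Let f_ge0 wx : (0 <= f wx)%E. Proof. by rewrite mule_ge0 // lee_fin. Qed.

Let mf : measurable_fun setT f.
Proof.
apply: emeasurable_funM.
  by apply: measurableT_comp; [exact: mgD|exact: measurable_fst].
by apply/measurable_EFinP; exact: measurable_indic.
Qed.

(** The slice of [U] at [w] has measure at least [kap * ht w ^+ n]; multiplied by the weight
    [ht w ^- n.+1] this leaves [kap / ht w]. *)
Let inner_ge w : D w ->
  ((cabs (p w) / ht w)%:E <= kap^-1%:E * \int[lam]_x f (w, x))%E.
Proof.
move=> Dw; rewrite lee_pdivlMl ?density_const_gt0 //.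
have t0 : 0 < ht w by exact: Dw.
have [m [tm km]] := good_set (hy w) t0.
have gDE : gD w = g w by rewrite /gD /patch mem_set.
have -> : (\int[lam]_x f (w, x) = g w * lam (xsection U w))%E.
  transitivity (\int[lam]_x (g w * (\1_(xsection U w) x)%:E))%E.
    apply: eq_integral => x _; rewrite /f /= gDE; congr (_ * _%:E)%E.
    by rewrite !indicE mem_xsection.
  have mx : measurable (xsection U w) by exact: measurable_xsection.
  rewrite ge0_integralZl //; last exact: pairing_density_ge0.
    by rewrite integral_indic // setIT.
  by apply/measurable_EFinP; exact: measurable_indic.
apply: (@le_trans _ _ (g w * (kap * ht w ^+ n)%:E)%E).
  rewrite /pairing_density -!EFinM lee_fin /wt exprS.
  have tn : ht w ^+ n != 0 by rewrite expf_neq0 // gt_eqF.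
  have t1 : ht w != 0 by rewrite gt_eqF.
  by rewrite le_eqVlt; apply/orP; left; apply/eqP; field; rewrite tn.
rewrite lee_wpmul2l ?pairing_density_ge0 //; apply: le_trans km _.
apply: le_measure; rewrite ?inE.
- by apply: measurableI; [exact: measurable_eball|exact: mE].
- exact: measurable_xsection.
move=> x [/= xw Ex]; rewrite /xsection /= inE; split => /=.
  by split=> //; rewrite edistC.
by exists m.
Qed.

(** The good radii at [x] may have no largest element, so the slice of [U] at [x] is exhausted by
    finite stages, each of which is empty or lies in a single cone truncated at a good radius. *)
Let Q x k := [set w : T | cone x w /\
  exists m, [/\ (m <= k)%N, E (rad m) x & ht w < rad m]].

Let Q_sub x k : Q x k = set0 \/ exists r, E r x /\ Q x k `<=` cone_h x r.
Proof.
have [[m0 [m0k Em0]]|none] := pselect (exists m, (m <= k)%N /\ E (rad m) x); last first.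
  left; apply/seteqP; split => // w [_ [m [mk Em _]]].
  by apply: none; exists m.
right; pose P (m : 'I_k.+1) := `[< E (rad m) x >].
have P0 : P (inord m0) by apply/asboolP; rewrite /= inordK.
case: (@Order.TotalTheory.arg_maxP _ _ _ (inord m0 : 'I_k.+1) P (fun m : 'I_k.+1 => rad m) P0) => i /asboolP Ei imax.
exists (rad i); split=> // w [cw [m [mk Em wm]]]; split=> //.
apply: lt_le_trans wm _.
have := imax (inord m); rewrite /P /= inordK //; apply; exact/asboolP.
Qed.

Let mQ x k : measurable (Q x k).
Proof.
rewrite (_ : Q x k = \big[setU/set0]_(m < k.+1)
    (if `[< E (rad m) x >] then cone_h x (rad m) else set0)).
  apply: bigsetU_measurable => m _; case: ifP => // _; exact: measurable_cone_h.
rewrite -(bigcup_mkord _ (fun m => if `[< E (rad m) x >] then cone_h x (rad m) else set0)).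
apply/seteqP; split => [w [cw [m [mk Em wm]]]|w [m /= mk]].
  by exists m => //=; rewrite asboolT.
by case: asboolP => // Em [cw wm]; split=> //; exists m.
Qed.

(** On a nonempty stage the cone inequality applies at a radius [r] with [E r x], where the envelope
    is at most [M * C2 x] and hence at most [M] times [Cq]; Fatou's lemma passes to the whole
    slice. *)
Let inner_le x :
  (\int[lam1]_w f (w, x) <= (sigma2^-1 * 2 * M)%:E * (Cq lam1 lam q F x * AXd lam1 G x))%E.
Proof.
have K0 : 0 <= sigma2^-1 * 2 :> R by rewrite mulr_ge0 // invr_ge0 ltW // sigma2_gt0.
have b0 : (0 <= AXd lam1 G x)%E by exact: gamma_norm_ge0.
have M0 := good_const_gt0.
have mcone := measurable_cone x.
have QD k : Q x k `<=` D by move=> w [[]].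
apply: (@fatou_le _ _ _ _ setT (fun k => gD \_ (Q x k))) => //.
- move=> k; apply/(measurable_restrictT _ (mQ x k)); exact: measurable_funTS.
- by move=> k w _; rewrite /patch; case: ifP.
- move=> w _; apply: cvg_near_cst.
  have [[[Dw wx] [m _ [wm Em]]]|nU] := pselect (U (w, x)).
    exists m => // k /= mk; rewrite /f indicE mem_set ?mule1; last by split=> //; exists m.
    by rewrite /patch mem_set //; split=> //; exists m.
  near=> k; rewrite /f indicE memNset // mule0 /patch memNset //.
  move=> [[Dw wx] [m [mk Em wm]]]; apply: nU; split=> //; by exists m.
- move=> k.
  rewrite -integral_mkcond.
  rewrite (eq_integral g); last first.
    by move=> w /[!inE] /QD Dw; rewrite /gD /patch mem_set.
  have [->|[r [Er Qr]]] := Q_sub x k.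
    rewrite integral_set0; apply: mule_ge0; first by rewrite lee_fin mulr_ge0 // ltW.
    by apply: mule_ge0 => //; exact: le_trans (C2_ge0 x) (C2_le x).
  apply: (@le_trans _ _ (\int[lam1]_(w in cone_h x r) g w)%E).
    by apply: lower_integral_subset => // w [[Dw _] _]; exact: pairing_density_ge0.
  apply: le_trans (cone_pairing_le hlam1 mF mG x r) _.
  rewrite [X in (_ <= X)%E](_ : _ =
      (sigma2^-1 * 2)%:E * (M%:E * Cq lam1 lam q F x * AXd lam1 G x))%E; last first.
    by rewrite EFinM !muleA.
  rewrite lee_wpmul2l ?lee_fin // lee_wpmul2r //.
  apply: le_trans Er _; rewrite lee_wpmul2l ?lee_fin ?(ltW M0) //.
Unshelve. all: by end_near. Qed.

Lemma carleson_duality :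
  (\int[lam1]_(w in D) (cabs (p w) / ht w)%:E <=
    (kap^-1 * (sigma2^-1 * 2 * M))%:E *
    \int[lam]_x (Cq lam1 lam q F x * AXd lam1 G x))%E.
Proof.
have [mL mR tonelli] := sigma_finite_tonelli (lebesgue_sigma_finite hlam1)
  (lebesgue_sigma_finite hlam) mf f_ge0.
have k0 : 0 < kap^-1 by rewrite invr_gt0 density_const_gt0.
have K0 : 0 < sigma2^-1 * 2 * M :> R.
  by rewrite mulr_gt0 ?good_const_gt0 // mulr_gt0 // invr_gt0 sigma2_gt0.
have L0 w : (0 <= \int[lam]_x f (w, x))%E by exact: integral_ge0.
have R0 x : (0 <= \int[lam1]_w f (w, x))%E by exact: integral_ge0.
apply: (@le_trans _ _ (\int[lam1]_w (kap^-1%:E * \int[lam]_x f (w, x)))%E).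
  apply: (@le_trans _ _ (\int[lam1]_(w in D) (kap^-1%:E * \int[lam]_x f (w, x)))%E).
    apply: ge0_le_lower_integral => w Dw; last exact: inner_ge.
    by rewrite lee_fin divr_ge0 ?cabs_ge0 // ltW.
  by apply: lower_integral_subset => // w _; rewrite mule_ge0 // lee_fin ltW.
rewrite ge0_integralZl // ?lee_fin ?(ltW k0) // tonelli EFinM -muleA.
rewrite lee_wpmul2l ?lee_fin ?(ltW k0) //.
rewrite -lee_pdivrMl // -ge0_integralZl // ?lee_fin ?invr_ge0 ?(ltW K0) //.
apply: ge0_le_lower_integral => x _.
  by rewrite mule_ge0 // lee_fin invr_ge0 ltW.
by rewrite lee_pdivrMl //; exact: inner_le.
Qed.

End CarlesonDuality.

Theorem theorem4p8 (R : realType) (n : nat) (q : R) (hq : 0 < q)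
  (lam : {measure set (n.-tuple R) -> \bar R})
  (lam1 : {measure set (n.+1.-tuple R) -> \bar R})
  (hlam : is_lebesgue_n lam) (hlam1 : is_lebesgue_n lam1)
  (X : completeNormedModType R[i]) :
  exists c : R, 0 <= c /\
  forall (F : n.+1.-tuple R -> X) (G : n.+1.-tuple R -> X -> R[i]),
    strongly_measurable setT (@Xnorm R X) (uhs n) F ->
    strongly_measurable (@is_Xdual R X) (@Xdual_norm R X) (uhs n) G ->
    (\int[lam1]_(w in uhs n) (cabs (G w (F w)) / ht w)%:E
      <= c%:E * \int[lam]_x (Cq lam1 lam q F x * AXd lam1 G x))%E.
Proof.
(* The factors come from the density of the good sets, the trace inequality and the stopping
   threshold; none of them involves [F], [G] or [X]. *)
exists ((density_const n)^-1 * (sigma2^-1 * 2 * good_const n q)); split.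
  have sg := @sigma2_gt0 R; have gg := good_const_gt0 n q.
  by rewrite !mulr_ge0 ?invr_ge0 // ltW // density_const_gt0.
by move=> F G mF mG; apply: carleson_duality.
Qed.
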